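(* Let $n\geq 1$ be an integer, $\mu\in\mathbb{R}^n$ a unit vector, $\beta\in\mathbb{R}$, $a\geq 1$ and $0<s\leq a$. Assume in addition that $s>a(1-\beta)$ if $\beta\leq 1$. Let $\{t_k\}_{k=1}^\infty$ be a sequence of nonnegative real numbers converging to $0$ such that $$\sum_{k=1}^{\infty}t_k^{\frac{2s}{a}}<\infty\ \text{ if }\beta>1,\qquad \sum_{k=1}^{\infty}t_k^{2\left(\beta-1+\frac{s}{a}\right)}<\infty\ \text{ if }\beta\leq1.$$ Let $f\in H^s(\mathbb{R}^n)$. Then $$\lim_{k\rightarrow\infty}(2\pi)^{-n}S_{t_k,a}f(x+t_k^\beta\mu)=f(x)$$ for almost every $x\in\mathbb{R}^n$.
   Context: Fourier transform convention: $\widehat{f}(\xi)=\int_{\mathbb{R}^n}e^{-i\xi\cdot x}f(x)\,dx$. The Sobolev space $H^s(\mathbb{R}^n)$ is the set of tempered distributions $f$ with $\|f\|_{H^s(\mathbb{R}^n)}=\left(\int_{\mathbb{R}^n}(1+|\xi|^2)^s|\widehat f(\xi)|^2\,d\xi\right)^{1/2}<\infty$. For $t\geq0$, $a>0$, $\beta\in\mathbb{R}$ and a unit vector $\mu\in\mathbb{R}^n$, $$S_{t,a}f(x+t^\beta\mu)=\int_{\mathbb{R}^n}e^{i(x\cdot\xi+t^\beta\mu\cdot\xi)}e^{it|\xi|^a}\widehat f(\xi)\,d\xi,\qquad x\in\mathbb{R}^n,$$ where for general $f\in H^s(\mathbb{R}^n)$, $s\ge 0$, the integral is understood in the $L^2$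 (Plancherel) sense, i.e. $x\mapsto(2\pi)^{-n}S_{t,a}f(x+t^\beta\mu)$ is the $L^2$ function whose Fourier transform is $e^{i(t^\beta\mu\cdot\xi+t|\xi|^a)}\widehat f(\xi)$. *)

(* Defs.v *)
From HB Require Import structures.
From mathcomp Require Import all_boot all_order all_algebra.
From mathcomp Require Import all_classical all_reals all_analysis.
From mathcomp Require Import complex.

Set Implicit Arguments.
Unset Strict Implicit.
Unset Printing Implicit Defensive.

Import Order.TTheory GRing.Theory Num.Theory.
Import numFieldNormedType.Exports.

Local Open Scope classical_set_scope.
Local Open Scope ring_scope.
Local Open Scope complex_scope.

(* R^n is 'rV[R]_n, with the sigma-algebra generated by the coordinates,
   that is, the Borel sigma-algebra. *)
Definition rV_display : measure_display.
Proof. exact. Qed.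

Section measurable_rV.
Context (R : realType) (n : nat).

Let coord (i : 'I_n) (x : 'rV[R]_n) : R := x ord0 i.

Let rV_set0 : g_sigma_preimage coord set0.
Proof. exact: sigma_algebra0. Qed.

Let rV_setC A : g_sigma_preimage coord A -> g_sigma_preimage coord (~` A).
Proof. exact: sigma_algebraC. Qed.

Let rV_bigcup (F : (set 'rV[R]_n)^nat) :
  (forall i, g_sigma_preimage coord (F i)) ->
  g_sigma_preimage coord (\bigcup_i (F i)).
Proof. exact: sigma_algebra_bigcup. Qed.

HB.instance Definition _ := @isMeasurable.Build rV_display
  'rV[R]_n (g_sigma_preimage coord) rV_set0 rV_setC rV_bigcup.

End measurable_rV.

Lemma measurable_rV_coord (R : realType) (n : nat) (i : 'I_n) :
  measurable_fun [set: 'rV[R]_n] (fun x : 'rV[R]_n => x ord0 i).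
Proof.
move=> _ Y mY; rewrite setTI; apply: sub_sigma_algebra => /=.
rewrite -bigcup_seq/=; exists i => /=; first by rewrite mem_index_enum.
by exists Y => //; rewrite setTI.
Qed.

Lemma measurable_fun_rVP d (T : measurableType d) (R : realType) (n : nat)
    (f : T -> 'rV[R]_n) :
  measurable_fun [set: T] f <->
  forall i, measurable_fun [set: T] (fun t => f t ord0 i).
Proof.
split=> [mf i|mf].
  exact: (measurableT_comp (measurable_rV_coord i) mf).
suff : preimage_set_system setT f measurable `<=` measurable.
  by move=> fm _ A mA; apply: fm; exists A.
rewrite -[X in preimage_set_system _ _ X]/(g_sigma_preimage
  (fun (i : 'I_n) (x : 'rV[R]_n) => x ord0 i)).
rewrite -g_sigma_preimage_comp.
apply: smallest_sub; first exact: sigma_algebra_measurable.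
case: n => [|n] in f mf *; first by rewrite big_ord0.
rewrite -bigcup_mkord_ord; apply: bigcup_sub => i Ii.
by move=> A [B mB <-]; exact: mf.
Qed.

Definition rV_cons (R : realType) (n : nat) (p : measurableTypeR R * 'rV[R]_n) :
    'rV[R]_n.+1 :=
  row_mx (p.1%:M : 'rV[R]_1) p.2.

Definition rV_uncons (R : realType) (n : nat) (x : 'rV[R]_n.+1) :
    measurableTypeR R * 'rV[R]_n :=
  (x ord0 ord0, rsubmx (x : 'rV[R]_(1 + n))).

Lemma rV_consK (R : realType) (n : nat) :
  cancel (@rV_cons R n) (@rV_uncons R n).
Proof.
move=> [r x]; rewrite /rV_uncons /rV_cons/= row_mxKr; congr pair.
apply: (@etrans _ _ (row_mx (r%:M : 'rV[R]_1) x ord0 (lshift n ord0))).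
  by congr (fun_of_matrix _ _ _); exact/val_inj.
by rewrite row_mxEl mxE eqxx mulr1n.
Qed.

Lemma measurable_rV_cons (R : realType) (n : nat) :
  measurable_fun [set: measurableTypeR R * 'rV[R]_n] (@rV_cons R n).
Proof.
apply/measurable_fun_rVP => i.
case: (@split_ordP 1 n i) => j ->.
  rewrite (_ : (fun t => _) = fst)//; apply/funext => t.
  by apply: etrans (row_mxEl _ _ _ _) _; rewrite [j]ord1 mxE eqxx mulr1n.
rewrite (_ : (fun t => _) = (fun x : 'rV[R]_n => x ord0 j) \o snd).
  exact: (measurableT_comp (measurable_rV_coord j)).
by apply/funext => t; exact: row_mxEr.
Qed.

Lemma measurable_rV_uncons (R : realType) (n : nat) :
  measurable_fun [set: 'rV[R]_n.+1] (@rV_uncons R n).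
Proof.
apply/measurable_fun_pairP; split; first exact: measurable_rV_coord.
apply/measurable_fun_rVP => i.
rewrite (_ : (fun t => _) = (fun x : 'rV[R]_n.+1 => x ord0 (rshift 1 i))).
  exact: measurable_rV_coord.
by apply/funext => t; exact: mxE.
Qed.

(* Lebesgue measure on R^(n+1) as the product of those on R and on R^n *)
Section rV_prod.
Context (R : realType) (n : nat).
Variable m : {sigma_finite_measure set 'rV[R]_n -> \bar R}.

Definition rV_prod : set 'rV[R]_n.+1 -> \bar R :=
  pushforward (lebesgue_measure \x m)%E (@rV_cons R n).

HB.instance Definition _ := Measure.copy rV_prod
  (measure_function_pushforward__canonical__measure_function_Measure
     (lebesgue_measure \x m)%E (@measurable_rV_cons R n)).

Let rV_prod_sigma_finite : sigma_finite setT rV_prod.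
Proof.
have /sigma_finiteP[F [TF ndF Foo]] := sigma_finiteT (@lebesgue_measure R).
have /sigma_finiteP[G [TG ndG Goo]] := sigma_finiteT m.
exists (fun k => @rV_uncons R n @^-1` (F k `*` G k)).
  rewrite -preimage_bigcup (_ : \bigcup_k _ = setT) ?preimage_setT//.
  rewrite -setXTT TF TG predeqE => -[x y]; split=> [[k _ []/= ? ?]|].
    by split; exists k.
  move=> [/= [k _ Fkx] [l _ Gly]]; exists (maxn k l) => //; split.
  - by move: x Fkx; exact/subsetPset/ndF/leq_maxl.
  - by move: y Gly; exact/subsetPset/ndG/leq_maxr.
move=> k; have [? ?] := Foo k; have [? ?] := Goo k; split.
  rewrite -[X in measurable X]setTI; apply: measurable_rV_uncons => //.
  exact: measurableX.
rewrite /rV_prod /pushforward -comp_preimage.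
rewrite (_ : _ \o _ = id); last by apply/funext => p; exact: rV_consK.
by rewrite preimage_id product_measure1E// lte_mul_pinfty// ge0_fin_numE.
Qed.

HB.instance Definition _ :=
  Measure_isSigmaFinite.Build _ _ _ rV_prod rV_prod_sigma_finite.

End rV_prod.

Fixpoint lebesgue_rV (R : realType) (n : nat) :
    {sigma_finite_measure set 'rV[R]_n -> \bar R} :=
  match n with
  | 0%N => \d_(0 : 'rV[R]_0)
  | m.+1 => rV_prod (lebesgue_rV R m)
  end.

Lemma lebesgue_rV_box (R : realType) (n : nat) (a b : 'rV[R]_n) :
  (forall i, a ord0 i <= b ord0 i) ->
  lebesgue_rV R n [set x | forall i, x ord0 i \in `[a ord0 i, b ord0 i]] =
  (\prod_(i < n) (b ord0 i - a ord0 i))%:E.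
Proof.
elim: n a b => [|n IHn] a b ab.
  rewrite big_ord0 /= diracE mem_set//.
  by move=> -[].
set a' : 'rV[R]_n := (rV_uncons a).2; set b' : 'rV[R]_n := (rV_uncons b).2.
have a'E i : a' ord0 i = a ord0 (lift ord0 i).
  by rewrite /a' mxE; congr (fun_of_matrix _ _ _); exact/val_inj.
have b'E i : b' ord0 i = b ord0 (lift ord0 i).
  by rewrite /b' mxE; congr (fun_of_matrix _ _ _); exact/val_inj.
have ab' i : a' ord0 i <= b' ord0 i by rewrite a'E b'E.
rewrite big_ord_recl EFinM.
have -> : (\prod_(i < n) (b ord0 (lift ord0 i) - a ord0 (lift ord0 i)) =
  \prod_(i < n) (b' ord0 i - a' ord0 i))%R.
  by apply: eq_bigr => i _; rewrite a'E b'E.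
rewrite -(IHn _ _ ab').
have consE p i : @rV_cons R n p ord0 (lift ord0 i) = p.2 ord0 i.
  rewrite -(row_mxEr (p.1%:M : 'rV[R]_1) p.2 ord0 i).
  by congr (fun_of_matrix _ _ _); exact/val_inj.
have cons0 p : @rV_cons R n p ord0 ord0 = p.1.
  exact: (congr1 fst (rV_consK p)).
have -> : (b ord0 ord0 - a ord0 ord0)%:E =
    lebesgue_measure (`[a ord0 ord0, b ord0 ord0] : set R).
  rewrite lebesgue_measure_itv /= lte_fin.
  by case: ltgtP (ab ord0) => // -> _; rewrite subrr.
rewrite -product_measure1E//; last first.
  rewrite [X in measurable X](_ : _ = \bigcap_(i in [set: 'I_n])
     ((fun x : 'rV[R]_n => x ord0 i) @^-1` `[a' ord0 i, b' ord0 i])).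
    apply: fin_bigcap_measurable => // i _.
    rewrite -[X in measurable X]setTI.
    by apply: measurable_rV_coord => //; exact: measurable_itv.
  by apply/seteqP; split=> [x /= h i _|x /= h i]; exact: h.
rewrite /= /rV_prod /pushforward.
congr (_ _); apply/seteqP; split=> [p /= bp|p [/= p1 p2] i].
- split=> [|i /=]; first by have := bp ord0; rewrite cons0.
  by have := bp (lift ord0 i); rewrite consE a'E b'E.
- case: (unliftP ord0 i) => [j|] ->; first by rewrite consE -a'E -b'E.
  by rewrite cons0.
Qed.

Section euclidean.
Context (R : realType) (n : nat).
Implicit Types x y : 'rV[R]_n.

Definition dot x y : R := \sum_(i < n) x ord0 i * y ord0 i.

(* the norm `|x| of the library on 'rV[R]_n is the sup norm *)
Definition enorm x : R := Num.sqrt (\sum_(i < n) x ord0 i ^+ 2).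

End euclidean.

Section complex_valued.
Context (R : realType).

(* the modulus as an element of R; the library norm `|z| lies in R[i] *)
Definition cabs (z : R[i]) : R := complex.Re `|z|.

Definition expi (theta : R) : R[i] := cos theta +i* sin theta.

Context (n : nat).
Implicit Types f : 'rV[R]_n -> R[i].

Definition reF f : 'rV[R]_n -> R := fun x => complex.Re (f x).
Definition imF f : 'rV[R]_n -> R := fun x => complex.Im (f x).

Definition cmeasurable f :=
  measurable_fun setT (reF f) /\ measurable_fun setT (imF f).

Definition cintegrable f :=
  (lebesgue_rV R n).-integrable setT (EFin \o reF f) /\
  (lebesgue_rV R n).-integrable setT (EFin \o imF f).

Definition cintegral f : R[i] :=
  Rintegral (lebesgue_rV R n) setT (reF f) +i*
  Rintegral (lebesgue_rV R n) setT (imF f).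

Definition L2 f :=
  cmeasurable f /\
  (\int[lebesgue_rV R n]_x (cabs (f x) ^+ 2)%:E < +oo)%E.

End complex_valued.

Section distributions.
Context (R : realType) (n : nat).
Implicit Types (f g F phi psi : 'rV[R]_n -> R[i]).

Definition basis_vec (i : 'I_n) : 'rV[R]_n := delta_mx ord0 i.

Definition partial (i : 'I_n) phi : 'rV[R]_n -> R[i] := fun x =>
  'D_(basis_vec i) (reF phi) x +i* 'D_(basis_vec i) (imF phi) x.

Definition partials (l : seq 'I_n) phi : 'rV[R]_n -> R[i] :=
  foldr partial phi l.

(* Existence of all iterated partial derivatives alone would not give
   smoothness, but it does with the bounds of the second clause. *)
Definition schwartz phi :=
  (forall l i x, derivable (reF (partials l phi)) x (basis_vec i) /\
                 derivable (imF (partials l phi)) x (basis_vec i)) /\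
  (forall (N : nat) l, exists C : R, forall x,
     (1 + enorm x) ^+ N * cabs (partials l phi x) <= C).

Definition schwartz_seminorm (N : nat) phi : R :=
  sup [set r : R | exists x l, (size l <= N)%N /\
    r = (1 + enorm x) ^+ N * cabs (partials l phi x)].

(* Distributions are seen as functionals on all functions R^n -> C; only the
   values at Schwartz functions are meaningful. *)
Definition functional := ('rV[R]_n -> R[i]) -> R[i].

Definition tempered (T : functional) :=
  (forall (c : R[i]) phi psi, schwartz phi -> schwartz psi ->
     T (fun x => c * phi x + psi x) = c * T phi + T psi) /\
  (exists (C : R) (N : nat), forall phi, schwartz phi ->
     cabs (T phi) <= C * schwartz_seminorm N phi).

Definition distr_of f : functional :=
  fun phi => cintegral (fun x => f x * phi x).

(* T is (integration against) the function f *)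
Definition represents f (T : functional) :=
  cmeasurable f /\
  forall phi, schwartz phi ->
    cintegrable (fun x => f x * phi x) /\ T phi = distr_of f phi.

Definition fourier phi : 'rV[R]_n -> R[i] := fun xi =>
  cintegral (fun x => expi (- dot xi x) * phi x).

Definition fourier_distr (T : functional) : functional :=
  fun phi => T (fourier phi).

(* the H^s norm of the distribution whose Fourier transform is F *)
Definition sobolev_norm (s : R) F : \bar R :=
  ((\int[lebesgue_rV R n]_xi
      ((1 + enorm xi ^+ 2) `^ s * cabs (F xi) ^+ 2)%:E) `^ 2^-1)%E.

Definition sobolev (s : R) (T : functional) :=
  tempered T /\
  exists F, represents F (fourier_distr T) /\ (sobolev_norm s F < +oo)%E.

(* u is x |-> S_{t,a} f (x + t^beta mu), where f is the distribution T:
   (2 pi)^-n u is the L^2 function whose Fourier transform is the Fourier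
   transform of T multiplied by the symbol. *)
Definition is_evolution (a beta : R) (mu : 'rV[R]_n) (t : R)
    (T : functional) (u : 'rV[R]_n -> R[i]) :=
  let g := fun x => ((2 * pi) ^- n)%:C * u x in
  L2 g /\
  forall F, represents F (fourier_distr T) ->
    represents
      (fun xi => expi (t `^ beta * dot mu xi + t * enorm xi `^ a) * F xi)
      (fourier_distr (distr_of g)).

End distributions.

(* Main.v *)
(* If h is locally integrable and its Fourier transform is a function H, pairing
   h with the wave packets whose Fourier transforms are Gaussians shows that
   int |h|^2 <= C int |H|^2. We apply this to h = (2 pi)^-n S_{t_k} f - f, where
   H = (e^{i theta} - 1) F and
   |e^{i theta} - 1| <= C t_k^delta (1 + |xi|^2)^{s/2}. The exponents are such
   that the bounds on int |h|^2 are summable in k, so sum_k |h_k(x)|^2 is finite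
   for almost every x and its terms tend to 0.

   For the L^2 inequality, multiplying h * gaussian = (inverse transform of a
   damped H) by chi and using 2 a b <= a^2 + b^2 gives
   2 <h * G_r, chi> <= |H|^2 + |chi|^2 after normalisation, for chi a bounded
   function times a fixed Gaussian. As r -> 0 this becomes 2 <h, chi> <= |H|^2 +
   |chi|^2 for chi continuous along rays, hence for chi in the closure under
   bounded pointwise limits, in particular for simple functions; chi increasing
   to the positive part of h concludes. *)

Require Import Defs.
From mathcomp Require Import all_boot all_order all_algebra.
From mathcomp Require Import all_classical all_reals all_analysis.
From mathcomp Require Import measurable_realfun lebesgue_integral_under.
From mathcomp Require Import complex ring lra.

Set Implicit Arguments.
Unset Strict Implicit.
Unset Printing Implicit Defensive.

Import Order.TTheory GRing.Theory Num.Theory.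
Import numFieldNormedType.Exports.

Local Open Scope classical_set_scope.
Local Open Scope ring_scope.

(** * Integrals against bounded kernels *)

(** Plancherel's theorem cannot be quoted for h: [represents] makes f integrable against Schwartz
    functions only, so h is not known to be square integrable and the finiteness of int |h|^2 is
    part of the claim. The absorption of int |chi|^2 is therefore carried out on simple functions
    times Gaussians, where every term is finite. Of the two Gaussian factors in chi = p gauss^2, one
    makes chi integrable and the other pays for the exchange of integrals.

    The constants are not sharp: in int |h|^2 <= 4 int |H|^2 one factor 2 comes from positive and
    negative parts, the other from real and imaginary parts.

    The exponent delta comes from |sin x| <= |x|^v for 0 <= v <= 1. The phase t |xi|^a takes v =
    s/a, which uses the full weight of H^s. When beta <= 1, the phase t^beta mu.xi takes v =
    delta/beta with delta = beta - 1 + s/a; the conditions on s give 0 < delta <= beta and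
    delta/beta <= s, so this phase costs no more weight than the other one. *)

Section bounded_kernel.
Context d1 d2 (T1 : measurableType d1) (T2 : measurableType d2) (R : realType).
Variables (m1 : {sigma_finite_measure set T1 -> \bar R})
  (m2 : {sigma_finite_measure set T2 -> \bar R}).
Variables (u : T1 -> R) (v : T2 -> R) (b : T1 * T2 -> R) (M : R).
Hypotheses (iu : m1.-integrable setT (EFin \o u))
  (iv : m2.-integrable setT (EFin \o v))
  (mb : measurable_fun setT b) (bM : forall p, `|b p| <= M).

Let F (p : T1 * T2) : \bar R := (u p.1 * (v p.2 * b p))%:E.

Let mu : measurable_fun setT u.
Proof. by move/measurable_int : iu => /measurable_EFinP. Qed.

Let mv : measurable_fun setT v.
Proof. by move/measurable_int : iv => /measurable_EFinP. Qed.

Let mF : measurable_fun setT F.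
Proof.
apply/measurable_EFinP; apply: measurable_funM.
  exact: measurableT_comp.
by apply: measurable_funM => //; exact: measurableT_comp.
Qed.

Let integrable_F : (m1 \x m2)%E.-integrable setT F.
Proof.
(* Tonelli with the product majorant |M| |u x| |v y|; the absolute value makes the constant
   nonnegative without exhibiting a point. *)
apply/integrable12ltyP => //; apply: (@le_lt_trans _ _
  (\int[m1]_x (`|M|%:E * (`|u x|%:E * \int[m2]_y `|v y|%:E)))%E).
  apply: ge0_le_integral => //.
  - by move=> x _; exact: integral_ge0.
  - have maF : measurable_fun setT (abse \o F) by exact: measurableT_comp.
    apply: (measurable_fun_fubini_tonelli_F (m2:=m2) (abse \o F)) => // p; exact: abse_ge0.
  - apply: emeasurable_funM => //; apply: emeasurable_funM => //.
    by apply/measurable_EFinP; exact: measurableT_comp.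
  move=> x _; rewrite -ge0_integralZl//; last first.
    by apply/measurable_EFinP; exact: measurableT_comp.
  rewrite -ge0_integralZl//; last first.
    by apply: measurable_funeM; apply/measurable_EFinP; exact: measurableT_comp.
  apply: ge0_le_integral => //.
  - by apply: measurableT_comp => //; exact: (measurableT_comp mF).
  - do 2 apply: measurable_funeM; apply/measurable_EFinP.
    exact: measurableT_comp.
  move=> y _; rewrite /F /= -!EFinM lee_fin !normrM mulrA mulrC.
  by rewrite ler_wpM2r// (le_trans (bM _))// ler_norm.
move: iu iv => /integrableP[_ fu] /integrableP[_ fv].
have v0 : (0 <= \int[m2]_y `|v y|%:E)%E by exact: integral_ge0.
rewrite ge0_integralZl//; last 2 first.
- by apply: emeasurable_funM => //; apply/measurable_EFinP; exact: measurableT_comp.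
- by move=> x _; rewrite mule_ge0.
rewrite ge0_integralZr//; last by apply/measurable_EFinP; exact: measurableT_comp.
apply: lte_mul_pinfty => //.
apply: lte_mul_pinfty => //; first exact: integral_ge0.
by rewrite ge0_fin_numE; [exact: fu|exact: integral_ge0].
Qed.

Lemma integrable_bounded_kernel1 x :
  m2.-integrable setT (fun y => (v y * b (x, y))%:E).
Proof.
apply: (@le_integrable _ _ _ _ _ measurableT _ (fun y => (M * v y)%:E)).
- apply/measurable_EFinP; apply: measurable_funM => //.
  exact: measurableT_comp.
- move=> y _ /=; rewrite lee_fin normrM mulrC [leRHS]normrM ler_wpM2r//.
  exact: le_trans (bM _) (ler_norm _).
- by under eq_fun do rewrite EFinM; exact: integrableZl.
Qed.

Lemma integrable_bounded_kernel2 y :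
  m1.-integrable setT (fun x => (u x * b (x, y))%:E).
Proof.
apply: (@le_integrable _ _ _ _ _ measurableT _ (fun x => (M * u x)%:E)).
- apply/measurable_EFinP; apply: measurable_funM => //.
  exact: measurableT_comp.
- move=> x _ /=; rewrite lee_fin normrM mulrC [leRHS]normrM ler_wpM2r//.
  exact: le_trans (bM _) (ler_norm _).
- by under eq_fun do rewrite EFinM; exact: integrableZl.
Qed.

Let F1E x : (\int[m2]_y F (x, y) =
  (u x * \int[m2]_y (v y * b (x, y)))%:E)%E.
Proof.
rewrite /F/= EFinM /Rintegral fineK; last first.
  by apply: integrable_fin_num => //; exact: integrable_bounded_kernel1.
rewrite -integralZl//.
exact: integrable_bounded_kernel1.
Qed.

Let F2E y : (\int[m1]_x F (x, y) =
  (v y * \int[m1]_x (u x * b (x, y)))%:E)%E.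
Proof.
rewrite /F/= EFinM /Rintegral fineK; last first.
  by apply: integrable_fin_num => //; exact: integrable_bounded_kernel2.
rewrite -integralZl//; last exact: integrable_bounded_kernel2.
by apply: eq_integral => x _; rewrite -EFinM mulrCA.
Qed.

Lemma integrable_kernel1 : m1.-integrable setT
  (fun x => (u x * \int[m2]_y (v y * b (x, y)))%:E).
Proof.
by apply: eq_integrable (integrable_fubini_F integrable_F) => // x _; exact: F1E.
Qed.

Lemma Rintegral_kernel_exchange :
  \int[m1]_x (u x * \int[m2]_y (v y * b (x, y))) =
  \int[m2]_y (v y * \int[m1]_x (u x * b (x, y))).
Proof.
have := Fubini integrable_F.
under eq_integral do rewrite F1E.
by under [X in _ = X -> _]eq_integral do rewrite F2E; rewrite /Rintegral => ->.
Qed.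

End bounded_kernel.

(** * Lebesgue integration on R^n *)

Section affine_line.
Variable R : realType.
Variables (a r : R) (r0 : 0 < r).
Let phi (z : measurableTypeR R) : measurableTypeR R := a + r * z.

Let mphi : measurable_fun setT phi.
Proof.
by apply: measurable_funD => //; apply: measurable_funM.
Qed.

Let nu : {measure set (measurableTypeR R) -> \bar R} :=
  mscale (NngNum (ltW r0))
    (measure_function_pushforward__canonical__measure_function_Measure
       lebesgue_measure mphi).

(** The scaled image measure gives every interval []x, y]] its length, and this characterises
    Lebesgue measure. *)
Let nuE A : measurable A -> lebesgue_measure A = nu A.
Proof.
apply: lebesgue_measure_unique => _ [[x y] _ <-] /=.
rewrite /nu /mscale /= /pushforward.
have -> : phi @^-1` `]x, y] = `](x - a) / r, (y - a) / r]%classic.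
  apply/seteqP; split => z /=; rewrite !in_itv/= ltr_pdivrMr// ler_pdivlMr//;
    by rewrite ltrBlDl lerBrDl mulrC.
rewrite !lebesgue_measure_itv/= !lte_fin ltr_pM2r ?invr_gt0// ltrD2r.
case: ifPn => _; last by rewrite mule0.
rewrite -!EFinB -EFinM -mulrBl mulrC divfK ?gt_eqF//; congr (_%:E); ring.
Qed.

Lemma ge0_integral_affine_line (f : R -> \bar R) :
  measurable_fun [set: measurableTypeR R] f -> (forall x, 0 <= f x)%E ->
  (r%:E * \int[lebesgue_measure]_z f (a + r * z)%R =
   \int[lebesgue_measure]_z f z)%E.
Proof.
move=> mf f0; rewrite [RHS](eq_measure_integral nu); last first.
  by move=> A mA _; exact: nuE.
rewrite ge0_integral_mscale//=; congr (_ * _)%E.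
by rewrite ge0_integral_pushforward.
Qed.

End affine_line.

Section integral_rV.
Variables (R : realType) (n : nat).

Lemma ge0_integral_rV (F : 'rV[R]_n.+1 -> \bar R) :
  measurable_fun setT F -> (forall x, 0 <= F x)%E ->
  (\int[lebesgue_rV R n.+1]_x F x =
   \int[lebesgue_measure]_r \int[lebesgue_rV R n]_v F (@rV_cons R n (r, v)))%E.
Proof.
move=> mF F0.
have -> : (\int[lebesgue_rV R n.+1]_x F x =
  \int[pushforward (lebesgue_measure \x lebesgue_rV R n)%E (@rV_cons R n)]_x F x)%E.
  by [].
rewrite ge0_integral_pushforward//; last exact: measurable_rV_cons.
have mFc : measurable_fun setT (F \o @rV_cons R n).
  by apply: measurableT_comp => //; exact: measurable_rV_cons.
have Fc0 p : (0 <= (F \o @rV_cons R n) p)%E by exact: F0.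
by rewrite fubini_tonelli1.
Qed.

Lemma integral_rV (F : 'rV[R]_n.+1 -> R) :
  (lebesgue_rV R n.+1).-integrable setT (EFin \o F) ->
  (\int[lebesgue_rV R n.+1]_x (F x)%:E =
   \int[lebesgue_measure]_r \int[lebesgue_rV R n]_v (F (@rV_cons R n (r, v)))%:E)%E.
Proof.
move=> iF; have mF := measurable_int _ iF.
have mc := @measurable_rV_cons R n.
have iFc : (lebesgue_measure \x lebesgue_rV R n)%E.-integrable setT
    ((EFin \o F) \o @rV_cons R n).
  apply/integrableP; split; first exact: measurableT_comp.
  have /integrableP[_] := iF.
  rewrite (_ : (\int[lebesgue_rV R n.+1]_x _ = \int[pushforward (lebesgue_measure \x lebesgue_rV R n)%E (@rV_cons R n)]_x `|(EFin \o F) x|)%E)//.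
  rewrite ge0_integral_pushforward//; exact: measurableT_comp.
rewrite (_ : (\int[lebesgue_rV R n.+1]_x _ =
  \int[pushforward (lebesgue_measure \x lebesgue_rV R n)%E (@rV_cons R n)]_x (EFin \o F) x)%E)//.
by rewrite integral_pushforward//= -(integral12_prod_meas1 iFc).
Qed.

End integral_rV.

Lemma measurable_affine (R : realType) (n : nat) (a : 'rV[R]_n) (r : R) :
  measurable_fun setT (fun z : 'rV[R]_n => a + r *: z).
Proof.
apply/measurable_fun_rVP => i.
rewrite (_ : (fun _ => _) = fun z : 'rV[R]_n => a ord0 i + r * z ord0 i); last first.
  by apply/funext => z; rewrite !mxE.
by apply: measurable_funD => //; apply: measurable_funM => //; exact: measurable_rV_coord.
Qed.

Lemma rV_cons0 (R : realType) (n : nat) (p : measurableTypeR R * 'rV[R]_n) :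
  rV_cons p ord0 ord0 = p.1.
Proof. exact: (congr1 fst (rV_consK p)). Qed.

Lemma rV_cons_lift (R : realType) (n : nat) (p : measurableTypeR R * 'rV[R]_n) i :
  rV_cons p ord0 (lift ord0 i) = p.2 ord0 i.
Proof.
rewrite -(row_mxEr (p.1%:M : 'rV[R]_1) p.2 ord0 i).
by congr (fun_of_matrix _ _ _); exact/val_inj.
Qed.

Lemma rV_uncons_lift (R : realType) (n : nat) (x : 'rV[R]_n.+1) i :
  (rV_uncons x).2 ord0 i = x ord0 (lift ord0 i).
Proof.
by rewrite /rV_uncons/= mxE; congr (fun_of_matrix _ _ _); exact/val_inj.
Qed.

Lemma rV_cons_affine (R : realType) (n : nat) (a : 'rV[R]_n.+1) (r z : R)
    (v : 'rV[R]_n) :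
  a + r *: @rV_cons R n (z, v) =
  @rV_cons R n (a ord0 ord0 + r * z, (rV_uncons a).2 + r *: v).
Proof.
apply/rowP => i; rewrite mxE [X in _ + X = _]mxE.
case: (unliftP ord0 i) => [j|] ->.
  by rewrite !rV_cons_lift/= -rV_uncons_lift [RHS]mxE [X in _ = _ + X]mxE.
by rewrite !rV_cons0.
Qed.

(** Induction on the dimension: by [rV_cons_affine] the map splits into an affine map of the line,
    contributing one factor [r], and an affine map of the remaining coordinates. *)
Lemma ge0_integral_affine (R : realType) (n : nat) (a : 'rV[R]_n) (r : R)
    (F : 'rV[R]_n -> \bar R) : 0 < r ->
  measurable_fun setT F -> (forall x, 0 <= F x)%E ->
  ((r ^+ n)%:E * \int[lebesgue_rV R n]_z F (a + r *: z)%R =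
   \int[lebesgue_rV R n]_z F z)%E.
Proof.
move=> r0; elim: n a F => [|n IHn] a F mF F0.
  by rewrite expr0 mul1e; apply: eq_integral => z _; congr F; apply/rowP => -[].
have mFc : measurable_fun setT (F \o @rV_cons R n).
  by apply: measurableT_comp => //; exact: measurable_rV_cons.
have mFz z : measurable_fun setT (fun v => F (@rV_cons R n (z, v))).
  by apply: (measurableT_comp mFc); exact: pair1_measurable.
have mG : measurable_fun [set: measurableTypeR R]
    (fun z => \int[lebesgue_rV R n]_v F (@rV_cons R n (z, v)))%E.
  apply: (measurable_fun_fubini_tonelli_F (m2:=lebesgue_rV R n)
    (F \o @rV_cons R n)) => // p; exact: F0.
rewrite !ge0_integral_rV//; last first.
  by apply: measurableT_comp => //; exact: measurable_affine.
rewrite -(ge0_integral_affine_line (a ord0 ord0) r0 mG); last first.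
  by move=> x; exact: integral_ge0.
rewrite exprS EFinM -muleA; congr (_ * _)%E.
have rn0 : 0 <= r ^+ n by rewrite exprn_ge0// ltW.
rewrite -ge0_integralZl//; last 2 first.
- apply: (measurable_fun_fubini_tonelli_F (m2:=lebesgue_rV R n)
    (fun p => F (a + r *: @rV_cons R n p))); last by move=> p; exact: F0.
  apply: measurableT_comp => //.
  by apply: (measurableT_comp (measurable_affine _ _)); exact: measurable_rV_cons.
- by move=> x _; exact: integral_ge0.
apply: eq_integral => z _.
rewrite -[RHS](IHn (rV_uncons a).2)//; congr (_ * _)%E.
by apply: eq_integral => v _; rewrite rV_cons_affine.
Qed.

Lemma integral_affine (R : realType) (n : nat) (a : 'rV[R]_n) (r : R)
    (F : 'rV[R]_n -> R) : 0 < r ->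
  (lebesgue_rV R n).-integrable setT (EFin \o F) ->
  (lebesgue_rV R n).-integrable setT (fun z => (F (a + r *: z))%:E) /\
  r ^+ n * \int[lebesgue_rV R n]_z F (a + r *: z) =
  \int[lebesgue_rV R n]_z F z.
Proof.
move=> r0 iF; have rn0 : 0 < r ^+ n by rewrite exprn_gt0.
have mF : measurable_fun setT (EFin \o F) by exact: measurable_int iF.
have iFa : (lebesgue_rV R n).-integrable setT (fun z => (F (a + r *: z))%:E).
  apply/integrableP; split.
    by apply: measurableT_comp mF _; exact: measurable_affine.
  have /integrableP[_] := iF.
  rewrite -(ge0_integral_affine a r0)//; last exact: measurableT_comp.
  (* An infinite rescaled integral would stay infinite after multiplication by [r ^+ n > 0]. *)
  by rewrite !ltey; apply: contra => /eqP ->; rewrite gt0_muley// lte_fin.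
split => //; rewrite /Rintegral -[r ^+ n in LHS]/(fine (r ^+ n)%:E) -fineM//;
  last exact: integrable_fin_num.
congr fine; rewrite [in LHS]integralE [RHS]integralE.
rewrite muleBr//; last first.
  by apply: fin_num_adde_defr; exact: (integrable_pos_fin_num measurableT iFa).
congr (_ - _)%E.
- rewrite -[RHS](ge0_integral_affine a r0)//; last exact: measurable_funepos.
  by congr (_ * _)%E; apply: eq_integral => z _; rewrite !funeposE.
- rewrite -[RHS](ge0_integral_affine a r0)//; last exact: measurable_funeneg.
  by congr (_ * _)%E; apply: eq_integral => z _; rewrite !funenegE.
Qed.

(** * Gaussians *)

Section gaussian_line.
Variable R : realType.
Implicit Types x y t c : R.
Local Notation mu := (@lebesgue_measure R).

Definition gauss1 t : R := expR (- (t ^+ 2 / 2)).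

Lemma gauss1_ge0 t : 0 <= gauss1 t. Proof. exact: expR_ge0. Qed.

Lemma measurable_gauss1 : measurable_fun setT gauss1.
Proof.
apply: measurableT_comp => //; apply: measurableT_comp => //.
by apply: measurable_funM => //; exact: measurable_funX.
Qed.

Lemma integral_gauss1 :
  mu.-integrable setT (EFin \o gauss1) /\
  \int[mu]_t gauss1 t = Num.sqrt (2 * pi).
Proof.
have p0 : normal_peak 1 != 0 :> R by rewrite gt_eqF// normal_peak_gt0// oner_eq0.
have E : gauss1 = fun t => (normal_peak 1)^-1 * normal_pdf 0 1 t.
  apply/funext => t; rewrite normal_pdfE ?oner_eq0// mulKf//.
  by rewrite /gauss1 /normal_fun subr0 expr1n mulNr.
have i1 := integrable_normal_pdf (0 : R) 1.
split.
  apply: eq_integrable (integrableZl measurableT (normal_peak 1)^-1 i1) => //.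
  by move=> t _; rewrite /= E EFinM.
rewrite E RintegralZl//.
rewrite [X in _ * X](_ : _ = 1); last first.
  by rewrite /Rintegral integral_normal_pdf.
by rewrite mulr1 /normal_peak invrK expr1n mul1r mulr_natl.
Qed.

(** The normal density of variance 2, up to its peak value; it is the common majorant of the
    integrands below that carry a factor [t]. *)
Lemma integrable_gauss1_half : mu.-integrable setT (fun t => (expR (- (t ^+ 2 / 4)))%:E).
Proof.
have s0 : Num.sqrt 2 != 0 :> R by rewrite gt_eqF// sqrtr_gt0.
have p0 : normal_peak (Num.sqrt 2) != 0 :> R by rewrite gt_eqF// normal_peak_gt0.
have E : (fun t => expR (- (t ^+ 2 / 4))) = fun t =>
    (normal_peak (Num.sqrt 2))^-1 * normal_pdf 0 (Num.sqrt 2) t.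
  apply/funext => t; rewrite normal_pdfE// mulKf//.
  rewrite /normal_fun subr0 mulNr sqr_sqrtr//; congr (expR (- (_ / _))).
  by rewrite -mulr_natr; lra.
have i1 := integrable_normal_pdf (0 : R) (Num.sqrt 2).
apply: eq_integrable (integrableZl measurableT (normal_peak (Num.sqrt 2))^-1 i1) => //.
by move=> t _; rewrite -EFinM -[RHS]/(((fun t => expR (- (t ^+ 2 / 4))) t)%:E) E.
Qed.

(** Half of the exponent absorbs the factor: |t| <= 1 + t^2/4 <= e^(t^2/4), where the first
    inequality is (|t|/2 - 1)^2 >= 0. *)
Lemma normr_mul_gauss1_le t : `|t| * gauss1 t <= expR (- (t ^+ 2 / 4)).
Proof.
have -> : gauss1 t = expR (- (t ^+ 2 / 4)) * expR (- (t ^+ 2 / 4)).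
  by rewrite -expRD; congr expR; lra.
rewrite mulrA ler_piMl ?expR_ge0//.
rewrite -ler_pdivlMr ?expR_gt0// mul1r -expRN opprK.
apply: le_trans (expR_ge1Dx _).
by rewrite -[t ^+ 2]real_normK ?num_real//; have := sqr_ge0 (`|t| / 2 - 1); lra.
Qed.

Lemma is_derive_gauss1 t : is_derive t 1 gauss1 (- t * gauss1 t).
Proof.
rewrite /gauss1.
have -> : - t * expR (- (t ^+ 2 / 2)) = expR (- (t ^+ 2 / 2)) * (- t) by rewrite mulrC.
apply: (@is_derive1_comp _ expR (fun t => - (t ^+ 2 / 2))).
apply: is_derive_eq; rewrite /GRing.scale/=; lra.
Qed.

Lemma is_derive_affine y c t : is_derive t 1 (fun t => y * t + c) y.
Proof. apply: is_derive_eq; rewrite /GRing.scale/=; lra. Qed.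

Lemma continuous_affine1 y c : continuous (fun t => y * t + c).
Proof.
move=> t; apply/differentiable_continuous/derivable1_diffP.
by have [] := is_derive_affine y c t.
Qed.

Lemma integrable_trig_gauss1 (g : R -> R) y c :
  measurable_fun setT g -> (forall x, `|g x| <= 1) ->
  mu.-integrable setT (fun t => (g (y * t + c) * gauss1 t)%:E) /\
  mu.-integrable setT (fun t => (t * g (y * t + c) * gauss1 t)%:E).
Proof.
move=> mg g1.
have mgy : measurable_fun setT (fun t => g (y * t + c)).
  apply: (measurableT_comp mg).
  exact: (continuous_measurable_fun (@continuous_affine1 y c)).
split.
  apply: (@le_integrable _ _ _ mu setT measurableT _ (EFin \o gauss1)).
  - apply/measurable_EFinP; apply: measurable_funM => //; exact: measurable_gauss1.
  - move=> t _ /=; rewrite lee_fin normrM ler_piMl//; exact: g1.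
  - exact: integral_gauss1.1.
apply: (@le_integrable _ _ _ mu setT measurableT _ (fun t => (expR (- (t ^+ 2 / 4)))%:E)).
- apply/measurable_EFinP; apply: measurable_funM => //; last exact: measurable_gauss1.
  by apply: measurable_funM => //; exact: measurable_id.
- move=> t _ /=; rewrite lee_fin !normrM (ger0_norm (gauss1_ge0 _)).
  rewrite (ger0_norm (expR_ge0 _)).
  apply: le_trans (normr_mul_gauss1_le t).
  by rewrite ler_wpM2r ?gauss1_ge0// ler_piMr//; exact: g1.
- exact: integrable_gauss1_half.
Qed.

(** The integrand is the derivative of sin(y t + c) e^(-t^2/2). Its integral over [-(n+1), n+1] is a
    difference of boundary values that tends to 0, and it tends to the full integral by dominated
    convergence. *)
Let ibp y c : \int[mu]_t (y * cos (y * t + c) * gauss1 t - t * sin (y * t + c) * gauss1 t) = 0.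
Proof.
pose Phi t := sin (y * t + c) * gauss1 t.
pose phi t := y * cos (y * t + c) * gauss1 t - t * sin (y * t + c) * gauss1 t.
have dPhi t : is_derive t 1 Phi (phi t).
  have d1 := is_derive_affine y c t.
  have d2 := is_derive_gauss1 t.
  have d3 : is_derive t 1 (fun t => sin (y * t + c)) (cos (y * t + c) * y).
    exact: (@is_derive1_comp _ sin (fun t => y * t + c)).
  apply: is_derive_eq; rewrite /phi /GRing.scale/=; lra.
have iphi : mu.-integrable setT (EFin \o phi).
  have [i1 _] := integrable_trig_gauss1 y c (continuous_measurable_fun (@continuous_cos R)) (@cos_max R).
  have [_ i2] := integrable_trig_gauss1 y c (continuous_measurable_fun (@continuous_sin R)) (@sin_max R).
  have := integrableB measurableT (integrableZl measurableT y i1) i2.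
  apply: eq_integrable => // t _ /=; rewrite /phi -EFinM -EFinB; congr (_%:E); lra.
have cphi : continuous phi.
  have cg : continuous gauss1.
    move=> t; apply/differentiable_continuous/derivable1_diffP.
    by have [] := is_derive_gauss1 t.
  have ca := @continuous_affine1 y c.
  have cc : continuous (fun t => cos (y * t + c)).
    move=> t; apply: (@continuous_comp _ _ _ (fun t => y * t + c) cos); first exact: ca.
    exact: continuous_cos.
  have cs : continuous (fun t => sin (y * t + c)).
    move=> t; apply: (@continuous_comp _ _ _ (fun t => y * t + c) sin); first exact: ca.
    exact: continuous_sin.
  move=> t; apply: cvgB; apply: cvgM; [apply: cvgM; [exact: cvg_cst|exact: cc]| exact: cg|
   apply: cvgM; [exact: cvg_id|exact: cs]|exact: cg].
have mphi : measurable_fun setT phi by exact: continuous_measurable_fun.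
pose f n t := (phi \_ `[- n.+1%:R, n.+1%:R]) t.
have fE n : (\int[mu]_t (f n t)%:E = (Phi n.+1%:R - Phi (- n.+1%:R))%:E)%E.
  transitivity (\int[mu]_(t in `[(- n.+1%:R)%R, n.+1%:R%R]) (phi t)%:E)%E.
    rewrite [RHS]integral_mkcond; apply: eq_integral => t _.
    by rewrite /f !patchE; case: ifP.
  rewrite EFinB.
  apply: continuous_FTC2.
  - by rewrite (@lt_trans _ _ 0)// ltrNl oppr0.
  - exact: continuous_subspaceT.
  - have cPhi t : {for t, continuous Phi}.
      by apply/differentiable_continuous/derivable1_diffP; have [] := dPhi t.
    split; first by move=> t _; have [] := dPhi t.
      by apply: cvg_at_right_filter; exact: cPhi.
    by apply: cvg_at_left_filter; exact: cPhi.
  - by move=> t _; rewrite derive1E; have [_ ->] := dPhi t.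
have lim1 : (\int[mu]_t (f n t)%:E)%E @[n --> \oo] --> (\int[mu]_t (phi t)%:E)%E.
  apply: (@dominated_cvg _ _ _ mu setT measurableT _ _ (fun t => `|phi t|%:E)).
  - move=> n; apply/measurable_EFinP; apply/(measurable_restrictT _ _).1 => //.
    exact: measurable_funTS.
  - move=> t _; apply: cvg_EFin; first by near=> n.
    apply: cvg_near_cst; near=> n.
    rewrite /= /f patchE ifT//= inE/= in_itv/= -ler_norml.
    apply: le_trans (_ : n%:R <= _); last by rewrite ler_nat.
    by near: n; exact: nbhs_infty_ger.
  - by [].
  - by have := integrable_norm iphi; exact: eq_integrable.
  - move=> n t _ /=; rewrite lee_fin /f patchE; case: ifP => // _.
    by rewrite normr0.
have lim2 : (\int[mu]_t (f n t)%:E)%E @[n --> \oo] --> 0%E.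
  under eq_fun do rewrite fE.
  apply: cvg_EFin; first by near=> n.
  (* A decay of order 1/n is enough for the boundary values: with m = n+1, e^(m^2/2) >= 1 + m^2/2 >=
     m/2. Stating it through [s ^+ 2] covers both endpoints. *)
  have hn (n : nat) s : s ^+ 2 = n.+1%:R ^+ 2 :> R -> `|Phi s| <= 2 * n.+1%:R^-1.
    move=> sE; rewrite /Phi normrM (ger0_norm (gauss1_ge0 _)).
    apply: (@le_trans _ _ (gauss1 s)).
      by rewrite ler_piMl ?gauss1_ge0// sin_max.
    rewrite /gauss1 sE expRN ler_pdivlMr// mulrC.
    rewrite ler_pdivrMr ?expR_gt0//.
    have := expR_ge1Dx (n.+1%:R ^+ 2 / 2 : R); have := sqr_ge0 (n.+1%:R - 1 : R); nra.
  apply/norm_cvg0P; apply: (squeeze_cvgr (f := fun=> 0 : R)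
    (h := fun n : nat => 4 * n.+1%:R^-1)).
  - near=> n; rewrite /= normr_ge0/=; apply: le_trans (ler_normB _ _) _.
    apply: le_trans (lerD (hn n _ erefl) (hn n _ (sqrrN _))) _.
    by rewrite -mulrDl -natrD.
  - exact: cvg_cst.
  - rewrite -[0](mulr0 4); apply: cvgM; [exact: cvg_cst|exact: cvg_harmonic].
have := cvg_unique _ lim1 lim2.
by rewrite /Rintegral => ->.
Unshelve. all: by end_near.
Qed.

(* The phase c covers sine and cosine at once and lets the n-dimensional formula
   be obtained by integrating one coordinate at a time. *)
Lemma integral_cos_gauss1 y c :
  \int[mu]_t (cos (y * t + c) * gauss1 t) =
  cos c * Num.sqrt (2 * pi) * gauss1 y.
Proof.
pose F y := \int[mu]_t (cos (y * t + c) * gauss1 t).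
pose f y t := cos (y * t + c) * gauss1 t.
have df x t : is_derive x 1 (f ^~ t) (- (t * sin (x * t + c) * gauss1 t)).
  have d1 : is_derive x 1 (fun x => x * t + c) t.
    by apply: is_derive_eq; rewrite /GRing.scale/=; lra.
  have d3 : is_derive x 1 (fun x => cos (x * t + c)) (- sin (x * t + c) * t).
    exact: (@is_derive1_comp _ cos (fun x => x * t + c)).
  by apply: is_derive_eq; rewrite /GRing.scale/=; lra.
have ic z := (integrable_trig_gauss1 z c (continuous_measurable_fun (@continuous_cos R)) (@cos_max R)).1.
have isn z := (integrable_trig_gauss1 z c (continuous_measurable_fun (@continuous_sin R)) (@sin_max R)).2.
(* Differentiation under the integral sign brings down -t sin, and [ibp] turns it back into the
   cosine: F solves F' = -x F. *)
have dF x : is_derive x 1 F (- x * F x).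
  have xI : `]x - 1, x + 1[%classic x by rewrite /= in_itv/=; apply/andP; split; lra.
  have H0 x' : `]x - 1, x + 1[%classic x' -> mu.-integrable setT (EFin \o f x').
    by move=> _; exact: ic.
  have H1 x' t : `]x - 1, x + 1[%classic x' -> setT t -> derivable (f ^~ t) x' 1.
    by move=> _ _; have [] := df x' t.
  have H2 x' t : `]x - 1, x + 1[%classic x' -> setT t ->
      `|partial1of2 f x' t| <= expR (- (t ^+ 2 / 4)).
    move=> _ _; rewrite partial1of2E; have [_ ->] := df x' t.
    rewrite normrN; apply: le_trans (normr_mul_gauss1_le t).
    rewrite 2!normrM (ger0_norm (gauss1_ge0 _)).
    by rewrite ler_wpM2r ?gauss1_ge0// ler_piMr// sin_max.
  have dd := derivable_under_integral measurableT xI H0 H1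
     (fun t => expR_ge0 (- (t ^+ 2 / 4))) integrable_gauss1_half H2.
  have de := differentiation_under_integral measurableT xI H0 H1
     (fun t => expR_ge0 (- (t ^+ 2 / 4))) integrable_gauss1_half H2.
  split; first exact: dd.
  rewrite -derive1E de.
  have -> : \int[mu]_t partial1of2 f x t = - \int[mu]_t (t * sin (x * t + c) * gauss1 t).
    rewrite -mulN1r -RintegralZl//; last exact: isn.
    apply: eq_Rintegral => t _.
    by rewrite partial1of2E; have [_ ->] := df x t; rewrite mulN1r.
  have ixc : mu.-integrable setT
      (EFin \o (fun t => x * cos (x * t + c) * gauss1 t)).
    apply: eq_integrable (integrableZl measurableT x (ic x)) => // t _.
    by rewrite -EFinM /= mulrA.
  have := ibp x c; rewrite RintegralB//; last exact: isn.
  move/eqP; rewrite subr_eq0 => /eqP <-.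
  rewrite /F -mulN1r -RintegralZl// -RintegralZl//; last exact: ic.
  by apply: eq_Rintegral => t _; lra.
(* The equation is solved by its integrating factor; the constant is the value at 0, where only the
   mass of the Gaussian remains. *)
have dG x : is_derive x 1 (fun x => F x * expR (x ^+ 2 / 2)) 0.
  have d1 : is_derive x 1 (fun x => expR (x ^+ 2 / 2)) (expR (x ^+ 2 / 2) * x).
    apply: (@is_derive1_comp _ expR (fun x => x ^+ 2 / 2)).
    by apply: is_derive_eq; rewrite /GRing.scale/=; lra.
  have d2 := dF x.
  by apply: is_derive_eq; rewrite /GRing.scale/=; lra.
have := is_derive_0_is_cst y 0 dG.
rewrite expr0n/= mul0r expR0 mulr1 => Fy.
have F0 : F 0 = cos c * Num.sqrt (2 * pi).
  rewrite -integral_gauss1.2 -RintegralZl//; last exact: integral_gauss1.1.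
  by apply: eq_Rintegral => t _; rewrite mul0r add0r.
by rewrite -F0 -Fy /gauss1 -mulrA -expRD addrN expR0 mulr1.
Qed.

End gaussian_line.

(** * The scalar product and Gaussians on R^n *)

Section dot_theory.
Variables (R : realType) (n : nat).
Implicit Types (x y z : 'rV[R]_n) (r c : R).

Lemma dotC x y : dot x y = dot y x.
Proof. by apply: eq_bigr => i _; rewrite mulrC. Qed.

Lemma dotDr x y z : dot x (y + z) = dot x y + dot x z.
Proof. by rewrite /dot -big_split/=; apply: eq_bigr => i _; rewrite mxE mulrDr. Qed.

Lemma dotZr x r y : dot x (r *: y) = r * dot x y.
Proof. by rewrite /dot mulr_sumr; apply: eq_bigr => i _; rewrite mxE mulrCA. Qed.

Lemma dotDl x y z : dot (x + y) z = dot x z + dot y z.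
Proof. by rewrite !(dotC _ z) dotDr. Qed.

Lemma dotZl x r y : dot (r *: x) y = r * dot x y.
Proof. by rewrite !(dotC _ y) dotZr. Qed.

Lemma dotNr x y : dot x (- y) = - dot x y.
Proof. by rewrite -scaleN1r dotZr mulN1r. Qed.

Lemma dotNl x y : dot (- x) y = - dot x y.
Proof. by rewrite !(dotC _ y) dotNr. Qed.

Lemma dot0r x : dot x 0 = 0.
Proof. by rewrite -(scale0r 0) dotZr mul0r. Qed.

Lemma dot_ge0 x : 0 <= dot x x.
Proof. by apply: sumr_ge0 => i _; rewrite -expr2 sqr_ge0. Qed.

Lemma sqr_enorm x : enorm x ^+ 2 = dot x x.
Proof.
rewrite /enorm sqr_sqrtr; first by apply: eq_bigr => i _; rewrite expr2.
by apply: sumr_ge0 => i _; exact: sqr_ge0.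
Qed.

Lemma dotDD_le x y : dot (x + y) (x + y) <= 2 * dot x x + 2 * dot y y.
Proof.
have := dot_ge0 (x - y); rewrite !(dotDl, dotDr, dotNl, dotNr) (dotC y x); lra.
Qed.

Lemma measurable_dot : measurable_fun setT (fun p : 'rV[R]_n * 'rV[R]_n => dot p.1 p.2).
Proof.
apply: measurable_sum => i; apply: measurable_funM.
  by apply: (measurableT_comp (measurable_rV_coord i)).
by apply: (measurableT_comp (measurable_rV_coord i)).
Qed.

Lemma measurable_dotr x : measurable_fun setT (dot x).
Proof.
apply: measurable_sum => i; apply: measurable_funM => //.
exact: measurable_rV_coord.
Qed.

Lemma measurable_dot_diag : measurable_fun setT (fun x => dot x x).
Proof.
apply: measurable_sum => i; apply: measurable_funM; exact: measurable_rV_coord.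
Qed.

Definition gauss x : R := expR (- (dot x x / 2)).

Lemma gauss_ge0 x : 0 <= gauss x. Proof. exact: expR_ge0. Qed.

Lemma gauss_gt0 x : 0 < gauss x. Proof. exact: expR_gt0. Qed.

Lemma gauss_le1 x : gauss x <= 1.
Proof. by rewrite -expR0 ler_expR oppr_le0 divr_ge0// dot_ge0. Qed.

Lemma gaussN x : gauss (- x) = gauss x.
Proof. by rewrite /gauss dotNl dotNr opprK. Qed.

Lemma measurable_gauss : measurable_fun setT gauss.
Proof.
apply: measurableT_comp => //; apply: measurableT_comp => //.
by apply: measurable_funM => //; exact: measurable_dot_diag.
Qed.

Lemma measurable_scale r : measurable_fun setT (fun x : 'rV[R]_n => r *: x).
Proof.
rewrite (_ : (fun _ => _) = fun x : 'rV[R]_n => 0 + r *: x).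
  exact: measurable_affine.
by apply/funext => x; rewrite add0r.
Qed.

(* This domination makes u(x) v(y) times a bounded function out of the kernel
   k(y) chi(x) gauss((y - x) / r), so that the integrals can be exchanged. *)
Lemma gauss_mul_le r x y : 0 < r -> r <= 1 ->
  gauss x * gauss (r^-1 *: (y - x)) <= gauss (2^-1 *: y).
Proof.
move=> r0 r1; rewrite /gauss -expRD ler_expR !(dotZl, dotZr).
set d := dot (y - x) (y - x); have d0 : 0 <= d := dot_ge0 _.
have : d <= r^-1 * (r^-1 * d).
  by rewrite mulrA ler_peMl// -expr2 exprn_ege1// invf_ge1.
have := dotDD_le x (y - x); rewrite (addrC x) subrK -/d.
have := dot_ge0 x; lra.
Qed.

(** From |y|^2 <= 2 |y + r z|^2 + 2 r^2 |z|^2. The square of the Gaussian pays for the first factor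
    2, and r <= 1/2 leaves enough of [gauss z]. The bound is independent of r and separates y from
    z, so it dominates the mollifications as r tends to 0. *)
Lemma gauss_shift_le r y z : 0 <= r -> r <= 2^-1 ->
  gauss (y + r *: z) ^+ 2 * gauss z <= gauss y * gauss (2^-1 *: z).
Proof.
move=> r0 r1; rewrite /gauss -expRM_natl -!expRD ler_expR.
have := dotDD_le (y + r *: z) (- (r *: z)); rewrite addrK.
rewrite dotNl dotNr opprK !(dotZl, dotZr).
have : r * (r * dot z z) <= 2^-1 * (2^-1 * dot z z).
  apply: ler_pM => //; first by rewrite mulr_ge0// dot_ge0.
  by rewrite ler_wpM2r// dot_ge0.
have := dot_ge0 z; have := dot_ge0 y; have := dot_ge0 (y + r *: z); lra.
Qed.

End dot_theory.

Lemma dot_cons (R : realType) (n : nat) (y : 'rV[R]_n.+1) r (v : 'rV[R]_n) :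
  dot y (@rV_cons R n (r, v)) = y ord0 ord0 * r + dot (rV_uncons y).2 v.
Proof.
rewrite /dot big_ord_recl rV_cons0/=; congr (_ + _).
by apply: eq_bigr => i _; rewrite rV_cons_lift rV_uncons_lift.
Qed.

Lemma dot_uncons (R : realType) (n : nat) (y : 'rV[R]_n.+1) :
  dot y y = y ord0 ord0 ^+ 2 + dot (rV_uncons y).2 (rV_uncons y).2.
Proof.
rewrite /dot big_ord_recl; congr (_ + _).
by apply: eq_bigr => i _; rewrite rV_uncons_lift.
Qed.

Lemma gauss_uncons (R : realType) (n : nat) (y : 'rV[R]_n.+1) :
  gauss y = gauss1 (y ord0 ord0) * gauss (rV_uncons y).2.
Proof. by rewrite /gauss dot_uncons -expRD; congr expR; lra. Qed.

Lemma gauss_cons (R : realType) (n : nat) r (v : 'rV[R]_n) :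
  gauss (@rV_cons R n (r, v)) = gauss1 r * gauss v.
Proof. by rewrite gauss_uncons rV_cons0 rV_consK. Qed.

(* Locked because conversion would otherwise try to unfold pi. *)
Definition gauss_mass (R : realType) (n : nat) : R :=
  locked (Num.sqrt (2 * pi) ^+ n).

Lemma gauss_massE (R : realType) (n : nat) :
  gauss_mass R n = Num.sqrt (2 * pi) ^+ n.
Proof. by rewrite /gauss_mass -lock. Qed.

Lemma gauss_mass_ge1 (R : realType) (n : nat) : 1 <= gauss_mass R n.
Proof.
rewrite gauss_massE; apply: exprn_ege1; rewrite -[leLHS]sqrtr1 ler_sqrt; have := @pi_ge2 R; lra.
Qed.

Lemma integral_rV0 (R : realType) (F : 'rV[R]_0 -> \bar R) :
  (\int[lebesgue_rV R 0]_x F x = F 0%R)%E.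
Proof.
rewrite -[RHS]mul1e; have mF : measurable_fun setT F.
  rewrite (_ : F = cst (F 0)) //; apply/funext => x; congr F.
  by apply/rowP => -[].
have -> : (\int[lebesgue_rV R 0]_x F x =
  \int[\d_(0%R : 'rV[R]_0)]_x F x)%E by [].
by rewrite integral_dirac// diracE mem_set.
Qed.

Lemma integral_gaussE (R : realType) (n : nat) :
  (\int[lebesgue_rV R n]_x (gauss x)%:E = (gauss_mass R n)%:E)%E.
Proof.
elim: n => [|n IHn].
  by rewrite integral_rV0 /gauss dot0r mul0r oppr0 expR0 !gauss_massE expr0.
rewrite ge0_integral_rV; last 2 first.
- by apply/measurable_EFinP; exact: measurable_gauss.
- by move=> x; rewrite lee_fin gauss_ge0.
transitivity (\int[lebesgue_measure]_r ((gauss1 r)%:E * (gauss_mass R n)%:E))%E.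
  apply: eq_integral => r _; rewrite -IHn -ge0_integralZl//.
  - by apply: eq_integral => v _; rewrite gauss_cons EFinM.
  - by apply/measurable_EFinP; exact: measurable_gauss.
  - by move=> x _; rewrite lee_fin gauss_ge0.
  - by rewrite lee_fin gauss1_ge0.
have [i1 e1] := integral_gauss1 R.
rewrite integralZr// !gauss_massE exprS EFinM; congr (_ * _)%E.
by rewrite -e1 /Rintegral fineK//; exact: integrable_fin_num.
Qed.

Lemma integrable_gauss (R : realType) (n : nat) :
  (lebesgue_rV R n).-integrable setT (EFin \o @gauss R n).
Proof.
apply/integrableP; split.
  by apply/measurable_EFinP; exact: measurable_gauss.
rewrite (eq_integral (fun x => (gauss x)%:E)) ?integral_gaussE ?ltry//.
by move=> x _ /=; rewrite ger0_norm ?gauss_ge0.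
Qed.

Lemma integral_gauss (R : realType) (n : nat) :
  \int[lebesgue_rV R n]_x gauss x = gauss_mass R n.
Proof. by rewrite /Rintegral integral_gaussE. Qed.

Lemma integrable_mul_bounded d (T : measurableType d) (R : realType)
    (m : {measure set T -> \bar R}) (f g : T -> R) (M : R) :
  m.-integrable setT (EFin \o f) -> measurable_fun setT g ->
  (forall x, `|g x| <= M) -> m.-integrable setT (fun x => (g x * f x)%:E).
Proof.
move=> fi mg gM.
have mf : measurable_fun setT f by move/measurable_int: fi => /measurable_EFinP.
apply: (@le_integrable _ _ _ m setT measurableT _ (fun x => M%:E * (f x)%:E)%E).
- by apply/measurable_EFinP; exact: measurable_funM.
- move=> x _ /=; rewrite lee_fin normrM [leRHS]normrM ler_wpM2r//.
  by rewrite (le_trans (gM x))// ler_norm.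
- exact: integrableZl.
Qed.

Lemma integral_cos_gauss (R : realType) (n : nat) (y : 'rV[R]_n) (c : R) :
  \int[lebesgue_rV R n]_x (cos (dot y x + c) * gauss x) =
  cos c * gauss_mass R n * gauss y.
Proof.
have mcos := continuous_measurable_fun (@continuous_cos R).
have ic m (z : 'rV[R]_m) a : (lebesgue_rV R m).-integrable setT
    (EFin \o (fun x => cos (dot z x + a) * gauss x)).
  apply: (integrable_mul_bounded (M := 1) (integrable_gauss R m)).
    by apply: measurableT_comp => //; apply: measurable_funD => //; exact: measurable_dotr.
  by move=> x; exact: cos_max.
elim: n y c => [|n IHn] y c.
  rewrite /Rintegral integral_rV0/= !gauss_massE expr0 mulr1 dot0r add0r.
  by congr (_ * gauss _); apply/rowP => -[].
rewrite /Rintegral integral_rV; last exact: ic.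
set y' := (rV_uncons y).2; set y0 := y ord0 ord0.
transitivity (\int[lebesgue_measure]_r
    (gauss_mass R n * gauss y' * (cos (y0 * r + c) * gauss1 r))).
  congr fine; apply: eq_integral => r _.
  (* For a fixed first coordinate r, its share [y0 * r] of the scalar product joins the phase of the
     induction hypothesis. *)
  transitivity ((\int[lebesgue_rV R n]_v
    (gauss1 r * (cos (dot y' v + (y0 * r + c)) * gauss v)))%R%:E)%E.
    rewrite /Rintegral fineK; last first.
      apply: integrable_fin_num => //.
      exact: (integrableZl measurableT (gauss1 r) (ic n y' (y0 * r + c))).
    apply: eq_integral => v _; rewrite gauss_cons dot_cons.
    by rewrite mulrCA /= -addrA addrCA.
  by rewrite RintegralZl// IHn; congr (_%:E); ring.
rewrite RintegralZl; last 2 first.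
- by [].
- exact: (integrable_trig_gauss1 y0 c mcos (@cos_max R)).1.
rewrite integral_cos_gauss1 (gauss_uncons y) !gauss_massE exprS -/y' -/y0; ring.
Qed.

Lemma integrable_gauss_scale (R : realType) (n : nat) (r : R) : 0 < r ->
  (lebesgue_rV R n).-integrable setT (fun x => (gauss (r *: x))%:E).
Proof.
move=> r0; have := (integral_affine 0 r0 (integrable_gauss R n)).1.
by apply: eq_integrable => // x _; rewrite add0r.
Qed.

Lemma integral_cos_gauss_scale (R : realType) (n : nat) (y : 'rV[R]_n) (r c : R) :
  0 < r ->
  \int[lebesgue_rV R n]_x (cos (dot y x + c) * gauss (r *: x)) =
  cos c * (gauss_mass R n / r ^+ n * gauss (r^-1 *: y)).
Proof.
move=> r0; have rn0 : r ^+ n != 0 by rewrite expf_neq0// gt_eqF.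
apply: (mulfI rn0).
have mcos := continuous_measurable_fun (@continuous_cos R).
have ic : (lebesgue_rV R n).-integrable setT
    (EFin \o (fun x => cos (dot (r^-1 *: y) x + c) * gauss x)).
  apply: (integrable_mul_bounded (M := 1) (integrable_gauss R n)).
    by apply: measurableT_comp => //; apply: measurable_funD => //; exact: measurable_dotr.
  by move=> x; exact: cos_max.
have [_] := integral_affine 0 r0 ic.
rewrite integral_cos_gauss => E.
transitivity (cos c * gauss_mass R n * gauss (r^-1 *: y)); last by field.
apply: (etrans (congr1 ( *%R (r ^+ n)) _) E); apply: eq_Rintegral => x _.
by rewrite add0r dotZl dotZr mulKf// gt_eqF.
Qed.

(** * Bounded Baire functions *)

Section bounded_baire.
Variables (R : realType) (n : nat).
Implicit Types (p q : 'rV[R]_n -> R) (x z : 'rV[R]_n) (M : R).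

(** The form of continuity used when the mollification radius tends to 0 for a fixed direction z.
    The radii 1/(j+2) start at 1/2, the largest one allowed by [gauss_shift_le]. *)
Definition ray_continuous p := forall x z,
  p (x + (j.+2%:R^-1 : R) *: z) @[j --> \oo] --> p x.

(** The bound in [baire_lim] is common to the whole sequence, so that an integral inequality passes
    to the limit by dominated convergence in an induction on [baire]. *)
Inductive baire : ('rV[R]_n -> R) -> Prop :=
| baire_base p M : measurable_fun setT p -> (forall x, `|p x| <= M) ->
    ray_continuous p -> baire p
| baire_lim (p : nat -> 'rV[R]_n -> R) q M : (forall j, baire (p j)) ->
    (forall j x, `|p j x| <= M) -> (forall x, p j x @[j --> \oo] --> q x) ->
    baire q.

Lemma cvg_normr_le (u : nat -> R) l M : (forall j, `|u j| <= M) ->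
  u j @[j --> \oo] --> l -> `|l| <= M.
Proof.
move=> uM ul; have nul : `|u j| @[j --> \oo] --> `|l| by exact: cvg_norm.
rewrite -(cvg_lim _ nul)//; apply: limr_le; first by apply/cvg_ex; exists `|l|.
exact: nearW.
Qed.

Lemma baire_measurable_bounded q : baire q ->
  measurable_fun setT q /\ exists M, forall x, `|q x| <= M.
Proof.
elim=> {q} [q M mq qM _|p q M _ IH pM pq]; first by split => //; exists M.
split; last by exists M => x; apply: cvg_normr_le (pq x) => j.
apply: (measurable_fun_cvg (h := p)) => [j|x _]; first exact: (IH j).1.
exact: pq.
Qed.

Lemma baire_cst c : baire (fun=> c).
Proof.
apply: (@baire_base _ `|c|) => // x z; exact: cvg_cst.
Qed.

(** Nested inductions: the limits are taken in one function while the other is fixed, so the uniform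
    bound needs only the boundedness of the fixed one. *)
Lemma baire_lin (a b : R) p q : baire p -> baire q ->
  baire (fun x => a * p x + b * q x).
Proof.
move=> bp bq; elim: bp => {p} [p M mp pM rp|p p' M bp IH pM pp]; last first.
  have [_ [N qN]] := baire_measurable_bounded bq.
  apply: (@baire_lim (fun j x => a * p j x + b * q x) _ (`|a| * M + `|b| * N)) => //.
    move=> j x; apply: le_trans (ler_normD _ _) _.
    by rewrite !normrM lerD// ler_wpM2l.
  by move=> x; apply: cvgD; [apply: cvgMr; exact: pp|exact: cvg_cst].
elim: bq => {q} [q N mq qN rq|q q' N bq IH qN qq]; last first.
  apply: (@baire_lim (fun j x => a * p x + b * q j x) _ (`|a| * M + `|b| * N)) => //.
    move=> j x; apply: le_trans (ler_normD _ _) _.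
    by rewrite !normrM lerD// ler_wpM2l.
  by move=> x; apply: cvgD; [exact: cvg_cst|apply: cvgMr; exact: qq].
apply: (@baire_base _ (`|a| * M + `|b| * N)).
- by apply: measurable_funD; apply: measurable_funM.
- move=> x; apply: le_trans (ler_normD _ _) _.
  by rewrite !normrM lerD// ler_wpM2l.
- move=> x z; apply: cvgD; apply: cvgMr; [exact: rp|exact: rq].
Qed.

Lemma baire_sum (I : Type) (s : seq I) (c : I -> R) (p : I -> 'rV[R]_n -> R) :
  (forall i, baire (p i)) -> baire (fun x => \sum_(i <- s) c i * p i x).
Proof.
move=> bp; elim: s => [|i s IHs].
  by under eq_fun do rewrite big_nil; exact: baire_cst.
under eq_fun do rewrite big_cons/= -[X in _ + X]mul1r.
exact: baire_lin.
Qed.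

Definition cozero : set_system 'rV[R]_n := [set A | exists v : 'rV[R]_n -> R,
  [/\ measurable_fun setT v, (forall x, 0 <= v x <= 1), ray_continuous v &
      A = [set x | 0 < v x]]].

Lemma setI_closed_cozero : setI_closed cozero.
Proof.
move=> A B [v [mv v01 rv ->]] [w [mw w01 rw ->]].
exists (fun x => v x * w x); split.
- exact: measurable_funM.
- move=> x; have /andP[v0 v1] := v01 x; have /andP[w0 w1] := w01 x.
  by rewrite mulr_ge0//= mulr_ile1.
- by move=> x z; apply: cvgM; [exact: rv|exact: rw].
- apply/seteqP; split => x /=; first by move=> [v0 w0]; exact: mulr_gt0.
  have /andP[v0 v1] := v01 x; have /andP[w0 w1] := w01 x.
  move=> vw; split; rewrite lt_neqAle ?v0 ?w0 andbT; apply: contraTN vw.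
    by move/eqP => <-; rewrite mul0r ltxx.
  by move/eqP => <-; rewrite mulr0 ltxx.
Qed.

Lemma cozero_halfspace i (a : R) : cozero [set x | a < x ord0 i].
Proof.
(* Twice the positive part of x_i - a. The witness 1 - e^(-w) then lies in [0, 1] and is positive
   exactly where w is. *)
pose w x := `|x ord0 i - a| + (x ord0 i - a).
have w0 x : 0 <= w x by rewrite -lerBlDr sub0r -normrN ler_norm.
have wa x : (0 < w x) = (a < x ord0 i).
  rewrite /w; have [xa|xa] := ltP a (x ord0 i).
    by rewrite gtr0_norm ?subr_gt0// addr_gt0 ?subr_gt0.
  by rewrite ler0_norm ?subr_le0// addNr ltxx.
have mw : measurable_fun setT w.
  have my : measurable_fun setT (fun x : 'rV[R]_n => x ord0 i - a).
    by apply: measurable_funB => //; exact: measurable_rV_coord.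
  by apply: measurable_funD => //; exact: measurableT_comp.
exists (fun x => 1 - expR (- w x)); split.
- apply: measurable_funB => //; apply: measurableT_comp => //.
  exact: measurableT_comp.
- move=> x; rewrite subr_ge0 gerBl expR_ge0 andbT.
  by rewrite -expR0 ler_expR oppr_le0.
- move=> x z; apply: cvgB; first exact: cvg_cst.
  apply: continuous_cvg; first exact: continuous_expR.
  have cy : (x + (j.+2%:R^-1 : R) *: z) ord0 i - a @[j --> \oo] --> x ord0 i - a.
    apply: cvgB; last exact: cvg_cst.
    have : x ord0 i + (j.+2%:R^-1 : R) * z ord0 i @[j --> \oo] -->
        x ord0 i + 0 * z ord0 i.
      apply: cvgD; first exact: cvg_cst.
      apply: cvgMl; rewrite (_ : (fun _ => _) = [sequence @harmonic R j.+1]_j)//.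
      by rewrite cvg_shiftS; exact: cvg_harmonic.
    rewrite mul0r addr0 => h; apply: cvg_trans h; apply: near_eq_cvg.
    by apply: nearW => j; rewrite !mxE.
  by apply: cvgN; apply: cvgD => //; exact: cvg_norm.
- have e x : (0 < 1 - expR (- w x)) = (a < x ord0 i).
    by rewrite -wa subr_gt0 -{1}expR0 ltr_expR oppr_lt0.
  by apply/seteqP; split => x /=; rewrite e.
Qed.

(* The cozero sets form a pi-system whose indicators are limits of
   1 - (1 - v)^j, which avoids any topological description of Borel sets. *)
Lemma measurable_cozero : @measurable _ 'rV[R]_n = <<s cozero >>.
Proof.
apply/seteqP; split; last first.
  apply: smallest_sub; first exact: sigma_algebra_measurable.
  move=> _ [v [mv _ _ ->]].
  rewrite (_ : [set x | _] = setT `&` v @^-1` `]0, +oo[%classic).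
    by apply: mv => //.
  by rewrite setTI; apply/seteqP; split => x /=; rewrite in_itv/= andbT.
have mid : measurable_fun [set: g_sigma_algebraType cozero]
    (fun x : g_sigma_algebraType cozero => x : 'rV[R]_n).
  apply/measurable_fun_rVP => i.
  apply: (measurability (@RGenOInfty.G R)).
    exact: RGenOInfty.measurableE.
  move=> _ [_ [a ->] <-]; rewrite setTI; apply: sub_sigma_algebra.
  have -> : (fun t : 'rV[R]_n => t ord0 i) @^-1` `]a, +oo[%classic =
      [set x | a < x ord0 i].
    by apply/seteqP; split => x /=; rewrite in_itv/= andbT.
  exact: cozero_halfspace.
by move=> A mA; have := mid measurableT _ mA; rewrite setTI.
Qed.

(** Dynkin's theorem for the pi-system [cozero]: complements are linear combinations with the
    constant 1, and disjoint unions are limits of partial sums, which disjointness keeps bounded by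
    1. *)
Lemma baire_indic (A : set 'rV[R]_n) : measurable A -> baire (\1_A).
Proof.
rewrite measurable_cozero; move: A.
apply: (dynkin_induction measurable_cozero setI_closed_cozero).
- by rewrite indicT; exact: baire_cst.
- move=> _ [v [mv v01 rv ->]].
  apply: (@baire_lim (fun j x => 1 - (1 - v x) ^+ j) _ 1).
  + move=> j; apply: (@baire_base _ 2).
    * by apply: measurable_funB => //; apply: measurable_funX; exact: measurable_funB.
    * move=> x; have /andP[v0 v1] := v01 x.
      have h0 : 0 <= (1 - v x) ^+ j by rewrite exprn_ge0// subr_ge0.
      have h1 : (1 - v x) ^+ j <= 1 by rewrite exprn_ile1 ?subr_ge0// gerBl.
      by rewrite ler_norml; apply/andP; split; lra.
    * move=> x z; apply: cvgB; first exact: cvg_cst.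
      have rv' : 1 - v (x + (i.+2%:R^-1 : R) *: z) @[i --> \oo] --> 1 - v x.
        by apply: cvgB; [exact: cvg_cst|exact: rv].
      elim: j => [|j IHj]; first by under eq_fun do rewrite expr0; rewrite expr0; exact: cvg_cst.
      by under eq_fun do rewrite exprS; rewrite exprS; apply: cvgM.
  + move=> j x; have /andP[v0 v1] := v01 x.
    have h0 : 0 <= (1 - v x) ^+ j by rewrite exprn_ge0// subr_ge0.
    have h1 : (1 - v x) ^+ j <= 1 by rewrite exprn_ile1 ?subr_ge0// gerBl.
    by rewrite ler_norml; apply/andP; split; lra.
  + move=> x; have /andP[v0 v1] := v01 x; rewrite indicE.
    have [vp|vn] := boolP (0 < v x).
      rewrite mem_set// -[X in _ --> X]subr0; apply: cvgB; first exact: cvg_cst.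
      by apply: cvg_expr; rewrite ger0_norm ?subr_ge0// gtrBl.
    have -> : v x = 0 by apply/eqP; rewrite eq_le v0 leNgt vn.
    rewrite memNset/=; last by move=> /=; exact/negP.
    by under eq_fun do rewrite subr0 expr1n subrr; exact: cvg_cst.
- move=> A mA bA; rewrite (_ : \1_(~` A) = fun x => 1 * 1 + (-1) * \1_A x).
    exact: baire_lin (baire_cst 1) bA.
  by apply/funext => x; rewrite !indicE in_setC; case: (x \in A); rewrite /=; lra.
- move=> F mF tF bF.
  (* A point of the union lies in exactly one [F m], so the partial sums at it are 0 up to index m
     and 1 afterwards. *)
  have Fx x : x \in \bigcup_k F k -> exists2 m : nat, F m x &
      forall k, \1_(F k) x = (k == m)%:R :> R.
    rewrite inE => -[m _ Fmx]; exists m => // k; rewrite indicE.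
    have [->|km] := eqVneq k m; first by rewrite mem_set.
    rewrite memNset// => Fkx; move/eqP: km; apply.
    by apply: (tF k m) => //; exists x.
  have Fx0 x : x \notin \bigcup_k F k -> forall k, \1_(F k) x = 0 :> R.
    move=> xF k; rewrite indicE memNset// => Fkx; move/negP: xF; apply.
    by rewrite inE; exists k.
  have sumE m j : \sum_(k < j) 1 * ((k : nat) == m)%:R = (m < j)%:R :> R.
    under eq_bigr do rewrite mul1r.
    have [mj|jm] := ltnP m j.
      rewrite (bigD1 (Ordinal mj))//= eqxx big1 ?addr0// => k /negbTE km.
      by rewrite -[(k : nat) == m]/(k == Ordinal mj) km.
    by rewrite big1// => k _; rewrite ltn_eqF// (leq_trans (ltn_ord k)).
  apply: (@baire_lim (fun j x => \sum_(k <- index_enum 'I_j) 1 * \1_(F k) x) _ 1).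
  + by move=> j; apply: (@baire_sum _ _ (fun=> 1) (fun k : 'I_j => \1_(F k))).
  + move=> j x; have [/Fx[m _ e]|/Fx0 e] := boolP (x \in \bigcup_k F k).
      by under eq_bigr do rewrite e; rewrite sumE; case: (m < j)%N; rewrite ?normr1 ?normr0.
    by under eq_bigr do rewrite e mulr0; rewrite big1// normr0.
  + move=> x; rewrite indicE; have [xF|xF] := boolP (x \in \bigcup_k F k).
      have [m _ e] := Fx x xF.
      apply: cvg_near_cst; exists m.+1 => // j /= mj.
      by under eq_bigr do rewrite e; rewrite sumE mj.
    apply: cvg_near_cst; apply: nearW => j.
    by under eq_bigr do rewrite (Fx0 _ xF) mulr0; rewrite big1.
Qed.

Import HBNNSimple.

Lemma baire_nnsfun (s : {nnsfun 'rV[R]_n >-> R}) : baire s.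
Proof.
rewrite (_ : (s : 'rV[R]_n -> R) =
   fun x => \sum_(y <- finmap.enum_fset (fset_set (range s))) y * \1_(s @^-1` [set y]) x).
  apply: (@baire_sum _ _ (fun y => y) (fun y => \1_(s @^-1` [set y]))) => y.
  exact/baire_indic.
by apply/funext => x; rewrite fimfunE fsbig_finite//.
Qed.

End bounded_baire.

(** * Convolution with Gaussians *)

Lemma weighted_amgm (R : realFieldType) (g a c : R) : 0 <= g ->
  a * (c * g) <= 2^-1 * (a ^+ 2 * g + c ^+ 2 * g).
Proof. by move=> g0; have := mulr_ge0 g0 (sqr_ge0 (a - c)); lra. Qed.

Section Rintegral_tools.
Context d (T : measurableType d) (R : realType).
Variable m : {measure set T -> \bar R}.

Lemma cvg_Rintegral_dominated (f : nat -> T -> R) (l g : T -> R) :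
  (forall j, measurable_fun setT (f j)) ->
  m.-integrable setT (EFin \o g) ->
  (forall j x, `|f j x| <= g x) ->
  (forall x, f j x @[j --> \oo] --> l x) ->
  \int[m]_x f j x @[j --> \oo] --> \int[m]_x l x.
Proof.
move=> mf ig fg fl.
have ml : measurable_fun setT l.
  by apply: (measurable_fun_cvg (h := f)) => // x _; exact: fl.
have ml' : measurable_fun setT (EFin \o l) by exact/measurable_EFinP.
have lg x : `|l x| <= g x by apply: cvg_normr_le (fl x) => j.
have il : m.-integrable setT (EFin \o l).
  apply: (@le_integrable _ _ _ m setT measurableT _ (EFin \o g)) => // x _ /=.
  by rewrite lee_fin (le_trans (lg x))// ler_norm.
have [] := @dominated_convergence _ _ _ m setT measurableT
  (fun j => EFin \o f j) (EFin \o l) (EFin \o g).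
- by move=> j; exact/measurable_EFinP.
- by [].
- by apply: aeW => x _; apply: cvg_EFin; [exact: nearW|exact: fl].
- by [].
- by apply: aeW => x j _ /=; rewrite lee_fin.
move=> _ _ h; apply: fine_cvg.
rewrite fineK//; exact: integrable_fin_num.
Qed.

Lemma integrable_addr (f g : T -> R) :
  m.-integrable setT (EFin \o f) -> m.-integrable setT (EFin \o g) ->
  m.-integrable setT (EFin \o (fun x => f x + g x)).
Proof.
by move=> fi gi; apply: eq_integrable (integrableD measurableT fi gi).
Qed.

Lemma integrable_mulrl (c : R) (f : T -> R) :
  m.-integrable setT (EFin \o f) -> m.-integrable setT (EFin \o (fun x => c * f x)).
Proof.
by move=> fi; apply: eq_integrable (integrableZl measurableT c fi).
Qed.

Lemma integrable_mulr_bounded (f g : T -> R) (M : R) :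
  m.-integrable setT (EFin \o f) -> measurable_fun setT g ->
  (forall x, `|g x| <= M) -> m.-integrable setT (EFin \o (fun x => f x * g x)).
Proof.
move=> fi mg gM; apply: eq_integrable (integrable_mul_bounded fi mg gM) => //.
by move=> x _ /=; rewrite mulrC.
Qed.

Lemma integrable_mul_sqr (f g : T -> R) :
  measurable_fun setT f -> measurable_fun setT g ->
  m.-integrable setT (EFin \o (fun x => f x ^+ 2)) ->
  m.-integrable setT (EFin \o (fun x => g x ^+ 2)) ->
  m.-integrable setT (EFin \o (fun x => f x * g x)).
Proof.
move=> mf mg if2 ig2.
apply: (@le_integrable _ _ _ m setT measurableT _
   (EFin \o (fun x => f x ^+ 2 + g x ^+ 2))).
- by apply/measurable_EFinP; exact: measurable_funM.
- move=> x _ /=; rewrite lee_fin; apply: le_trans (ler_norm _); rewrite normrM.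
  rewrite -(real_normK (num_real (f x))) -(real_normK (num_real (g x))).
  by have := sqr_ge0 (`|f x| - `|g x|); have := normr_ge0 (f x); have := normr_ge0 (g x); nra.
- by apply: eq_integrable (integrableD measurableT if2 ig2).
Qed.

End Rintegral_tools.

(** * Cosine and sine transforms *)

Section trigonometric_transform.
Variables (R : realType) (n : nat).
Implicit Types (u v w k p : 'rV[R]_n -> R) (x y z : 'rV[R]_n) (r M : R) (h : R -> R).
Local Notation mu := (lebesgue_rV R n).
Local Notation K := (gauss_mass R n).

(** For h = cos and h = sin this is, up to sign, the real or imaginary part of the Fourier transform
    of a real function. A generic bounded h lets each fact be proved once. *)
Definition trigT h u y : R := \int[mu]_x (u x * h (dot x y)).

Definition bounded_wave h := measurable_fun setT h /\ forall a : R, `|h a| <= 1.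

Lemma bounded_wave_cos : bounded_wave cos.
Proof.
split; [exact: continuous_measurable_fun (@continuous_cos R)|exact: cos_max].
Qed.

Lemma bounded_wave_sin : bounded_wave sin.
Proof.
split; [exact: continuous_measurable_fun (@continuous_sin R)|exact: sin_max].
Qed.

Variables (h : R -> R) (hw : bounded_wave h).

Let mb : measurable_fun setT (fun q : 'rV[R]_n * 'rV[R]_n => h (dot q.1 q.2)).
Proof. by apply: measurableT_comp; [exact: hw.1|exact: measurable_dot]. Qed.

(** The multiplication formula of the Fourier transform: Fubini's theorem and the symmetry of the
    scalar product. *)
Lemma trigT_exchange u v : mu.-integrable setT (EFin \o u) ->
  mu.-integrable setT (EFin \o v) ->
  mu.-integrable setT (EFin \o (fun x => u x * trigT h v x)) /\
  \int[mu]_x (u x * trigT h v x) = \int[mu]_x (v x * trigT h u x).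
Proof.
move=> iu iv.
have E1 x : trigT h v x = \int[mu]_y (v y * h (dot x y)).
  by apply: eq_Rintegral => y _; rewrite dotC.
have := integrable_kernel1 iu iv mb (fun _ => hw.2 _).
have := Rintegral_kernel_exchange iu iv mb (fun _ => hw.2 _).
under eq_Rintegral do rewrite -E1.
move=> e i; split; last exact: e.
by apply: eq_integrable i => // x _ /=; rewrite E1.
Qed.

Lemma integrable_trigT_kernel u y : mu.-integrable setT (EFin \o u) ->
  mu.-integrable setT (EFin \o (fun x => u x * h (dot x y))).
Proof.
move=> iu; apply: integrable_mulr_bounded iu _ (fun x => hw.2 _).
apply: measurableT_comp; first exact: hw.1.
by under eq_fun do rewrite dotC; exact: measurable_dotr.
Qed.

Lemma normr_trigT_le u y : mu.-integrable setT (EFin \o u) ->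
  `|trigT h u y| <= \int[mu]_x `|u x|.
Proof.
move=> iu; have ik := integrable_trigT_kernel y iu.
apply: le_trans (le_normr_Rintegral measurableT ik) _.
apply: le_Rintegral => //; [exact: integrable_norm|exact: integrable_norm|].
by move=> x _; rewrite normrM ler_piMr//; exact: hw.2.
Qed.

(** Fubini's theorem makes the product of the transform with [gauss] integrable, hence measurable,
    and the positive factor [gauss] is then divided out. *)
Lemma measurable_trigT u : mu.-integrable setT (EFin \o u) ->
  measurable_fun setT (trigT h u).
Proof.
move=> iu; have [i _] := trigT_exchange (integrable_gauss R n) iu.
have {i} /measurable_EFinP mg := measurable_int _ i.
have mV : measurable_fun setT (fun x : 'rV[R]_n => expR (dot x x / 2)).
  apply: measurableT_comp => //; apply: measurable_funM => //.
  exact: measurable_dot_diag.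
have := measurable_funM mV mg.
rewrite (_ : (_ \* _) = trigT h u)//; apply/funext => x /=.
by rewrite mulrA /gauss -expRD subrr expR0 mul1r.
Qed.

Lemma integrable_mul_trigT u w : mu.-integrable setT (EFin \o u) ->
  mu.-integrable setT (EFin \o w) ->
  mu.-integrable setT (EFin \o (fun x => w x * trigT h u x)).
Proof.
move=> iu iw; apply: (integrable_mulr_bounded iw (measurable_trigT iu)).
by move=> x; exact: normr_trigT_le.
Qed.

End trigonometric_transform.

(** * Exchanging a Gaussian average with a test function *)

Section gaussian_convolution.
Variables (R : realType) (n : nat).
Implicit Types (u v w k p : 'rV[R]_n -> R) (x y z : 'rV[R]_n) (r M : R).
Local Notation mu := (lebesgue_rV R n).
Local Notation K := (gauss_mass R n).

Lemma measurable_gauss_diff r :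
  measurable_fun setT (fun q : 'rV[R]_n * 'rV[R]_n => gauss (r *: (q.2 - q.1))).
Proof.
apply: measurableT_comp; first exact: measurable_gauss.
apply/measurable_fun_rVP => i.
rewrite (_ : (fun _ => _) = fun q : 'rV[R]_n * 'rV[R]_n => r * (q.2 ord0 i - q.1 ord0 i)).
  apply: measurable_funM => //; apply: measurable_funB.
    exact: (measurableT_comp (measurable_rV_coord i)).
  exact: (measurableT_comp (measurable_rV_coord i)).
by apply/funext => q; rewrite !mxE.
Qed.

Lemma gauss_le_half y : gauss y <= gauss (2^-1 *: y).
Proof.
rewrite /gauss ler_expR !(dotZl, dotZr); have := dot_ge0 y; lra.
Qed.

Lemma integral_gauss_diff r x : 0 < r ->
  mu.-integrable setT (EFin \o (fun y => gauss (r^-1 *: (y - x)))) /\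
  \int[mu]_y gauss (r^-1 *: (y - x)) = r ^+ n * K.
Proof.
move=> r0; have rV0 : 0 < r^-1 by rewrite invr_gt0.
have E y : gauss (- (r^-1 *: x) + r^-1 *: y) = gauss (r^-1 *: (y - x)).
  by rewrite scalerBr addrC.
have [i e] := integral_affine (- (r^-1 *: x)) rV0 (integrable_gauss R n).
split; first by apply: eq_integrable i => // y _ /=; rewrite E.
have rn0 : r ^+ n != 0 by rewrite expf_neq0// gt_eqF.
rewrite -integral_gauss -e exprVn (mulVKf rn0).
by apply: eq_Rintegral => y _; rewrite E.
Qed.

Section exchange.
Variables (k p : 'rV[R]_n -> R) (M r : R).
Hypotheses (ik : mu.-integrable setT (EFin \o (fun y => k y * gauss (2^-1 *: y))))
  (mp : measurable_fun setT p) (pM : forall x, `|p x| <= M)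
  (r0 : 0 < r) (r1 : r <= 1).

(** The last factor is 1 / gauss(y/2): it cancels the weight under which [k] is integrable. By
    [gauss_mul_le] one factor [gauss x] keeps the quotient below 1; a second one makes [p * gauss]
    integrable. This is the origin of [gauss x ^+ 2] in all test functions. *)
Let b (q : 'rV[R]_n * 'rV[R]_n) : R :=
  gauss q.1 * gauss (r^-1 *: (q.2 - q.1)) * (expR (dot (2^-1 *: q.2) (2^-1 *: q.2) / 2)).

Let VK y : expR (dot (2^-1 *: y) (2^-1 *: y) / 2) * gauss (2^-1 *: y) = 1.
Proof. by rewrite /gauss -expRD subrr expR0. Qed.

Let mb : measurable_fun setT b.
Proof.
apply: measurable_funM; first apply: measurable_funM.
- by apply: measurableT_comp => //; exact: measurable_gauss.
- exact: measurable_gauss_diff.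
- apply: measurableT_comp => //; apply: measurable_funM => //.
  rewrite (_ : (fun _ => _) = fun q : 'rV[R]_n * 'rV[R]_n => 2^-1 * (2^-1 * dot q.2 q.2)).
    do 2 apply: measurable_funM => //.
    exact: (measurableT_comp (@measurable_dot_diag R n) measurable_snd).
  by apply/funext => q; rewrite dotZl dotZr.
Qed.

Let b1 q : `|b q| <= 1.
Proof.
have b0 : 0 <= b q by exact: mulr_ge0 (mulr_ge0 (gauss_ge0 _) (gauss_ge0 _)) (expR_ge0 _).
rewrite (ger0_norm b0) /b -[leRHS](VK q.2) [leRHS]mulrC ler_wpM2r ?expR_ge0//.
exact: gauss_mul_le.
Qed.

Let iu : mu.-integrable setT (EFin \o (fun x => p x * gauss x)).
Proof. exact: (integrable_mul_bounded (integrable_gauss R n) mp pM). Qed.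

Lemma integrable_gauss_conv x :
  mu.-integrable setT (EFin \o (fun y => k y * gauss (r^-1 *: (y - x)))).
Proof.
have := integrableZl measurableT (expR (dot x x / 2)) (integrable_bounded_kernel1 ik mb b1 x).
apply: eq_integrable => // y _ /=; rewrite -EFinM; congr (_%:E); rewrite /b/=.
have VX : expR (dot x x / 2) * gauss x = 1 by rewrite /gauss -expRD subrr expR0.
transitivity (expR (dot x x / 2) * gauss x * (expR (dot (2^-1 *: y) (2^-1 *: y) / 2) *
  gauss (2^-1 *: y)) * (k y * gauss (r^-1 *: (y - x)))); first by ring.
by rewrite VX VK !mul1r.
Qed.

Lemma integrable_gauss_sqr_conv y : mu.-integrable setT
  (EFin \o (fun x => p x * gauss x ^+ 2 * gauss (r^-1 *: (y - x)))).
Proof.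
have : mu.-integrable setT (EFin \o (fun x => p x * gauss x *
     (gauss x * gauss (r^-1 *: (y - x))))).
  apply: (integrable_mulr_bounded (M := 1) iu).
    apply: measurable_funM; first exact: measurable_gauss.
    exact: (measurableT_comp (measurable_gauss_diff r^-1) (pair2_measurable y)).
  move=> x; rewrite ger0_norm ?mulr_ge0 ?gauss_ge0// mulr_ile1 ?gauss_ge0 ?gauss_le1//.
by apply: eq_integrable => // x _ /=; congr (_%:E); ring.
Qed.

Lemma gauss_conv_exchange :
  [/\ mu.-integrable setT (EFin \o (fun x => p x * gauss x ^+ 2 *
        \int[mu]_y (k y * gauss (r^-1 *: (y - x))))),
     mu.-integrable setT (EFin \o (fun y => k y *
        \int[mu]_x (p x * gauss x ^+ 2 * gauss (r^-1 *: (y - x))))) &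
   \int[mu]_x (p x * gauss x ^+ 2 * \int[mu]_y (k y * gauss (r^-1 *: (y - x)))) =
   \int[mu]_y (k y * \int[mu]_x (p x * gauss x ^+ 2 * gauss (r^-1 *: (y - x))))].
Proof.
have E1 x : p x * gauss x * (\int[mu]_y (k y * gauss (2^-1 *: y) * b (x, y))) =
    p x * gauss x ^+ 2 * \int[mu]_y (k y * gauss (r^-1 *: (y - x))).
  rewrite expr2 -!mulrA; congr (_ * (_ * _)).
  rewrite -RintegralZl; [|by []|exact: integrable_gauss_conv].
  apply: eq_Rintegral => y _; rewrite /b/=.
  transitivity (expR (dot (2^-1 *: y) (2^-1 *: y) / 2) * gauss (2^-1 *: y) *
    (gauss x * (k y * gauss (r^-1 *: (y - x))))); first by ring.
  by rewrite VK mul1r.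
have E2 y : k y * gauss (2^-1 *: y) * (\int[mu]_x (p x * gauss x * b (x, y))) =
    k y * \int[mu]_x (p x * gauss x ^+ 2 * gauss (r^-1 *: (y - x))).
  rewrite -mulrA; congr (_ * _).
  rewrite -RintegralZl; [|by []|exact: (integrable_bounded_kernel2 iu mb b1)].
  apply: eq_Rintegral => x _; rewrite /b/=.
  transitivity (expR (dot (2^-1 *: y) (2^-1 *: y) / 2) * gauss (2^-1 *: y) *
    (p x * gauss x ^+ 2 * gauss (r^-1 *: (y - x)))); first by ring.
  by rewrite VK mul1r.
have swap : measurable_fun setT (fun q => b (q.2, q.1)).
  apply: (measurableT_comp mb).
  by apply/measurable_fun_pairP; split; [exact: measurable_snd|exact: measurable_fst].
split.
- by apply: eq_integrable (integrable_kernel1 iu ik mb b1) => // x _ /=; rewrite E1.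
- have := integrable_kernel1 ik iu swap (fun _ => b1 _).
  by apply: eq_integrable => // y _ /=; rewrite -E2.
- pose I (g : 'rV[R]_n -> R) := \int[mu]_x g x.
  apply: (etrans (congr1 I (esym (funext E1)))).
  apply: (etrans _ (congr1 I (funext E2))).
  exact: (Rintegral_kernel_exchange iu ik mb b1).
Qed.

(** The substitution x = y + r z moves r out of the Gaussian into the argument of the test function,
    where the limit r -> 0 can be taken. *)
Lemma gauss_conv_scale y :
  \int[mu]_x (p x * gauss x ^+ 2 * gauss (r^-1 *: (y - x))) =
  r ^+ n * \int[mu]_z (p (y + r *: z) * gauss (y + r *: z) ^+ 2 * gauss z).
Proof.
have [_ <-] := integral_affine y r0 (integrable_gauss_sqr_conv y).
congr (_ * _); apply: eq_Rintegral => z _; congr (_ * _).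
by rewrite opprD addrA subrr add0r scalerN scalerA mulVf ?gt_eqF// scale1r gaussN.
Qed.

End exchange.
End gaussian_convolution.

(** * Energy of the transform of a damped test function *)

Section energy.
Variables (R : realType) (n : nat).
Local Notation mu := (lebesgue_rV R n).
Local Notation K := (gauss_mass R n).
Variables (p : 'rV[R]_n -> R) (M r : R).
Hypotheses (mp : measurable_fun setT p) (pM : forall x, `|p x| <= M)
  (r0 : 0 < r) (r1 : r <= 1).

Let chi x := p x * gauss x ^+ 2.
Let w (x : 'rV[R]_n) := gauss (r *: x).
Let G (x y : 'rV[R]_n) := gauss (r^-1 *: (y - x)).

Let g1 (x : 'rV[R]_n) m : `|gauss x ^+ m| <= 1.
Proof. by rewrite ger0_norm ?exprn_ge0 ?gauss_ge0// exprn_ile1 ?gauss_ge0 ?gauss_le1. Qed.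

Let mg m : measurable_fun setT (fun x : 'rV[R]_n => gauss x ^+ m).
Proof. by apply: measurable_funX; exact: measurable_gauss. Qed.

Let M0 : 0 <= M.
Proof. exact: le_trans (pM 0). Qed.

Lemma integrable_gauss_damped : mu.-integrable setT (EFin \o chi).
Proof.
have : mu.-integrable setT (EFin \o (fun x => p x * gauss x ^+ 1 * gauss x)).
  apply: (integrable_mul_bounded (M := M) (integrable_gauss R n)).
    exact: measurable_funM.
  by move=> x; rewrite normrM -[leRHS]mulr1 ler_pM.
by apply: eq_integrable => // x _ /=; rewrite /chi expr1 expr2 mulrA.
Qed.

Let ichi := integrable_gauss_damped.

Let mchi : measurable_fun setT chi.
Proof. exact: measurable_funM. Qed.

Let chiM x : `|chi x| <= M.
Proof. by rewrite normrM -[leRHS]mulr1 ler_pM. Qed.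

Lemma integrable_gauss_damped_sqr : mu.-integrable setT (EFin \o (fun x => chi x ^+ 2)).
Proof.
exact: (integrable_mul_bounded ichi mchi chiM).
Qed.

Let iw : mu.-integrable setT (EFin \o w).
Proof. exact: integrable_gauss_scale. Qed.

Let iwT h : bounded_wave h -> mu.-integrable setT (EFin \o (fun x => w x * trigT h chi x)).
Proof. by move=> hw; exact: integrable_mul_trigT. Qed.

(** Two uses of the multiplication formula unfold the square of the transform into a quadratic form
    in [chi]. *)
Let wave_energy h : bounded_wave h ->
  \int[mu]_x (w x * trigT h chi x * trigT h chi x) =
  \int[mu]_x (chi x * \int[mu]_y (chi y * trigT h (fun z => w z * h (dot z x)) y)).
Proof.
move=> hw; have [_ <-] := trigT_exchange hw ichi (iwT hw).
apply: eq_Rintegral => x _; congr (_ * _).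
have [_ <-] := trigT_exchange hw (integrable_trigT_kernel hw x iw) ichi.
by apply: eq_Rintegral => y _; rewrite mulrAC.
Qed.

Let iwhh h h' x y : bounded_wave h -> bounded_wave h' ->
  mu.-integrable setT (EFin \o (fun z => w z * h (dot z x) * h' (dot z y))).
Proof.
move=> hw hw'.
exact: (integrable_trigT_kernel hw' y (integrable_trigT_kernel hw x iw)).
Qed.

(** By cos A cos B + sin A sin B = cos(A - B) the sum is the cosine transform of a dilated Gaussian
    at y - x. *)
Let wave_kernel x y :
  trigT cos (fun z => w z * cos (dot z x)) y +
  trigT sin (fun z => w z * sin (dot z x)) y = K / r ^+ n * G y x.
Proof.
rewrite /trigT -RintegralD//; [|exact: (iwhh _ _ (bounded_wave_cos R) (bounded_wave_cos R))|
  exact: (iwhh _ _ (bounded_wave_sin R) (bounded_wave_sin R))].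
rewrite -[RHS]mul1r -cos0 /G -(integral_cos_gauss_scale _ _ r0).
apply: eq_Rintegral => z _; rewrite addr0 dotDl dotNl cosB (dotC x) (dotC y) /w; ring.
Qed.

Let iG y : mu.-integrable setT (EFin \o (fun x => G y x)).
Proof. exact: (integral_gauss_diff y r0).1. Qed.

Let GC x y : G x y = G y x.
Proof. by rewrite /G -opprB scalerN gaussN. Qed.

Let GCf x : (fun y => G y x) = G x.
Proof. by apply/funext => y; rewrite GC. Qed.

Let ichiG x : mu.-integrable setT (EFin \o (fun y => chi y * G y x)).
Proof.
by apply: (integrable_gauss_sqr_conv r mp pM x).
Qed.

Let ichi_conv : mu.-integrable setT (EFin \o (fun y => chi y * gauss (2^-1 *: y))).
Proof.
apply: (integrable_mulr_bounded (M := 1) ichi).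
  by apply: measurableT_comp; [exact: measurable_gauss|exact: measurable_scale].
by move=> x; rewrite ger0_norm ?gauss_ge0 ?gauss_le1.
Qed.

Let one_conv : mu.-integrable setT (EFin \o (fun y : 'rV[R]_n => 1 * gauss (2^-1 *: y))).
Proof.
have h : 0 < 2^-1 :> R by rewrite invr_gt0.
by apply: eq_integrable (integrable_gauss_scale n h) => // x _ /=; rewrite mul1r.
Qed.

Let rn0 : r ^+ n != 0. Proof. by rewrite expf_neq0// gt_eqF. Qed.

(** Schur's test: G is nonnegative, symmetric and of total mass r^n K in each variable, so chi(x)
    chi(y) <= (chi(x)^2 + chi(y)^2)/2 bounds the form by that mass times int chi^2. *)
Let energy_le : \int[mu]_x (chi x * \int[mu]_y (chi y * G y x)) <=
  r ^+ n * K * \int[mu]_x (chi x ^+ 2).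
Proof.
(* Writing chi^2 as [p2 * gauss ^+ 2] gives it the shape required by [gauss_conv_exchange], applied
   with the constant 1 in place of [k]. *)
pose p2 x := p x ^+ 2 * gauss x ^+ 2.
have mp2 : measurable_fun setT p2 by apply: measurable_funM => //; exact: measurable_funX.
have p2M x : `|p2 x| <= M ^+ 2.
  by rewrite normrM -[leRHS]mulr1 ler_pM// normrX lerXn2r// nnegrE.
have chi2E x : chi x ^+ 2 = p2 x * gauss x ^+ 2 by rewrite /chi /p2; ring.
have i1 : mu.-integrable setT (EFin \o (fun x => chi x * \int[mu]_y (chi y * G y x))).
  by have [_ i _] := gauss_conv_exchange ichi_conv mp pM r0 r1.
have [_ i2 e2] := gauss_conv_exchange one_conv mp2 p2M r0 r1.
pose B x := \int[mu]_y (chi y ^+ 2 * G y x).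
have BE : B = fun x => 1 * \int[mu]_y (p2 y * gauss y ^+ 2 * gauss (r^-1 *: (x - y))).
  by apply/funext => x; rewrite mul1r; apply: eq_Rintegral => y _; rewrite chi2E.
have iB : mu.-integrable setT (EFin \o B) by rewrite BE; exact: i2.
have eB : \int[mu]_x B x = r ^+ n * K * \int[mu]_x (chi x ^+ 2).
  rewrite BE; apply: (etrans (esym e2)).
  rewrite -[RHS]RintegralZl; [|by []|exact: integrable_gauss_damped_sqr].
  apply: eq_Rintegral => x _; rewrite mulrC chi2E; congr (_ * _).
  by rewrite -(integral_gauss_diff x r0).2; apply: eq_Rintegral => y _; rewrite mul1r.
clear BE.
have i3 : mu.-integrable setT (EFin \o (fun x => r ^+ n * K * chi x ^+ 2)).
  exact: (integrable_mulrl (r ^+ n * K) integrable_gauss_damped_sqr).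
apply: (@le_trans _ _ (\int[mu]_x (2^-1 * (r ^+ n * K * chi x ^+ 2 + B x)))).
  apply: le_Rintegral; [by []|exact: i1|
    exact: (integrable_mulrl 2^-1 (integrable_addr i3 iB))|].
  move=> x _.
  have iGx0 : mu.-integrable setT (EFin \o (fun y => G y x)).
    by rewrite GCf; exact: iG.
  have iGx : mu.-integrable setT (EFin \o (fun y => chi x ^+ 2 * G y x)).
    exact: (integrable_mulrl (chi x ^+ 2) iGx0).
  have iBx : mu.-integrable setT (EFin \o (fun y => chi y ^+ 2 * G y x)).
    have := integrable_gauss_sqr_conv r mp2 p2M x.
    by apply: eq_integrable => [//|] y _; rewrite /= chi2E.
  have -> : r ^+ n * K * chi x ^+ 2 = \int[mu]_y (chi x ^+ 2 * G y x).
    rewrite RintegralZl; [|by []|exact: iGx0].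
    by rewrite GCf mulrC (integral_gauss_diff x r0).2.
  rewrite -RintegralD; [|by []|exact: iGx|exact: iBx].
  rewrite -RintegralZl; [|by []|exact: ichiG].
  rewrite -RintegralZl; [|by []|exact: (integrable_addr iGx iBx)].
  apply: le_Rintegral; [by []| | |].
  - exact: (integrable_mulrl (chi x) (ichiG x)).
  - exact: (integrable_mulrl 2^-1 (integrable_addr iGx iBx)).
  - by move=> y _; apply: weighted_amgm; exact: gauss_ge0.
rewrite RintegralZl; [|by []|exact: (integrable_addr i3 iB)].
rewrite RintegralD; [|by []|exact: i3|exact: iB].
rewrite eB RintegralZl; [|by []|exact: integrable_gauss_damped_sqr].
by set z := r ^+ n * K * _; rewrite -mulr2n -[z *+ 2]mulr_natl mulKf// pnatr_eq0.
Qed.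

(** An inequality of Plancherel type with a Gaussian cutoff [w], uniform in r: the quadratic form
    has kernel (K / r^n) G, whose mass is K^2. *)
Lemma trigT_energy_le :
  \int[mu]_x (w x * trigT cos chi x ^+ 2) +
  \int[mu]_x (w x * trigT sin chi x ^+ 2) <= K ^+ 2 * \int[mu]_x (chi x ^+ 2).
Proof.
have e h : bounded_wave h -> \int[mu]_x (w x * trigT h chi x ^+ 2) =
  \int[mu]_x (w x * trigT h chi x * trigT h chi x).
  by move=> _; apply: eq_Rintegral => x _; rewrite expr2 mulrA.
rewrite !e; [|exact: bounded_wave_sin|exact: bounded_wave_cos].
rewrite !wave_energy; [|exact: bounded_wave_sin|exact: bounded_wave_cos].
have ie h x : bounded_wave h -> mu.-integrable setT (EFin \o
    (fun y => chi y * trigT h (fun z => w z * h (dot z x)) y)).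
  by move=> hw; apply: integrable_mul_trigT => //; exact: integrable_trigT_kernel.
have ii h : bounded_wave h -> mu.-integrable setT (EFin \o
   (fun x => chi x * \int[mu]_y (chi y * trigT h (fun z => w z * h (dot z x)) y))).
  move=> hw; have [i _] := trigT_exchange hw ichi (iwT hw).
  apply: eq_integrable i => // x _ /=; congr ((_ * _)%:E).
  have [_ <-] := trigT_exchange hw (integrable_trigT_kernel hw x iw) ichi.
  by apply: eq_Rintegral => y _; rewrite mulrAC.
rewrite -RintegralD; [|by []|exact: ii (bounded_wave_cos R)|exact: ii (bounded_wave_sin R)].
have -> : K ^+ 2 * \int[mu]_x (chi x ^+ 2) =
    K / r ^+ n * (r ^+ n * K * \int[mu]_x (chi x ^+ 2)).
  by rewrite mulrA; congr (_ * _); field.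
apply: le_trans (ler_wpM2l _ energy_le); last first.
  by rewrite divr_ge0 ?exprn_ge0 ?ltW// (lt_le_trans ltr01)// gauss_mass_ge1.
rewrite -RintegralZl; [|by []|by have [_ i _] := gauss_conv_exchange ichi_conv mp pM r0 r1].
rewrite le_eqVlt; apply/orP; left; apply/eqP; apply: eq_Rintegral => x _.
rewrite -mulrDr mulrCA; congr (_ * _).
rewrite -RintegralD; [|by []|exact: (ie _ _ (bounded_wave_cos R))|exact: (ie _ _ (bounded_wave_sin R))].
rewrite -RintegralZl; [|by []|exact: ichiG].
by apply: eq_Rintegral => y _; rewrite -mulrDr wave_kernel mulrCA.
Qed.

End energy.

(** * The L^2 inequality *)

(** The weight is kept on [c] alone: [c] will be a transform whose energy is controlled with the
    cutoff, while [b] is square integrable by itself. *)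
Lemma damped_amgm (R : realFieldType) (a b c : R) : 0 <= a -> a <= 1 ->
  2 * (a * (b * c)) <= b ^+ 2 + a * c ^+ 2.
Proof.
move=> a0 a1; have := mulr_ge0 a0 (sqr_ge0 (b - c)).
have : 0 <= (1 - a) * b ^+ 2 by rewrite mulr_ge0 ?sqr_ge0// subr_ge0.
lra.
Qed.

Lemma parseval_combine (R : realFieldType) (a b e1 e2 t1 t2 s : R) :
  2 * `|a| <= e1 + t1 -> 2 * `|b| <= e2 + t2 -> t1 + t2 <= s ->
  2 * (a - b) <= e1 + e2 + s.
Proof.
by have := ler_norm a; have := ler_norm (- b); rewrite normrN; lra.
Qed.

(** The 2 on the left side leaves one copy of c S after absorption: 2 c S <= 2 c I <= e + c S. *)
Lemma absorb_le (R : realFieldType) (c S I e : R) : 1 <= c -> 0 <= S ->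
  S <= I -> 2 * c * I <= e + c * S -> S <= e.
Proof.
move=> c1 S0 SI h; have h1 : c * S <= c * I by rewrite ler_wpM2l// (le_trans ler01).
have h2 : S <= c * S by rewrite ler_peMl.
move: h; rewrite -mulrA; lra.
Qed.

Section plancherel_le.
Variables (R : realType) (n : nat).
Local Notation mu := (lebesgue_rV R n).
Local Notation K := (gauss_mass R n).
Implicit Types (p q g : 'rV[R]_n -> R) (r M : R) (h : R -> R) (x y z : 'rV[R]_n).
Variables (k K1 K2 : 'rV[R]_n -> R).
Hypotheses (mk : measurable_fun setT k)
  (ik : mu.-integrable setT (EFin \o (fun y => k y * gauss (2^-1 *: y))))
  (mK1 : measurable_fun setT K1) (mK2 : measurable_fun setT K2)
  (iK1 : mu.-integrable setT (EFin \o (fun x => K1 x ^+ 2)))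
  (iK2 : mu.-integrable setT (EFin \o (fun x => K2 x ^+ 2))).
(** The right side is the real part of the unnormalised inverse transform of K1 + i K2 damped by
    [gauss (r *: xi)]; the left side is a Gaussian average of [k] around x. *)
Hypothesis transform_k : forall r x, 0 < r -> r <= 2^-1 ->
  K / r ^+ n * \int[mu]_y (k y * gauss (r^-1 *: (y - x))) =
  trigT cos (fun xi => gauss (r *: xi) * K1 xi) x -
  trigT sin (fun xi => gauss (r *: xi) * K2 xi) x.

Let E := \int[mu]_x (K1 x ^+ 2) + \int[mu]_x (K2 x ^+ 2).

Let K0 : 0 < K.
Proof. exact: lt_le_trans (gauss_mass_ge1 R n). Qed.

Let gauss_normr_le1 (x : 'rV[R]_n) : `|gauss x| <= 1.
Proof. by rewrite ger0_norm ?gauss_ge0 ?gauss_le1. Qed.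

Let measurable_w (r : R) : measurable_fun setT (fun x : 'rV[R]_n => gauss (r *: x)).
Proof. by apply: measurableT_comp; [exact: measurable_gauss|exact: measurable_scale]. Qed.

Let integrable_w_mul (r : R) (g : 'rV[R]_n -> R) : 0 < r -> measurable_fun setT g ->
  mu.-integrable setT (EFin \o (fun x => g x ^+ 2)) ->
  mu.-integrable setT (EFin \o (fun x => gauss (r *: x) * g x)).
Proof.
move=> r0 mg ig; apply: integrable_mul_sqr => //.
exact: (integrable_mul_bounded (M := 1) (integrable_gauss_scale n r0)).
Qed.

(** The multiplication formula moves the transform from [g] to [chi], and [damped_amgm] then
    separates the two in such a way that the cutoff stays on the energy of [chi]. *)
Let half_parseval (r : R) (h : R -> R) (p : 'rV[R]_n -> R) (M : R) (g : 'rV[R]_n -> R) : bounded_wave h -> 0 < r ->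
  measurable_fun setT p -> (forall x, `|p x| <= M) ->
  measurable_fun setT g -> mu.-integrable setT (EFin \o (fun x => g x ^+ 2)) ->
  let chi x := p x * gauss x ^+ 2 in
  mu.-integrable setT (EFin \o (fun x => chi x * trigT h (fun xi => gauss (r *: xi) * g xi) x)) /\
  2 * `|\int[mu]_x (chi x * trigT h (fun xi => gauss (r *: xi) * g xi) x)| <=
  \int[mu]_x (g x ^+ 2) + \int[mu]_x (gauss (r *: x) * trigT h chi x ^+ 2).
Proof.
move=> hw r0 mp pM mg ig chi.
have ichi := integrable_gauss_damped mp pM.
have iwg := integrable_w_mul r0 mg ig.
have [i e] := trigT_exchange hw ichi iwg; split; first exact: i.
rewrite e; have i1 := integrable_mul_trigT hw ichi iwg.
have i2 : mu.-integrable setT (EFin \o (fun x => gauss (r *: x) * trigT h chi x ^+ 2)).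
  have iw := integrable_mul_trigT hw ichi (integrable_gauss_scale n r0).
  have := integrable_mulr_bounded iw (measurable_trigT hw ichi)
    (fun x => normr_trigT_le hw x ichi).
  by apply: eq_integrable => [//|] x _; rewrite /= expr2 mulrA.
apply: (@le_trans _ _ (2 * \int[mu]_x `|gauss (r *: x) * g x * trigT h chi x|)).
  by apply: ler_wpM2l; [exact: ler0n|exact: (le_normr_Rintegral measurableT i1)].
rewrite -RintegralD; [|by []|exact: ig|exact: i2].
rewrite -RintegralZl; [|by []|exact: integrable_norm].
apply: le_Rintegral; [by []| | |].
- exact: (integrable_mulrl 2 (integrable_norm i1)).
- exact: (integrable_addr ig i2).
move=> x _; rewrite -mulrA normrM (ger0_norm (gauss_ge0 _)) normrM.
rewrite -(real_normK (num_real (g x))) -(real_normK (num_real (trigT h chi x))).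
by apply: damped_amgm; [exact: gauss_ge0|exact: gauss_le1].
Qed.

Let measurable_mollification p M r : 0 < r -> r <= 1 ->
  measurable_fun setT p -> (forall x, `|p x| <= M) ->
  measurable_fun setT (fun y =>
    \int[mu]_z (p (y + r *: z) * gauss (y + r *: z) ^+ 2 * gauss z)).
Proof.
move=> r0 r1 mp pM; have rn0 : r ^+ n != 0 by rewrite expf_neq0// gt_eqF.
have ig : mu.-integrable setT (EFin \o (fun y => gauss y * gauss (2^-1 *: y))).
  by apply: (integrable_mulr_bounded (M := 1) (integrable_gauss R n)).
have [_ i _] := gauss_conv_exchange ig mp pM r0 r1.
have {i} /measurable_EFinP mc := measurable_int _ i.
have mV : measurable_fun setT (fun x : 'rV[R]_n => (r ^+ n)^-1 * expR (dot x x / 2)).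
  apply: measurable_funM => //; apply: measurableT_comp => //.
  by apply: measurable_funM => //; exact: measurable_dot_diag.
have := measurable_funM mV mc.
rewrite (_ : (_ \* _) = fun y =>
  \int[mu]_z (p (y + r *: z) * gauss (y + r *: z) ^+ 2 * gauss z)) //.
apply/funext => y /=; rewrite (gauss_conv_scale mp pM r0).
move: (Rintegral _ _ _) => I.
have VX : expR (dot y y / 2) * gauss y = 1 by rewrite /gauss -expRD subrr expR0.
transitivity (expR (dot y y / 2) * gauss y * ((r ^+ n)^-1 * r ^+ n) * I); first by ring.
by rewrite VX mulVf// !mul1r.
Qed.

Lemma mollified_pairing_le p M r : 0 < r -> r <= 2^-1 ->
  measurable_fun setT p -> (forall x, `|p x| <= M) ->
  2 * K * \int[mu]_y (k y *
    \int[mu]_z (p (y + r *: z) * gauss (y + r *: z) ^+ 2 * gauss z)) <=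
  E + K ^+ 2 * \int[mu]_x ((p x * gauss x ^+ 2) ^+ 2).
Proof.
move=> r0 rh mp pM; have r1 : r <= 1 by apply: le_trans rh _; rewrite invf_le1// ler1n.
have rn0 : r ^+ n != 0 by rewrite expf_neq0// gt_eqF.
have [ia ib e] := gauss_conv_exchange ik mp pM r0 r1.
have [i1 h1] := half_parseval (bounded_wave_cos R) r0 mp pM mK1 iK1.
have [i2 h2] := half_parseval (bounded_wave_sin R) r0 mp pM mK2 iK2.
have h3 := trigT_energy_le mp pM r0 r1.
rewrite -(mulrA 2 K).
have -> : K * \int[mu]_y (k y *
    \int[mu]_z (p (y + r *: z) * gauss (y + r *: z) ^+ 2 * gauss z)) =
  \int[mu]_x (p x * gauss x ^+ 2 * trigT cos (fun xi => gauss (r *: xi) * K1 xi) x) -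
  \int[mu]_x (p x * gauss x ^+ 2 * trigT sin (fun xi => gauss (r *: xi) * K2 xi) x) :> R.
  rewrite -RintegralB; [|by []|exact: i1|exact: i2].
  (* The Jacobian r^n of [gauss_conv_scale] cancels against K / r^n from the Gaussian transform, so
     that no constant blows up as r -> 0. *)
  transitivity (K / r ^+ n * \int[mu]_y (k y * (r ^+ n *
    \int[mu]_z (p (y + r *: z) * gauss (y + r *: z) ^+ 2 * gauss z)))).
    rewrite (_ : (fun y => k y * (r ^+ n * _)) = fun y => r ^+ n * (k y *
      \int[mu]_z (p (y + r *: z) * gauss (y + r *: z) ^+ 2 * gauss z))); last first.
      by apply/funext => y; rewrite mulrCA.
    rewrite [in RHS]RintegralZl; first by rewrite mulrA divfK.
      by [].
    have := integrable_mulrl (r ^+ n)^-1 ib.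
    apply: eq_integrable => [//|] y _ /=.
    by rewrite (gauss_conv_scale mp pM r0) mulrCA mulKf.
  rewrite (_ : (fun y => k y * (r ^+ n * _)) = fun y => k y *
     \int[mu]_x (p x * gauss x ^+ 2 * gauss (r^-1 *: (y - x)))); last first.
    by apply/funext => y; rewrite (gauss_conv_scale mp pM r0).
  rewrite -e -RintegralZl; [|by []|exact: ia].
  apply: eq_Rintegral => x _.
  by rewrite -mulrBr -transform_k; [exact: mulrCA|exact: r0|exact: rh].
exact: parseval_combine h1 h2 h3.
Qed.

Let ikg : mu.-integrable setT (EFin \o (fun y => k y * gauss y ^+ 2)).
Proof.
have mV : measurable_fun setT (fun x : 'rV[R]_n =>
    expR (dot (2^-1 *: x) (2^-1 *: x) / 2) * gauss x ^+ 2).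
  apply: measurable_funM; last by apply: measurable_funX; exact: measurable_gauss.
  apply: measurableT_comp => //; apply: measurable_funM => //.
  under eq_fun do rewrite dotZl dotZr.
  by do 2 apply: measurable_funM => //; exact: measurable_dot_diag.
have := integrable_mulr_bounded (M := 1) ik mV.
have VK y : gauss (2^-1 *: y) * expR (dot (2^-1 *: y) (2^-1 *: y) / 2) = 1 :> R.
  by rewrite /gauss -expRD addNr expR0.
move=> h; apply: eq_integrable (h _) => //.
  by move=> y _ /=; congr (_%:E); rewrite -mulrA (mulrA (gauss _)) VK mul1r.
move=> y; rewrite ger0_norm ?mulr_ge0 ?expR_ge0 ?exprn_ge0 ?gauss_ge0//.
rewrite -[leRHS](VK y) mulrC ler_wpM2r ?expR_ge0//.
apply: le_trans (gauss_le_half y); rewrite expr2 ler_piMr ?gauss_ge0 ?gauss_le1//.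
Qed.

Let damped_le (p : 'rV[R]_n -> R) M x : (forall x, `|p x| <= M) ->
  `|(p x * gauss x ^+ 2) ^+ 2| <= M ^+ 2 * gauss x.
Proof.
move=> pM; rewrite normrX normrM (ger0_norm (exprn_ge0 _ (gauss_ge0 x))) exprMn.
apply: ler_pM; rewrite ?exprn_ge0 ?gauss_ge0//.
  by rewrite lerXn2r// nnegrE// (le_trans _ (pM x)).
have g1 := gauss_le1 x; have g0 := gauss_ge0 x.
by rewrite -exprM (exprD _ 1 3) expr1 ler_piMr// exprn_ile1.
Qed.

(** Limit of [mollified_pairing_le]: the average against the unnormalised Gaussian tends to K p
    gauss^2, which turns the factor 2 K into 2 K^2. *)
Let pairing_le_base p M : measurable_fun setT p -> (forall x, `|p x| <= M) ->
  ray_continuous p ->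
  2 * K ^+ 2 * \int[mu]_y (k y * (p y * gauss y ^+ 2)) <=
  E + K ^+ 2 * \int[mu]_x ((p x * gauss x ^+ 2) ^+ 2).
Proof.
move=> mp pM rp.
pose r (j : nat) : R := j.+2%:R^-1.
have r0 j : 0 < r j by rewrite invr_gt0.
have rh j : r j <= 2^-1 by rewrite lef_pV2 ?posrE// ler_nat.
have M0 : 0 <= M by exact: le_trans (pM 0).
pose I j y := \int[mu]_z (p (y + r j *: z) * gauss (y + r j *: z) ^+ 2 * gauss z).
have ig := integrable_gauss R n.
have h2 : 0 < 2^-1 :> R by rewrite invr_gt0.
have ray_gauss : ray_continuous (@gauss R n).
  move=> x z; rewrite /gauss.
  apply: continuous_cvg; first exact: continuous_expR.
  apply: cvgN; apply: cvgM; last exact: cvg_cst.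
  have r_cvg : r j @[j --> \oo] --> 0.
    rewrite (_ : r = [sequence @harmonic R j.+1]_j)//.
    by rewrite cvg_shiftS; exact: cvg_harmonic.
  have : dot x x + 2 * (r j * dot x z) + r j * (r j * dot z z) @[j --> \oo] -->
      dot x x + 2 * (0 * dot x z) + 0 * (0 * dot z z).
    apply: cvgD; first apply: cvgD; first exact: cvg_cst.
      by apply: cvgMr; apply: cvgMl.
    by apply: cvgM => //; exact: cvgMl.
  rewrite !mul0r mulr0 !addr0 => h; apply: cvg_trans h; apply: near_eq_cvg.
  apply: nearW => j; rewrite !(dotDl, dotDr, dotZl, dotZr) (dotC z x) -/(r j).
  by move: (r j) (dot x x) (dot x z) (dot z z) => b A B C; ring.
have Ibd j y z : `|p (y + r j *: z) * gauss (y + r j *: z) ^+ 2 * gauss z| <=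
    M * (gauss y * gauss (2^-1 *: z)).
  rewrite -mulrA normrM ler_pM//.
  rewrite ger0_norm ?mulr_ge0 ?exprn_ge0 ?gauss_ge0//.
  by apply: gauss_shift_le => //; exact: ltW.
have mI1 j y : measurable_fun setT
    (fun z => p (y + r j *: z) * gauss (y + r j *: z) ^+ 2 * gauss z).
  apply: measurable_funM; last exact: measurable_gauss.
  apply: (measurableT_comp (f := fun x => p x * gauss x ^+ 2)); last exact: measurable_affine.
  by apply: measurable_funM => //; apply: measurable_funX; exact: measurable_gauss.
have Icvg y : I j y @[j --> \oo] --> K * (p y * gauss y ^+ 2).
  have -> : K * (p y * gauss y ^+ 2) = \int[mu]_z (p y * gauss y ^+ 2 * gauss z).
    by rewrite RintegralZl; [rewrite integral_gauss mulrC|by []|exact: ig].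
  apply: (cvg_Rintegral_dominated (g := fun z => M * (gauss y * gauss (2^-1 *: z)))) => //.
  - have := integrable_mulrl (M * gauss y) (integrable_gauss_scale n h2).
    by apply: eq_integrable => // z _ /=; rewrite mulrA.
  - move=> z; apply: cvgMl; apply: cvgM; first exact: rp.
    by under eq_fun do rewrite expr2; rewrite expr2; apply: cvgM; exact: ray_gauss.
(* A majorant in y that does not depend on j and carries exactly the weight under which [k] is
   integrable. *)
have IM j y : `|I j y| <= M * (K / 2^-1 ^+ n) * gauss (2^-1 *: y).
  have i1 : mu.-integrable setT (EFin \o
     (fun z => p (y + r j *: z) * gauss (y + r j *: z) ^+ 2 * gauss z)).
    apply: (@le_integrable _ _ _ mu setT measurableT _
      (EFin \o (fun z => M * (gauss y * gauss (2^-1 *: z))))).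
    - exact/measurable_EFinP.
    - by move=> z _ /=; rewrite lee_fin (le_trans (Ibd j y z))// ler_norm.
    - have := integrable_mulrl (M * gauss y) (integrable_gauss_scale n h2).
      by apply: eq_integrable => // z _ /=; rewrite mulrA.
  apply: le_trans (le_normr_Rintegral measurableT i1) _.
  apply: (@le_trans _ _ (\int[mu]_z (M * gauss y * gauss (2^-1 *: z)))).
    apply: le_Rintegral; [by []| | |].
    - exact: integrable_norm.
    - exact: (integrable_mulrl (M * gauss y) (integrable_gauss_scale n h2)).
    - by move=> z _; rewrite -[leRHS]mulrA; exact: Ibd.
  rewrite RintegralZl; [|by []|exact: integrable_gauss_scale].
  have -> : \int[mu]_z gauss (2^-1 *: z) = K / 2^-1 ^+ n.
    have := integral_cos_gauss_scale (0 : 'rV[R]_n) 0 h2.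
    rewrite cos0 mul1r scaler0 {2}/gauss dot0r mul0r oppr0 expR0 mulr1 => <-.
    by apply: eq_Rintegral => z _; rewrite dotC dot0r addr0 cos0 mul1r.
  rewrite mulrAC; apply: ler_wpM2l; last exact: gauss_le_half.
  by apply: mulr_ge0 => //; apply: divr_ge0; [exact: ltW|rewrite exprn_ge0// ltW].
have mI j : measurable_fun setT (I j).
  apply: (measurable_mollification (r0 j) _ mp pM).
  by apply: le_trans (rh j) _; rewrite invf_le1// ler1n.
have C : \int[mu]_y (k y * I j y) @[j --> \oo] -->
    \int[mu]_y (k y * (K * (p y * gauss y ^+ 2))).
  apply: (cvg_Rintegral_dominated
    (g := fun y => M * (K / 2^-1 ^+ n) * `|k y * gauss (2^-1 *: y)|)).
  - by move=> j; exact: measurable_funM.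
  - exact: (integrable_mulrl (M * (K / 2^-1 ^+ n)) (integrable_norm ik)).
  - move=> j y; rewrite !normrM (ger0_norm (gauss_ge0 _)) mulrCA.
    by rewrite ler_wpM2l// mulrC; exact: IM.
  - by move=> y; apply: cvgMr; exact: Icvg.
have -> : 2 * K ^+ 2 * \int[mu]_y (k y * (p y * gauss y ^+ 2)) =
    2 * K * \int[mu]_y (k y * (K * (p y * gauss y ^+ 2))).
  rewrite (_ : (fun y => k y * (K * _)) = fun y => K * (k y * (p y * gauss y ^+ 2))).
    rewrite [in RHS]RintegralZl; first by rewrite mulrA -(mulrA 2 K) expr2.
      by [].
    have := integrable_mulr_bounded ikg mp pM.
    by apply: eq_integrable => [//|] y _ /=; congr (_%:E); rewrite -mulrA (mulrC (gauss y ^+ 2)).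
  by apply/funext => y; rewrite mulrCA.
apply: (ler_cvg_to (a := \oo) (f := fun j => 2 * K * \int[mu]_y (k y * I j y))
  (g := fun=> E + K ^+ 2 * \int[mu]_x ((p x * gauss x ^+ 2) ^+ 2))).
- by apply: cvgMr; exact: C.
- exact: cvg_cst.
- by apply: nearW => j; exact: (mollified_pairing_le (r0 j) (rh j) mp pM).
Qed.

Let pairing_le q : baire q ->
  2 * K ^+ 2 * \int[mu]_y (k y * (q y * gauss y ^+ 2)) <=
  E + K ^+ 2 * \int[mu]_x ((q x * gauss x ^+ 2) ^+ 2).
Proof.
elim=> {q} [q M mq qM rq|p q M bp IH pM pq].
  exact: pairing_le_base mq qM rq.
have mp j : measurable_fun setT (p j) := (baire_measurable_bounded (bp j)).1.
have mg2 : measurable_fun setT (fun x : 'rV[R]_n => gauss x ^+ 2).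
  by apply: measurable_funX; exact: measurable_gauss.
have c1 : \int[mu]_y (k y * (p j y * gauss y ^+ 2)) @[j --> \oo] -->
    \int[mu]_y (k y * (q y * gauss y ^+ 2)).
  apply: (cvg_Rintegral_dominated (g := fun y => M * `|k y * gauss y ^+ 2|)).
  - by move=> j; apply: measurable_funM => //; exact: measurable_funM.
  - exact: (integrable_mulrl M (integrable_norm ikg)).
  - by move=> j y; rewrite mulrCA normrM; apply: ler_wpM2r.
  - by move=> y; apply: cvgMr; apply: cvgMl; exact: pq.
have c2 : \int[mu]_x ((p j x * gauss x ^+ 2) ^+ 2) @[j --> \oo] -->
    \int[mu]_x ((q x * gauss x ^+ 2) ^+ 2).
  apply: (cvg_Rintegral_dominated (g := fun x => M ^+ 2 * gauss x)).
  - by move=> j; apply: measurable_funX; exact: measurable_funM.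
  - exact: (integrable_mulrl (M ^+ 2) (integrable_gauss R n)).
  - by move=> j x; apply: damped_le => y; exact: pM.
  - move=> x; under eq_fun do rewrite expr2; rewrite expr2.
    by apply: cvgM; apply: cvgMl; exact: pq.
apply: (ler_cvg_to (a := \oo)
  (f := fun j => 2 * K ^+ 2 * \int[mu]_y (k y * (p j y * gauss y ^+ 2)))
  (g := fun j => E + K ^+ 2 * \int[mu]_x ((p j x * gauss x ^+ 2) ^+ 2))).
- by apply: cvgMr; exact: c1.
- by apply: cvgD; [exact: cvg_cst|apply: cvgMr; exact: c2].
- by apply: nearW => j; exact: IH.
Qed.

Import HBNNSimple.

(** With chi = s gauss^2, the hypothesis gives chi <= k where s > 0, hence chi^2 <= k chi
    everywhere, as both sides vanish where s = 0. So int chi^2 <= int k chi, and [absorb_le] applies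
    because int chi^2 is finite. *)
Let simple_le (s : {nnsfun 'rV[R]_n >-> R}) :
  (forall x, s x <= Num.max (k x / gauss x ^+ 2) 0) ->
  \int[mu]_x ((s x * gauss x ^+ 2) ^+ 2) <= E.
Proof.
move=> sk; have bs := baire_nnsfun s.
have [ms [M sM]] := baire_measurable_bounded bs.
have i1 : mu.-integrable setT (EFin \o (fun x => (s x * gauss x ^+ 2) ^+ 2)).
  exact: (integrable_gauss_damped_sqr ms sM).
have i2 : mu.-integrable setT (EFin \o (fun y => k y * (s y * gauss y ^+ 2))).
  have := integrable_mulr_bounded ikg ms sM.
  by apply: eq_integrable => [//|] y _ /=; rewrite -mulrA (mulrC (gauss y ^+ 2)).
have le1 : \int[mu]_x ((s x * gauss x ^+ 2) ^+ 2) <=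
    \int[mu]_y (k y * (s y * gauss y ^+ 2)).
  apply: le_Rintegral; [by []|exact: i1|exact: i2|] => x _.
  have s0 : 0 <= s x by [].
  have g0 : 0 < gauss x ^+ 2 by rewrite exprn_gt0// gauss_gt0.
  rewrite expr2; have [->|sn0] := eqVneq (s x) 0; first by rewrite !mul0r mulr0.
  have sp : 0 < s x by rewrite lt_neqAle eq_sym sn0.
  apply: ler_wpM2r; first by rewrite mulr_ge0// ltW.
  have := sk x; rewrite le_max => /orP[|]; last by rewrite leNgt sp.
  by rewrite ler_pdivlMr.
have := pairing_le bs; move: le1.
have S0 : 0 <= \int[mu]_x ((s x * gauss x ^+ 2) ^+ 2).
  by apply: Rintegral_ge0 => x _; exact: sqr_ge0.
have K1' : 1 <= K ^+ 2 by apply: exprn_ege1; exact: gauss_mass_ge1.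
exact: absorb_le K1' S0.
Qed.

Lemma sqr_funrpos_integral_le :
  (\int[mu]_x ((Num.max (k x) 0) ^+ 2)%:E <= E%:E)%E.
Proof.
(* Approximating the positive part of k / gauss^2 rather than that of k compensates the damping: s_j
   gauss^2 increases to the positive part of k. *)
pose f x := (Num.max (k x / gauss x ^+ 2) 0)%:E.
have mg2 : measurable_fun setT (fun x : 'rV[R]_n => gauss x ^+ 2).
  by apply: measurable_funX; exact: measurable_gauss.
have mV : measurable_fun setT (fun x : 'rV[R]_n => (gauss x ^+ 2)^-1).
  rewrite (_ : (fun _ => _) = fun x : 'rV[R]_n => expR (dot x x / 2) ^+ 2).
    apply: measurable_funX; apply: measurableT_comp => //.
    by apply: measurable_funM => //; exact: measurable_dot_diag.
  by apply/funext => x; rewrite -exprVn /gauss -expRN opprK.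
have mf : measurable_fun setT f.
  apply/measurable_EFinP; apply: measurable_maxr => //.
  exact: measurable_funM.
have f0 x : setT x -> (0 <= f x)%E by move=> _; rewrite lee_fin le_max lexx orbT.
pose s := nnsfun_approx measurableT mf.
have scvg x : s j x @[j --> \oo] --> Num.max (k x / gauss x ^+ 2) 0.
  have := cvg_nnsfun_approx measurableT mf f0 (I : setT x).
  by move/fine_cvg.
have snd x : nondecreasing_seq (s ^~ x).
  by move=> i j ij; have /lefP := nd_nnsfun_approx measurableT mf ij; exact.
have sle j x : s j x <= Num.max (k x / gauss x ^+ 2) 0.
  have cs : cvgn (fun i => s i x) by exact: cvgP (scvg x).
  by have := nondecreasing_cvgn_le (snd x) cs j; rewrite (cvg_lim _ (scvg x)).
have ms j : measurable_fun setT (s j) by exact: measurable_funP.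
have kE x : Num.max (k x) 0 = Num.max (k x / gauss x ^+ 2) 0 * gauss x ^+ 2.
  have g0 : 0 < gauss x ^+ 2 by rewrite exprn_gt0// gauss_gt0.
  by rewrite maxr_pMl ?mul0r ?divfK ?gt_eqF// ltW.
have -> : (\int[mu]_x ((Num.max (k x) 0) ^+ 2)%:E =
    limn (fun j => \int[mu]_x ((s j x * gauss x ^+ 2) ^+ 2)%:E))%E.
  rewrite -monotone_convergence.
  - apply: eq_integral => x _; apply/esym/cvg_lim => //.
    apply: cvg_EFin; first exact: nearW.
    rewrite kE; under eq_fun do rewrite /= expr2; rewrite expr2.
    by apply: cvgM; apply: cvgMl; exact: scvg.
  - by [].
  - move=> j; apply/measurable_EFinP; apply: measurable_funX.
    exact: measurable_funM.
  - by move=> j x _; rewrite lee_fin sqr_ge0.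
  - move=> x _ i j ij; rewrite lee_fin lerXn2r ?nnegrE ?mulr_ge0 ?exprn_ge0 ?gauss_ge0//.
    by rewrite ler_wpM2r ?exprn_ge0 ?gauss_ge0//; exact: snd.
apply: lime_le.
  apply: ereal_nondecreasing_is_cvgn => i j ij; apply: ge0_le_integral => //.
  - by move=> x _; rewrite lee_fin sqr_ge0.
  - apply/measurable_EFinP; apply: measurable_funX; exact: measurable_funM.
  - apply/measurable_EFinP; apply: measurable_funX; exact: measurable_funM.
  - move=> x _; rewrite lee_fin lerXn2r ?nnegrE ?mulr_ge0 ?exprn_ge0 ?gauss_ge0//.
    by rewrite ler_wpM2r ?exprn_ge0 ?gauss_ge0//; exact: snd.
apply: nearW => j; have [_ [M sM]] := baire_measurable_bounded (baire_nnsfun (s j)).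
have i1 := integrable_gauss_damped_sqr (ms j) sM.
rewrite -(fineK (integrable_fin_num measurableT i1)) lee_fin.
exact: (simple_le (sle j)).
Qed.

End plancherel_le.

(** * The pointwise bound on the symbol *)

Section symbol_bound.
Variable R : realType.
Implicit Types (x y t e m : R).

Lemma normr_sin_le x : `|sin x| <= `|x|.
Proof.
wlog x0 : x / 0 <= x => [H|].
  have [/H//|x0] := leP 0 x.
  by rewrite -normrN -sinN -[leRHS]normrN; apply: H; rewrite oppr_ge0 ltW.
have [c _] := @MVT_segment R sin cos 0 x x0 (fun z _ => is_derive_sin z)
  (continuous_subspaceT (@continuous_sin R)).
rewrite sin0 !subr0 => ->; rewrite normrM ler_piMl//; exact: cos_max.
Qed.

(** Subadditivity lets the two terms of the phase be estimated with different exponents. *)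
Lemma normr_sinD_le x y : `|sin (x + y)| <= `|sin x| + `|sin y|.
Proof.
rewrite sinD; apply: le_trans (ler_normD _ _) _; rewrite !normrM.
by rewrite lerD// ?ler_piMr ?ler_piMl ?cos_max.
Qed.

(** Interpolation between |sin x| <= 1, used when u >= 1, and |sin x| <= |x|, used when u < 1. *)
Lemma normr_sin_le_powR x u v : 0 <= v -> v <= 1 -> `|x| <= u ->
  `|sin x| <= u `^ v.
Proof.
move=> v0 v1 xu; have u0 : 0 <= u by apply: le_trans xu.
have [u1|u1] := leP 1 u.
  apply: le_trans (sin_max _) _; rewrite -(powRr0 u).
  by apply: ler_powR.
have [uz|un0] := eqVneq u 0.
  have -> : x = 0 by apply/eqP; rewrite -normr_le0 -uz.
  by rewrite sin0 normr0 powR_ge0.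
apply: le_trans (normr_sin_le x) _; apply: le_trans xu _.
by apply: ger1_powR => //; rewrite lt_neqAle eq_sym un0 u0 ltW.
Qed.

(** The left side is |e^(i theta) - 1|^2 = 4 sin(theta/2)^2. Each of the two terms of the phase
    contributes at most t^del J^s to |sin(theta/2)|, where J^2 = 1 + e^2 and rho = 2 del, whence 16
    = 4 * 2^2. *)
Lemma oscillation_bound (beta a s t m e theta rho : R) :
  1 <= a -> 0 < s -> s <= a -> (beta <= 1 -> a * (1 - beta) < s) ->
  0 <= t -> t <= 1 -> 0 <= e -> `|m| <= e ->
  theta = t `^ beta * m + t * e `^ a ->
  rho = (if beta <= 1 then 2 * (beta - 1 + s / a) else 2 * s / a) ->
  (cos theta - 1) ^+ 2 + sin theta ^+ 2 <= 16 * t `^ rho * (1 + e ^+ 2) `^ s.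
Proof.
move=> a1 s0 sa sb t0 t1 e0 me thetaE rhoE0.
have a0 : 0 < a by apply: lt_le_trans a1; exact: ltr01.
pose J := Num.sqrt (1 + e ^+ 2); pose sg := s / a.
have sg0 : 0 < sg by rewrite divr_gt0.
have sg1 : sg <= 1 by rewrite ler_pdivrMr// mul1r.
have asg : a * sg = s by rewrite /sg mulrC divfK// gt_eqF.
have sgs : sg <= s by rewrite -asg ler_peMl// ltW.
have J1 : 1 <= J by rewrite -[leLHS]sqrtr1 ler_wsqrtr// lerDl sqr_ge0.
have eJ : e <= J.
  by rewrite -[leLHS]ger0_norm// -sqrtr_sqr ler_wsqrtr// lerDr.
have J0 : 0 <= J by rewrite (le_trans ler01).
pose del := if beta <= 1 then beta - 1 + sg else sg.
have rhoE : rho = del * 2.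
  by rewrite rhoE0 /del /sg; case: ifP => _; rewrite ?mulrA; ring.
have delsg : del <= sg by rewrite /del; case: ifP => // b1; lra.
(* For beta <= 1, a (1 - beta) < s <= a forces beta > 0. *)
have b0 : 0 < beta.
  have [b1|b1] := leP beta 1; last exact: lt_trans b1.
  have := sb b1; rewrite -asg ltr_pM2l//; lra.
have del0 : 0 < del.
  rewrite /del; case: ifP => // b1.
  by have := sb b1; rewrite -asg ltr_pM2l//; lra.
have thalf : `|sin (theta / 2)| <= 2 * (t `^ del * J `^ s).
  (* At t = 0 the phase vanishes because 0^beta = 0, which relies on beta being nonzero. *)
  have [tz|tn0] := eqVneq t 0.
    rewrite thetaE tz powR0 ?gt_eqF// !mul0r addr0 mul0r sin0 normr0.
    by rewrite !mulr_ge0 ?powR_ge0.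
  have tp : 0 < t by rewrite lt_neqAle eq_sym tn0.
  have t01 : 0 < t <= 1 by rewrite tp.
  rewrite thetaE mulrDl; apply: le_trans (normr_sinD_le _ _) _.
  rewrite mulr_natl mulr2n; apply: lerD.
    have bd : `|t `^ beta * m / 2| <= t `^ beta * J.
      rewrite !normrM (ger0_norm (powR_ge0 _ _)) -mulrA ler_wpM2l ?powR_ge0//.
      rewrite normfV (ger0_norm (ler0n _ 2)) ler_pdivrMr//.
      by apply: le_trans me _; apply: le_trans eJ _; rewrite ler_peMr// ler1n.
    rewrite /del; case: ifP => b1.
      have d1 : beta - 1 + sg <= beta by lra.
      have d0 : 0 < beta - 1 + sg by move: del0; rewrite /del b1.
      have tau0 : 0 <= (beta - 1 + sg) / beta by rewrite divr_ge0 ?ltW.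
      have tau1 : (beta - 1 + sg) / beta <= 1 by rewrite ler_pdivrMr// mul1r.
      apply: le_trans (normr_sin_le_powR tau0 tau1 bd) _.
      rewrite powRM ?powR_ge0// -powRrM (mulrC beta) divfK ?gt_eqF//.
      rewrite ler_wpM2l ?powR_ge0//; apply: ler_powR => //.
      (* The power of J must not exceed s, that is, del <= s beta. If s >= 1 this follows from del
         <= beta; otherwise from del <= beta - 1 + s and (1 - beta)(1 - s) >= 0. *)
      rewrite ler_pdivrMr//; have [s1|s1] := leP 1 s.
        by apply: le_trans d1 _; rewrite ler_peMl// ltW.
      have := mulr_ge0 (_ : 0 <= 1 - beta) (_ : 0 <= 1 - s); rewrite !subr_ge0.
      by move=> /(_ b1 (ltW s1)); lra.
    apply: le_trans (normr_sin_le_powR (ltW sg0) sg1 bd) _.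
    rewrite -[in X in _ <= X]asg powRrM -powRM ?powR_ge0//.
    apply: ge0_ler_powR; [exact: ltW|by rewrite nnegrE mulr_ge0 ?powR_ge0|
      by rewrite nnegrE mulr_ge0 ?powR_ge0|].
    apply: ler_pM => //; first exact: powR_ge0.
      by apply: ge1r_powR => //; rewrite ltW// ltNge b1.
    exact: le1r_powR.
  have bd : `|t * e `^ a / 2| <= t * J `^ a.
    rewrite !normrM (ger0_norm t0) (ger0_norm (powR_ge0 _ _)) -mulrA ler_wpM2l//.
    rewrite normfV (ger0_norm (ler0n _ 2)) ler_pdivrMr//.
    have eJa : e `^ a <= J `^ a by apply: ge0_ler_powR => //; exact: ltW.
    by apply: le_trans eJa _; rewrite ler_peMr ?powR_ge0// ler1n.
  apply: le_trans (normr_sin_le_powR (ltW sg0) sg1 bd) _.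
  rewrite powRM ?powR_ge0// -powRrM asg ler_wpM2r ?powR_ge0//.
  exact: ger_powR.
have -> : (cos theta - 1) ^+ 2 + sin theta ^+ 2 = 4 * `|sin (theta / 2)| ^+ 2.
  have h2 : theta = (theta / 2) *+ 2 by rewrite -mulr_natr divfK.
  have c2 : cos theta = 1 - 2 * sin (theta / 2) ^+ 2.
    by rewrite {1}h2 cos_mulr2n cos2sin2; lra.
  by rewrite sin2cos2 c2 real_normK ?num_real//; ring.
have -> : 16 * t `^ rho * (1 + e ^+ 2) `^ s = 4 * (2 * (t `^ del * J `^ s)) ^+ 2.
  have q x y : 0 <= x -> x `^ (y * 2) = (x `^ y) ^+ 2.
    by move=> x0; rewrite powRrM -powR_mulrn ?powR_ge0.
  have JE : (1 + e ^+ 2) `^ s = (J `^ s) ^+ 2.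
    have -> : 1 + e ^+ 2 = J `^ 2.
      by rewrite powR_mulrn// sqr_sqrtr// addr_ge0// sqr_ge0.
    by rewrite -powRrM mulrC q.
  rewrite rhoE q// JE; ring.
by rewrite ler_wpM2l// lerXn2r// nnegrE !mulr_ge0 ?powR_ge0.
Qed.

Lemma nneseries_lty_cvg0 (f : nat -> \bar R) : (forall k, 0 <= f k)%E ->
  (\sum_(0 <= k <oo) f k < +oo)%E -> f k @[k --> \oo] --> 0%E.
Proof.
move=> f0 foo; have tl := nneseries_tail_cvg foo (fun k _ => f0 k).
apply: (squeeze_cvge _ (cvg_cst 0%E) tl); apply: nearW => k; rewrite f0/=.
have := @nneseries_lim_ge R f xpredT k k.+1 (fun i _ _ => f0 i).
by rewrite big_nat1.
Qed.

End symbol_bound.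

(** * From the positive part to a real function *)

Section real_plancherel.
Variables (R : realType) (n : nat).
Local Notation mu := (lebesgue_rV R n).
Local Notation K := (gauss_mass R n).

(** [sqr_funrpos_integral_le] is applied to k and to -k, whose positive parts have squares adding up
    to k^2; hence the factor 2. *)
Lemma sqr_integral_le (k K1 K2 : 'rV[R]_n -> R) :
  measurable_fun setT k -> measurable_fun setT K1 -> measurable_fun setT K2 ->
  mu.-integrable setT (EFin \o (fun x => K1 x ^+ 2)) ->
  mu.-integrable setT (EFin \o (fun x => K2 x ^+ 2)) ->
  (forall r x, 0 < r ->
    mu.-integrable setT (EFin \o (fun y => k y * gauss (r^-1 *: (y - x))))) ->
  (forall r x, 0 < r ->
    K / r ^+ n * \int[mu]_y (k y * gauss (r^-1 *: (y - x))) =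
    \int[mu]_xi (gauss (r *: xi) *
      (K1 xi * cos (dot x xi) - K2 xi * sin (dot x xi)))) ->
  (\int[mu]_x (k x ^+ 2)%:E <=
   (2 * (\int[mu]_x (K1 x ^+ 2) + \int[mu]_x (K2 x ^+ 2)))%:E)%E.
Proof.
move=> mk mK1 mK2 iK1 iK2 ik tr.
(* The sign c = 1 or -1 treats k and -k at once; it disappears from the squares of K1 and K2. *)
have pos (k' L1 L2 : 'rV[R]_n -> R) (c : R) : c ^+ 2 = 1 ->
    (k' = fun x => c * k x) -> (L1 = fun x => c * K1 x) -> (L2 = fun x => c * K2 x) ->
    (\int[mu]_x ((Num.max (k' x) 0) ^+ 2)%:E <=
     (\int[mu]_x (K1 x ^+ 2) + \int[mu]_x (K2 x ^+ 2))%:E)%E.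
  move=> c2 k'E L1E L2E.
  have mk' : measurable_fun setT k' by rewrite k'E; exact: measurable_funM.
  have mL1 : measurable_fun setT L1 by rewrite L1E; exact: measurable_funM.
  have mL2 : measurable_fun setT L2 by rewrite L2E; exact: measurable_funM.
  have s1 : (fun x => L1 x ^+ 2) = (fun x => K1 x ^+ 2).
    by apply/funext => x; rewrite L1E exprMn c2 mul1r.
  have s2 : (fun x => L2 x ^+ 2) = (fun x => K2 x ^+ 2).
    by apply/funext => x; rewrite L2E exprMn c2 mul1r.
  have iL1 : mu.-integrable setT (EFin \o (fun x => L1 x ^+ 2)) by rewrite s1.
  have iL2 : mu.-integrable setT (EFin \o (fun x => L2 x ^+ 2)) by rewrite s2.
  have ik' : mu.-integrable setT (EFin \o (fun y => k' y * gauss (2^-1 *: y))).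
    have := integrable_mulrl c (ik 2 0 (ltr0n _ 2)).
    by apply: eq_integrable => [//|] x _; rewrite /= k'E subr0 mulrA.
  have wL r (L : 'rV[R]_n -> R) : 0 < r -> measurable_fun setT L ->
      mu.-integrable setT (EFin \o (fun x => L x ^+ 2)) ->
      mu.-integrable setT (EFin \o (fun x => gauss (r *: x) * L x)).
    move=> r0 mL iL.
    have mw : measurable_fun setT (fun x : 'rV[R]_n => gauss (r *: x)).
      by apply: measurableT_comp; [exact: measurable_gauss|exact: measurable_scale].
    apply: integrable_mul_sqr => //.
    apply: (integrable_mul_bounded (M := 1) (integrable_gauss_scale n r0)) => //.
    by move=> x; rewrite ger0_norm ?gauss_ge0 ?gauss_le1.
  have := sqr_funrpos_integral_le mk' ik' mL1 mL2 iL1 iL2.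
  rewrite s1 s2; apply => r x r0 _.
  have iw1 := wL r L1 r0 mL1 iL1; have iw2 := wL r L2 r0 mL2 iL2.
  rewrite /trigT -RintegralB; [|by []|
    exact: (integrable_trigT_kernel (bounded_wave_cos R) x iw1)|
    exact: (integrable_trigT_kernel (bounded_wave_sin R) x iw2)].
  transitivity (c * (K / r ^+ n * \int[mu]_y (k y * gauss (r^-1 *: (y - x))))).
    rewrite [RHS]mulrCA; congr (_ * _).
    rewrite -RintegralZl; [|by []|exact: ik].
    by apply: eq_Rintegral => y _; rewrite k'E mulrA.
  rewrite tr// -RintegralZl; [|by []|]; last first.
    have h1 := integrable_trigT_kernel (bounded_wave_cos R) x (wL r K1 r0 mK1 iK1).
    have h2 := integrable_trigT_kernel (bounded_wave_sin R) x (wL r K2 r0 mK2 iK2).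
    have := integrable_addr h1 (integrable_mulrl (-1) h2).
    by apply: eq_integrable => [//|] y _; rewrite /= (dotC y); congr (_%:E); ring.
  by apply: eq_Rintegral => y _; rewrite L1E L2E (dotC y); ring.
have p1 := pos k K1 K2 1; have p2 := pos (fun x => - k x) (fun x => - K1 x) (fun x => - K2 x) (-1).
have {}p1 : (\int[mu]_x ((Num.max (k x) 0) ^+ 2)%:E <=
     (\int[mu]_x (K1 x ^+ 2) + \int[mu]_x (K2 x ^+ 2))%:E)%E.
  by apply: p1; rewrite ?expr1n//; apply/funext => x; rewrite mul1r.
have {}p2 : (\int[mu]_x ((Num.max (- k x) 0) ^+ 2)%:E <=
     (\int[mu]_x (K1 x ^+ 2) + \int[mu]_x (K2 x ^+ 2))%:E)%E.
  by apply: p2; rewrite ?sqrrN ?expr1n//; apply/funext => x; rewrite mulN1r.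
have -> : (\int[mu]_x (k x ^+ 2)%:E = \int[mu]_x ((Num.max (k x) 0) ^+ 2)%:E +
    \int[mu]_x ((Num.max (- k x) 0) ^+ 2)%:E)%E.
  rewrite -ge0_integralD.
  - apply: eq_integral => x _; rewrite -EFinD; congr (_%:E).
    rewrite !maxEle oppr_le0; case: (ltgtP (k x) 0) => [_|_|->] /=.
    + by rewrite expr0n add0r sqrrN.
    + by rewrite expr0n addr0.
    + by rewrite expr0n addr0.
  - by [].
  - by move=> x _; rewrite lee_fin sqr_ge0.
  - by apply/measurable_EFinP; apply: measurable_funX; exact: measurable_maxr.
  - by move=> x _; rewrite lee_fin sqr_ge0.
  - apply/measurable_EFinP; apply: measurable_funX; apply: measurable_maxr => //.
    exact: measurableT_comp.
by rewrite mulr_natl mulr2n [leRHS]EFinD leeD.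
Qed.

End real_plancherel.

(** * Gaussian wave packets *)

Local Open Scope complex_scope.

Section cabs_theory.
Variable R : realType.
Implicit Type z : R[i].

Lemma cabsE z : cabs z = Num.sqrt (complex.Re z ^+ 2 + complex.Im z ^+ 2).
Proof. by case: z. Qed.

Lemma sqr_cabs z : cabs z ^+ 2 = complex.Re z ^+ 2 + complex.Im z ^+ 2.
Proof. by rewrite cabsE sqr_sqrtr// addr_ge0// sqr_ge0. Qed.

Lemma cabs_le z : cabs z <= `|complex.Re z| + `|complex.Im z|.
Proof.
rewrite cabsE -[leRHS]ger0_norm ?addr_ge0// -sqrtr_sqr ler_wsqrtr// sqrrD.
by rewrite !real_normK ?num_real// lerD2r lerDl mulrn_wge0// mulr_ge0.
Qed.

End cabs_theory.

Section gaussian_symbols.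
Variables (R : realType) (n : nat).
Implicit Types (p q : 'rV[R]_n -> R) (x y z v b : 'rV[R]_n) (c : R).

(** Turns a directional derivative into a derivative in one variable, to which the chain rule
    [is_derive1_comp] applies. *)
Lemma is_derive_line (p : 'rV[R]_n -> R) x v (d : R) :
  is_derive (0 : R) (1 : R) (fun t : R => p (t *: v + x)) d -> is_derive x v p d.
Proof.
have E : (fun h : R => h^-1 *: ((p \o shift x) (h *: v) - p x)) =
    (fun h : R => h^-1 *: (((fun t : R => p (t *: v + x)) \o shift 0) (h *: (1 : R)) -
       p (0 *: v + x))).
  apply/funext => h /=; congr (_ *: (p (_ + x) - p _)); last by rewrite scale0r add0r.
  by rewrite addr0 /GRing.scale/= mulr1.
by move=> [dp de]; split; [rewrite /derivable E|rewrite -de /derive E].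
Qed.

(* A class of factors of at most polynomial growth, stable under derivation; its
   products with a Gaussian are Schwartz functions. *)
Inductive symbol : ('rV[R]_n -> R) -> Prop :=
| symbol_cst c : symbol (fun=> c)
| symbol_coord i : symbol (fun x => x ord0 i)
| symbol_cos y : symbol (fun x => cos (dot y x))
| symbol_sin y : symbol (fun x => sin (dot y x))
| symbol_add p q : symbol p -> symbol q -> symbol (fun x => p x + q x)
| symbol_mul p q : symbol p -> symbol q -> symbol (fun x => p x * q x).

Lemma dot_basis x i : dot x (@basis_vec R n i) = x ord0 i.
Proof.
rewrite /dot (bigD1 i)//= /basis_vec mxE !eqxx mulr1 big1 ?addr0// => j ji.
by rewrite mxE (negbTE ji) andbF mulr0.
Qed.

Lemma symbol_derive p i : symbol p ->
  exists2 q, symbol q & forall x, is_derive x (@basis_vec R n i) p (q x).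
Proof.
elim=> {p} [c|j|y|y|p q sp [p' sp' dp] sq [q' sq' dq]|p q sp [p' sp' dp] sq [q' sq' dq]].
- by exists (fun=> 0); [exact: symbol_cst|move=> x; exact: is_derive_cst].
- exists (fun=> @basis_vec R n i ord0 j); first exact: symbol_cst.
  move=> x; apply: is_derive_line.
  rewrite (_ : (fun t : R => _) = fun t : R => @basis_vec R n i ord0 j * t + x ord0 j).
    exact: is_derive_affine.
  by apply/funext => t; rewrite !mxE mulrC.
- exists (fun x => - y ord0 i * sin (dot y x)).
    by apply: symbol_mul; [exact: symbol_cst|exact: symbol_sin].
  move=> x; apply: is_derive_line.
  rewrite (_ : (fun t : R => _) = fun t : R => cos (y ord0 i * t + dot y x)).
    have d := is_derive_affine (y ord0 i) (dot y x) 0.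
    have : is_derive (0 : R) (1 : R) (fun t : R => cos (y ord0 i * t + dot y x))
        (- sin (y ord0 i * 0 + dot y x) * y ord0 i).
      exact: (@is_derive1_comp _ cos (fun t => y ord0 i * t + dot y x)).
    by rewrite mulr0 add0r mulNr (mulrC (sin _)) -mulNr.
  by apply/funext => t; rewrite dotDr dotZr dot_basis mulrC.
- exists (fun x => y ord0 i * cos (dot y x)).
    by apply: symbol_mul; [exact: symbol_cst|exact: symbol_cos].
  move=> x; apply: is_derive_line.
  rewrite (_ : (fun t : R => _) = fun t : R => sin (y ord0 i * t + dot y x)).
    have d := is_derive_affine (y ord0 i) (dot y x) 0.
    have : is_derive (0 : R) (1 : R) (fun t : R => sin (y ord0 i * t + dot y x))
        (cos (y ord0 i * 0 + dot y x) * y ord0 i).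
      exact: (@is_derive1_comp _ sin (fun t => y ord0 i * t + dot y x)).
    by rewrite mulr0 add0r (mulrC (cos _)).
  by apply/funext => t; rewrite dotDr dotZr dot_basis mulrC.
- exists (fun x => p' x + q' x); first exact: symbol_add.
  by move=> x; exact: is_deriveD.
- exists (fun x => p x * q' x + q x * p' x).
    by apply: symbol_add; exact: symbol_mul.
  by move=> x; exact: is_deriveM.
Qed.

Lemma normr_coord_le_enorm x i : `|x ord0 i| <= enorm x.
Proof.
rewrite -sqrtr_sqr ler_wsqrtr// (bigD1 i)//= lerDl.
by apply: sumr_ge0 => j _; exact: sqr_ge0.
Qed.

Lemma enorm_ge0 x : 0 <= enorm x.
Proof. exact: sqrtr_ge0. Qed.

Lemma symbol_growth p : symbol p ->
  exists C N, 0 <= C /\ forall x, `|p x| <= C * (1 + enorm x) ^+ N.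
Proof.
have e1 x : 1 <= 1 + enorm x by rewrite lerDl enorm_ge0.
elim=> {p} [c|j|y|y|p q _ [C [N [C0 pC]]] _ [D [M [D0 qD]]]
  |p q _ [C [N [C0 pC]]] _ [D [M [D0 qD]]]].
- by exists `|c|, 0%N; split => // x; rewrite expr0 mulr1.
- exists 1, 1%N; split => // x; rewrite expr1 mul1r.
  by apply: le_trans (normr_coord_le_enorm x j) _; rewrite lerDr.
- by exists 1, 0%N; split => // x; rewrite expr0 mulr1 cos_max.
- by exists 1, 0%N; split => // x; rewrite expr0 mulr1 sin_max.
- exists (C + D), (N + M)%N; split; first exact: addr_ge0.
  move=> x; apply: le_trans (ler_normD _ _) _; rewrite mulrDl lerD//.
    apply: le_trans (pC x) _; rewrite ler_wpM2l// ler_weXn2l//.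
    exact: leq_addr.
  apply: le_trans (qD x) _; rewrite ler_wpM2l// ler_weXn2l//.
  exact: leq_addl.
- exists (C * D), (N + M)%N; split; first exact: mulr_ge0.
  by move=> x; rewrite normrM exprD mulrACA ler_pM.
Qed.

(** One family for both sides of the Fourier transform: wave packets have centre 0 and c = r^2/2,
    their transforms have centre x and c = r^(-2)/2. *)
Definition bell c b x : R := expR (- (c * dot (x - b) (x - b))).

Lemma is_derive_bell c b x i :
  is_derive x (@basis_vec R n i) (bell c b) (- (2 * c * (x ord0 i - b ord0 i)) * bell c b x).
Proof.
apply: is_derive_line; set v := @basis_vec R n i.
pose A := dot v v; pose B := x ord0 i - b ord0 i; pose C := dot (x - b) (x - b).
have BE : dot (x - b) v = B by rewrite dot_basis !mxE.
rewrite (_ : (fun t : R => _) = fun t : R => expR (- (c * (A * t ^+ 2 + 2 * B * t + C)))).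
  have d : is_derive (0 : R) 1 (fun t : R => - (c * (A * t ^+ 2 + 2 * B * t + C)))
      (- (2 * c * B)).
    by apply: is_derive_eq; rewrite /GRing.scale/=; lra.
  have : is_derive (0 : R) (1 : R)
      (fun t : R => expR (- (c * (A * t ^+ 2 + 2 * B * t + C))))
      (expR (- (c * (A * 0 ^+ 2 + 2 * B * 0 + C))) * - (2 * c * B)).
    exact: (@is_derive1_comp _ expR (fun t => - (c * (A * t ^+ 2 + 2 * B * t + C)))).
  rewrite expr0n/= !mulr0 !add0r => dd.
  by apply: (@is_derive_eq _ _ _ _ _ _ _ _ dd); exact: mulrC.
apply/funext => t; rewrite /bell -addrA; congr (expR (- (c * _))).
by rewrite !(dotDl _ (x - b)) !(dotDr _ _ (x - b)) !dotZr !dotZl (dotC v) BE -/A -/C; ring.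
Qed.

Lemma symbol_bell_derive p c b i : symbol p ->
  exists2 q, symbol q &
   forall x, is_derive x (@basis_vec R n i) (fun x => p x * bell c b x) (q x * bell c b x).
Proof.
move=> sp; have [q sq dq] := symbol_derive i sp.
exists (fun x => p x * (- (2 * c) * (x ord0 i + - b ord0 i)) + q x).
  apply: symbol_add => //; apply: symbol_mul => //; apply: symbol_mul.
    exact: symbol_cst.
  by apply: symbol_add; [exact: symbol_coord|exact: symbol_cst].
move=> x; have d1 := dq x; have d2 := is_derive_bell c b x i.
apply: is_derive_eq; rewrite /GRing.scale/=; ring.
Qed.

Lemma bell_decay c b N : 0 < c ->
  exists C, 0 <= C /\ forall x, (1 + enorm x) ^+ N * bell c b x <= C.
Proof.
(* With u = 1 + |x|, the inequality u^2/D <= e^(u^2/D) raised to the power m gives u^(2m) <= D^m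
   e^(c u^2/4) for this D. That exponent is absorbed by the bell, since u^2 <= 2 + 4 |x - b|^2 + 4
   |b|^2. Taking N + 1 keeps m positive. *)
move=> c0; pose m : R := N.+1%:R; pose D : R := 4 * m / c.
have m0 : 0 < m by rewrite ltr0n.
have D0 : 0 < D by rewrite divr_gt0// mulr_gt0.
exists (D ^+ N.+1 * expR (c / 2 + c * dot b b)).
split; first by rewrite mulr_ge0 ?expR_ge0// exprn_ge0// ltW.
move=> x; set u := 1 + enorm x.
have u1 : 1 <= u by rewrite lerDl enorm_ge0.
have h1 : u ^+ N <= (u ^+ 2) ^+ N.+1.
  by rewrite -exprM ler_weXn2l// mul2n -addnn addSn ltnW// ltnS leq_addr.
have h2 : (u ^+ 2) ^+ N.+1 <= D ^+ N.+1 * expR (c / 4 * u ^+ 2).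
  have -> : c / 4 * u ^+ 2 = m * (u ^+ 2 / D).
    by rewrite /D; field; rewrite !gt_eqF.
  rewrite expRM_natl -exprMn; apply: lerXn2r.
  - by rewrite nnegrE sqr_ge0.
  - by rewrite nnegrE mulr_ge0 ?expR_ge0// ltW.
  rewrite mulrC -ler_pdivrMr//; apply: le_trans (expR_ge1Dx _).
  by rewrite lerDr.
have h3 : expR (c / 4 * u ^+ 2) * bell c b x <= expR (c / 2 + c * dot b b).
  rewrite /bell -expRD ler_expR.
  have := dotDD_le (x - b) b; rewrite subrK -sqr_enorm /u.
  have := sqr_ge0 (1 - enorm x).
  move: (enorm x) (dot (x - b) (x - b)) (dot b b) => e d bb e1 e2.
  have e3 : (1 + e) ^+ 2 <= 2 + 4 * d + 4 * bb by lra.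
  have : c * (1 + e) ^+ 2 <= c * (2 + 4 * d + 4 * bb) by rewrite ler_wpM2l// ltW.
  lra.
apply: le_trans (_ : D ^+ N.+1 * (expR (c / 4 * u ^+ 2) * bell c b x) <= _).
  by rewrite mulrA ler_wpM2r ?expR_ge0// (le_trans h1).
by rewrite ler_wpM2l// exprn_ge0// ltW.
Qed.

Lemma partials_symbol p1 p2 c b l : symbol p1 -> symbol p2 ->
  exists q1 q2, [/\ symbol q1, symbol q2 &
    partials l (fun x => (p1 x * bell c b x) +i* (p2 x * bell c b x)) =
    fun x => (q1 x * bell c b x) +i* (q2 x * bell c b x)].
Proof.
move=> s1 s2; elim: l => [|i l [q1 [q2 [t1 t2 e]]]] /=.
  by exists p1, p2.
have [r1 u1 d1] := symbol_bell_derive c b i t1.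
have [r2 u2 d2] := symbol_bell_derive c b i t2.
exists r1, r2; split => //; rewrite -/(partials l _) e; apply/funext => x.
rewrite /partial.
have -> : reF (fun x => (q1 x * bell c b x) +i* (q2 x * bell c b x)) =
  fun x => q1 x * bell c b x by [].
have -> : imF (fun x => (q1 x * bell c b x) +i* (q2 x * bell c b x)) =
  fun x => q2 x * bell c b x by [].
by have [_ ->] := d1 x; have [_ ->] := d2 x.
Qed.

Lemma schwartz_bell p1 p2 c b : 0 < c -> symbol p1 -> symbol p2 ->
  schwartz (fun x => (p1 x * bell c b x) +i* (p2 x * bell c b x)).
Proof.
move=> c0 s1 s2; split.
  move=> l i x; have [q1 [q2 [t1 t2 ->]]] := partials_symbol c b l s1 s2.
  have [r1 u1 d1] := symbol_bell_derive c b i t1.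
  have [r2 u2 d2] := symbol_bell_derive c b i t2.
  by split; [have [] := d1 x|have [] := d2 x].
move=> N l; have [q1 [q2 [t1 t2 ->]]] := partials_symbol c b l s1 s2.
have [C1 [N1 [C10 h1]]] := symbol_growth t1.
have [C2 [N2 [C20 h2]]] := symbol_growth t2.
have [D1 [D10 k1]] := bell_decay b (N + N1) c0.
have [D2 [D20 k2]] := bell_decay b (N + N2) c0.
exists (C1 * D1 + C2 * D2) => x.
have e0 : 0 <= (1 + enorm x) ^+ N by rewrite exprn_ge0// addr_ge0// enorm_ge0.
have b0 : 0 <= bell c b x by exact: expR_ge0.
apply: le_trans (ler_wpM2l e0 (cabs_le _)) _; rewrite mulrDr /= !normrM (ger0_norm b0).
have aux (q C D : R) M : 0 <= C -> q <= C * (1 + enorm x) ^+ M ->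
    (1 + enorm x) ^+ (N + M) * bell c b x <= D ->
    (1 + enorm x) ^+ N * (q * bell c b x) <= C * D.
  move=> C0 hq hD; apply: le_trans (_ : C * ((1 + enorm x) ^+ (N + M) * bell c b x) <= _).
    have -> : C * ((1 + enorm x) ^+ (N + M) * bell c b x) =
        (1 + enorm x) ^+ N * (C * (1 + enorm x) ^+ M * bell c b x).
      by rewrite exprD; ring.
    by rewrite ler_wpM2l// ler_wpM2r.
  by rewrite ler_wpM2l.
by apply: lerD; [exact: aux (h1 x) (k1 x)|exact: aux (h2 x) (k2 x)].
Qed.

End gaussian_symbols.

Section fourier_gaussian.
Variables (R : realType) (n : nat).
Implicit Types (x y xi : 'rV[R]_n) (r : R).
Local Notation mu := (lebesgue_rV R n).
Local Notation K := (gauss_mass R n).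

(** This is e^(i x.xi) e^(-r^2 |xi|^2 / 2). Its transform is a real bump of width r around x, so
    testing a distribution identity on it yields the Gaussian average of the function near x. *)
Definition wave_packet r x xi : R[i] :=
  (cos (dot x xi) * gauss (r *: xi)) +i* (sin (dot x xi) * gauss (r *: xi)).

Definition wave_packet_hat r x y : R[i] :=
  (K / r ^+ n * gauss (r^-1 *: (y - x))) +i* 0.

Lemma schwartz_wave_packet r x : 0 < r -> schwartz (wave_packet r x).
Proof.
move=> r0; have c0 : 0 < r ^+ 2 / 2 by rewrite divr_gt0// exprn_gt0.
have := schwartz_bell 0 c0 (symbol_cos x) (symbol_sin x).
rewrite (_ : (fun _ => _) = wave_packet r x)//; apply/funext => xi.
rewrite /wave_packet /bell /gauss subr0 dotZl dotZr.
by have -> : r ^+ 2 / 2 * dot xi xi = r * (r * dot xi xi) / 2 by ring.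
Qed.

Lemma schwartz_wave_packet_hat r x : 0 < r -> schwartz (wave_packet_hat r x).
Proof.
move=> r0; have c0 : 0 < r^-1 ^+ 2 / 2 by rewrite divr_gt0// exprn_gt0// invr_gt0.
have := schwartz_bell x c0 (symbol_cst n (K / r ^+ n)) (symbol_cst n 0).
rewrite (_ : (fun _ => _) = wave_packet_hat r x)//; apply/funext => y.
rewrite /wave_packet_hat /bell /gauss dotZl dotZr mul0r.
by have -> : r^-1 ^+ 2 / 2 * dot (y - x) (y - x) =
  r^-1 * (r^-1 * dot (y - x) (y - x)) / 2 by ring.
Qed.

Lemma fourier_wave_packet r x : 0 < r ->
  fourier (wave_packet r x) = wave_packet_hat r x.
Proof.
move=> r0; apply/funext => y; rewrite /fourier /cintegral /wave_packet_hat.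
congr (_ +i* _).
  transitivity (\int[mu]_xi (cos (dot (x - y) xi + 0) * gauss (r *: xi))).
    apply: eq_Rintegral => xi _; rewrite /reF /wave_packet /expi /=.
    rewrite addr0 dotDl dotNl cosB cosN sinN; ring.
  rewrite integral_cos_gauss_scale// cos0 mul1r; congr (_ * _).
  by rewrite -gaussN -scalerN opprB.
(* The sine is a cosine with phase -pi/2, so the same formula applies and its factor cos(-pi/2)
   vanishes. *)
transitivity (\int[mu]_xi (cos (dot (x - y) xi + - (pi / 2)) * gauss (r *: xi))).
  apply: eq_Rintegral => xi _; rewrite /imF /wave_packet /expi /=.
  rewrite cosBpihalf dotDl dotNl sinB cosN sinN; ring.
by rewrite integral_cos_gauss_scale// cosN cos_pihalf mul0r.
Qed.

End fourier_gaussian.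

(** * The evolution *)

Section complex_plancherel.
Variables (R : realType) (n : nat).
Implicit Types (f g h H F phi : 'rV[R]_n -> R[i]).
Local Notation mu := (lebesgue_rV R n).
Local Notation K := (gauss_mass R n).

Lemma cmeasurableB f g : cmeasurable f -> cmeasurable g ->
  cmeasurable (fun x => f x - g x).
Proof.
move=> [f1 f2] [g1 g2]; split.
  rewrite (_ : reF _ = fun x => reF f x - reF g x); first exact: measurable_funB.
  by apply/funext => x; rewrite /reF; case: (f x) (g x) => [? ?] [? ?].
rewrite (_ : imF _ = fun x => imF f x - imF g x); first exact: measurable_funB.
by apply/funext => x; rewrite /imF; case: (f x) (g x) => [? ?] [? ?].
Qed.

Lemma measurable_sqr_cabs f : cmeasurable f ->
  measurable_fun setT (fun x => cabs (f x) ^+ 2).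
Proof.
move=> [f1 f2]; under eq_fun do rewrite sqr_cabs.
by apply: measurable_funD; exact: measurable_funX.
Qed.

Lemma cintegralB f g : cintegrable f -> cintegrable g ->
  cintegrable (fun x => f x - g x) /\
  cintegral (fun x => f x - g x) = cintegral f - cintegral g.
Proof.
move=> [f1 f2] [g1 g2].
have reE : reF (fun x => f x - g x) = fun x => reF f x - reF g x.
  by apply/funext => x; rewrite /reF; case: (f x) (g x) => [? ?] [? ?].
have imE : imF (fun x => f x - g x) = fun x => imF f x - imF g x.
  by apply/funext => x; rewrite /imF; case: (f x) (g x) => [? ?] [? ?].
have iB (u v : 'rV[R]_n -> R) : mu.-integrable setT (EFin \o u) ->
    mu.-integrable setT (EFin \o v) -> mu.-integrable setT (EFin \o (fun x => u x - v x)).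
  move=> iu iv; have := integrable_addr iu (integrable_mulrl (-1) iv).
  by apply: eq_integrable => [//|] x _; rewrite /= mulN1r.
split; first by split; rewrite ?reE ?imE; exact: iB.
rewrite /cintegral reE imE RintegralB; [|by []|exact: f1|exact: g1].
by rewrite RintegralB; [|by []|exact: f2|exact: g2].
Qed.

Lemma integrable_re_sqr f : cmeasurable f ->
  mu.-integrable setT (EFin \o (fun x => cabs (f x) ^+ 2)) ->
  mu.-integrable setT (EFin \o (fun x => reF f x ^+ 2)) /\
  mu.-integrable setT (EFin \o (fun x => imF f x ^+ 2)).
Proof.
move=> [f1 f2] i; split.
  apply: (@le_integrable _ _ _ mu setT measurableT _ _ _ _ i).
    by apply/measurable_EFinP; exact: measurable_funX.
  move=> x _ /=; rewrite lee_fin (ger0_norm (sqr_ge0 _)) (ger0_norm (sqr_ge0 _)).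
  by rewrite sqr_cabs lerDl sqr_ge0.
apply: (@le_integrable _ _ _ mu setT measurableT _ _ _ _ i).
  by apply/measurable_EFinP; exact: measurable_funX.
move=> x _ /=; rewrite lee_fin (ger0_norm (sqr_ge0 _)) (ger0_norm (sqr_ge0 _)).
by rewrite sqr_cabs lerDr sqr_ge0.
Qed.

Lemma integrable_sqr_cabs f : L2 f ->
  mu.-integrable setT (EFin \o (fun x => cabs (f x) ^+ 2)).
Proof.
move=> [mf foo]; apply/integrableP; split.
  by apply/measurable_EFinP; exact: measurable_sqr_cabs.
rewrite (eq_integral (fun x => (cabs (f x) ^+ 2)%:E))// => x _ /=.
by rewrite ger0_norm// sqr_ge0.
Qed.

Lemma cintegrable_wave_packet_hat g r x : 0 < r -> L2 g ->
  cintegrable (fun y => g y * wave_packet_hat r x y).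
Proof.
move=> r0 Lg; have [g1 g2] := Lg.1.
have [i1 i2] := integrable_re_sqr Lg.1 (integrable_sqr_cabs Lg).
have iw := (integral_gauss_diff x r0).1.
have /measurable_EFinP mw := measurable_int _ iw.
have iw2 : mu.-integrable setT (EFin \o (fun y => gauss (r^-1 *: (y - x)) ^+ 2)).
  apply: (integrable_mulr_bounded (M := 1) iw mw) => y.
  by rewrite ger0_norm ?gauss_ge0 ?gauss_le1.
split.
  have := integrable_mulrl (K / r ^+ n) (integrable_mul_sqr g1 mw i1 iw2).
  apply: eq_integrable => [//|] y _ /=; congr (_%:E).
  by rewrite /reF /wave_packet_hat; case: (g y) => u v /=; rewrite mulr0 subr0 mulrCA.
have := integrable_mulrl (K / r ^+ n) (integrable_mul_sqr g2 mw i2 iw2).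
apply: eq_integrable => [//|] y _ /=; congr (_%:E).
by rewrite /imF /wave_packet_hat; case: (g y) => u v /=; rewrite mulr0 add0r mulrCA.
Qed.

(** Real and imaginary parts of h are treated separately, with bound 2 int |H|^2 for each. The first
    corresponds to (K1, K2) = (Re H, Im H), the second to (Im H, -Re H), since Im(H e^(i theta)) =
    Im H cos theta + Re H sin theta. *)
Lemma complex_sqr_integral_le h H : cmeasurable h -> cmeasurable H ->
  mu.-integrable setT (EFin \o (fun x => cabs (H x) ^+ 2)) ->
  (forall r x, 0 < r -> cintegrable (fun y => h y * wave_packet_hat r x y)) ->
  (forall r x, 0 < r -> cintegral (fun y => h y * wave_packet_hat r x y) =
    cintegral (fun xi => H xi * wave_packet r x xi)) ->
  (\int[mu]_x (cabs (h x) ^+ 2)%:E <= (4 * \int[mu]_x (cabs (H x) ^+ 2))%:E)%E.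
Proof.
move=> mh mH iH ih tr; have [iH1 iH2] := integrable_re_sqr mH iH.
have K0 : 0 < K by exact: lt_le_trans ltr01 (gauss_mass_ge1 R n).
have c0 r : 0 < r -> K / r ^+ n != 0.
  by move=> r0; rewrite mulf_neq0 ?invr_eq0 ?expf_neq0 ?gt_eqF.
have reE r x : reF (fun y => h y * wave_packet_hat r x y) =
    fun y => K / r ^+ n * (reF h y * gauss (r^-1 *: (y - x))).
  apply/funext => y; rewrite /reF /wave_packet_hat; case: (h y) => u v /=.
  by rewrite mulr0 subr0 mulrCA.
have imE r x : imF (fun y => h y * wave_packet_hat r x y) =
    fun y => K / r ^+ n * (imF h y * gauss (r^-1 *: (y - x))).
  apply/funext => y; rewrite /imF /wave_packet_hat; case: (h y) => u v /=.
  by rewrite mulr0 add0r mulrCA.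
have i1 r x : 0 < r ->
    mu.-integrable setT (EFin \o (fun y => reF h y * gauss (r^-1 *: (y - x)))).
  move=> r0; have := (ih r x r0).1; rewrite reE.
  move/(integrable_mulrl (K / r ^+ n)^-1).
  by apply: eq_integrable => [//|] y _ /=; rewrite mulKf// c0.
have i2 r x : 0 < r ->
    mu.-integrable setT (EFin \o (fun y => imF h y * gauss (r^-1 *: (y - x)))).
  move=> r0; have := (ih r x r0).2; rewrite imE.
  move/(integrable_mulrl (K / r ^+ n)^-1).
  by apply: eq_integrable => [//|] y _ /=; rewrite mulKf// c0.
have e1 : (\int[mu]_x (reF h x ^+ 2)%:E <=
    (2 * (\int[mu]_x (reF H x ^+ 2) + \int[mu]_x (imF H x ^+ 2)))%:E)%E.
  apply: (sqr_integral_le mh.1 mH.1 mH.2 iH1 iH2 i1) => r x r0.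
  have := congr1 (@complex.Re R) (tr r x r0); rewrite /cintegral /= reE.
  rewrite RintegralZl; [|by []|exact: i1] => ->; apply: eq_Rintegral => xi _.
  by rewrite /reF /imF /wave_packet; case: (H xi) => u v /=; ring.
have e2 : (\int[mu]_x (imF h x ^+ 2)%:E <=
    (2 * (\int[mu]_x (imF H x ^+ 2) + \int[mu]_x ((- reF H x) ^+ 2)))%:E)%E.
  have mN : measurable_fun setT (fun x => - reF H x).
    by apply: measurableT_comp => //; exact: mH.1.
  have iN : mu.-integrable setT (EFin \o (fun x => (- reF H x) ^+ 2)).
    by apply: eq_integrable iH1 => [//|] x _; rewrite /= sqrrN.
  apply: (sqr_integral_le mh.2 mH.2 mN iH2 iN i2) => r x r0.
  have := congr1 (@complex.Im R) (tr r x r0); rewrite /cintegral /= imE.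
  rewrite RintegralZl; [|by []|exact: i2] => ->; apply: eq_Rintegral => xi _.
  by rewrite /reF /imF /wave_packet; case: (H xi) => u v /=; ring.
have e3 : \int[mu]_x ((- reF H x) ^+ 2) = \int[mu]_x (reF H x ^+ 2).
  by apply: eq_Rintegral => x _; rewrite sqrrN.
rewrite e3 in e2.
have -> : \int[mu]_x (cabs (H x) ^+ 2) =
    \int[mu]_x (reF H x ^+ 2) + \int[mu]_x (imF H x ^+ 2).
  rewrite -RintegralD; [|by []|exact: iH1|exact: iH2].
  by apply: eq_Rintegral => x _; rewrite sqr_cabs.
have -> : (\int[mu]_x (cabs (h x) ^+ 2)%:E =
    \int[mu]_x (reF h x ^+ 2)%:E + \int[mu]_x (imF h x ^+ 2)%:E)%E.
  rewrite -ge0_integralD.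
  - by apply: eq_integral => x _; rewrite sqr_cabs EFinD.
  - by [].
  - by move=> x _; rewrite lee_fin sqr_ge0.
  - by apply/measurable_EFinP; apply: measurable_funX; exact: mh.1.
  - by move=> x _; rewrite lee_fin sqr_ge0.
  - by apply/measurable_EFinP; apply: measurable_funX; exact: mh.2.
apply: le_trans (leeD e1 e2) _; rewrite -EFinD lee_fin.
move: (\int[mu]_x (reF H x ^+ 2)) (\int[mu]_x (imF H x ^+ 2)) => A B.
by rewrite (addrC B) -mulrDl -natrD.
Qed.

End complex_plancherel.

Section evolution.
Variables (R : realType) (n : nat).
Local Notation mu := (lebesgue_rV R n).

Lemma normr_dot_le (m x : 'rV[R]_n) : enorm m = 1 -> `|dot m x| <= enorm x.
Proof.
move=> m1; have mm : dot m m = 1 by rewrite -sqr_enorm m1 expr1n.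
rewrite -ler_sqr ?nnegrE ?enorm_ge0// real_normK ?num_real// sqr_enorm.
(* Cauchy-Schwarz for a unit vector: the component of x orthogonal to m has nonnegative square
   length. *)
have := dot_ge0 (x - dot m x *: m).
rewrite !(dotDl, dotDr, dotNl, dotNr, dotZl, dotZr) mm (dotC x m).
by move: (dot m x) (dot x x) => A B; lra.
Qed.

Lemma sobolev_weight_integrable (s : R) (F : 'rV[R]_n -> R[i]) : cmeasurable F ->
  (sobolev_norm s F < +oo)%E ->
  mu.-integrable setT (EFin \o (fun x => (1 + enorm x ^+ 2) `^ s * cabs (F x) ^+ 2)).
Proof.
move=> mF; rewrite /sobolev_norm => Foo.
have mW : measurable_fun setT (fun x : 'rV[R]_n => (1 + enorm x ^+ 2) `^ s * cabs (F x) ^+ 2).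
  apply: measurable_funM; last exact: measurable_sqr_cabs.
  have m1 : measurable_fun setT (fun x : 'rV[R]_n => 1 + enorm x ^+ 2).
    apply: measurable_funD => //; under eq_fun do rewrite sqr_enorm.
    exact: measurable_dot_diag.
  exact: (measurableT_comp (measurable_powR s) m1).
apply/integrableP; split; first exact/measurable_EFinP.
rewrite (eq_integral (fun x => ((1 + enorm x ^+ 2) `^ s * cabs (F x) ^+ 2)%:E)); last first.
  by move=> x _ /=; rewrite ger0_norm// mulr_ge0 ?powR_ge0 ?sqr_ge0.
(* The norm is the square root of this integral, and an infinite integral has an infinite square
   root. *)
rewrite ltey; apply: contraTN Foo => /eqP ->.
by rewrite poweRyr ?invr_eq0 ?pnatr_eq0// ltxx.
Qed.

(** The definition of the Fourier transform of a distribution, tested on wave packets for both g and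
    f, supplies the transform identity for h by subtraction. The constant 64 is 4 from
    [complex_sqr_integral_le] times 16 from [oscillation_bound]. *)
Lemma evolution_error_le (a beta s t : R) (m : 'rV[R]_n) (T : functional R n)
    (f F u : 'rV[R]_n -> R[i]) :
  enorm m = 1 -> 1 <= a -> 0 < s -> s <= a -> (beta <= 1 -> a * (1 - beta) < s) ->
  0 <= t -> t <= 1 -> represents f T -> represents F (fourier_distr T) ->
  (sobolev_norm s F < +oo)%E -> is_evolution a beta m t T u ->
  let h x := ((2 * pi) ^- n)%:C * u x - f x in
  let rho := if beta <= 1 then 2 * (beta - 1 + s / a) else 2 * s / a in
  cmeasurable h /\
  (\int[mu]_x (cabs (h x) ^+ 2)%:E <= (64 *
    \int[mu]_x ((1 + enorm x ^+ 2) `^ s * cabs (F x) ^+ 2) * t `^ rho)%:E)%E.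
Proof.
move=> m1 a1 s0 sa sb t0 t1 hf hF Foo hu h rho.
pose g x := ((2 * pi) ^- n)%:C * u x.
have [Lg /(_ F hF) hg] : L2 g /\ _ := hu.
pose th xi := t `^ beta * dot m xi + t * enorm xi `^ a.
pose H xi := expi (th xi) * F xi - F xi.
have mh : cmeasurable h by exact: cmeasurableB Lg.1 hf.1.
have mH : cmeasurable H by exact: cmeasurableB hg.1 hF.1.
have iW := sobolev_weight_integrable hF.1 Foo.
have HW x : cabs (H x) ^+ 2 <=
    16 * t `^ rho * ((1 + enorm x ^+ 2) `^ s * cabs (F x) ^+ 2).
  have -> : cabs (H x) ^+ 2 =
      ((cos (th x) - 1) ^+ 2 + sin (th x) ^+ 2) * cabs (F x) ^+ 2.
    by rewrite !sqr_cabs /H /expi; case: (F x) => p q /=; ring.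
  rewrite mulrA ler_wpM2r ?sqr_ge0//.
  apply: (oscillation_bound a1 s0 sa sb t0 t1 (enorm_ge0 x) _ erefl erefl).
  exact: normr_dot_le.
have iH : mu.-integrable setT (EFin \o (fun x => cabs (H x) ^+ 2)).
  have iW' := integrable_mulrl (16 * t `^ rho) iW.
  apply: (@le_integrable _ _ _ mu setT measurableT _ _ _ _ iW').
    by apply/measurable_EFinP; exact: measurable_sqr_cabs.
  move=> x _; rewrite [X in (X <= _)%E]/= [X in (_ <= X)%E]/= lee_fin.
  by rewrite (ger0_norm (sqr_ge0 _)); apply: le_trans (HW x) (ler_norm _).
split => //.
have hatE (r : R) (x : 'rV[R]_n) : 0 < r -> fourier (wave_packet r x) = wave_packet_hat r x.
  exact: fourier_wave_packet.
have sp (r : R) (x : 'rV[R]_n) : 0 < r -> schwartz (wave_packet r x) by exact: schwartz_wave_packet.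
have sph (r : R) (x : 'rV[R]_n) : 0 < r -> schwartz (wave_packet_hat r x).
  exact: schwartz_wave_packet_hat.
(* For g the pairing is integrable because g is square integrable; for f the corresponding fact is
   part of [represents]. *)
have ig (r : R) (x : 'rV[R]_n) : 0 < r -> cintegrable (fun y => g y * wave_packet_hat r x y).
  by move=> r0; exact: cintegrable_wave_packet_hat.
have hE r x : (fun y => h y * wave_packet_hat r x y) =
    fun y => g y * wave_packet_hat r x y - f y * wave_packet_hat r x y.
  by apply/funext => y; rewrite mulrBl.
have HE r x : (fun y => H y * wave_packet r x y) =
    fun y => expi (th y) * F y * wave_packet r x y - F y * wave_packet r x y.
  by apply/funext => y; rewrite mulrBl.
have ih (r : R) (x : 'rV[R]_n) : 0 < r -> cintegrable (fun y => h y * wave_packet_hat r x y).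
  move=> r0; rewrite hE.
  exact: (cintegralB (ig r x r0) (hf.2 _ (sph r x r0)).1).1.
apply: le_trans (complex_sqr_integral_le mh mH iH ih _) _.
  move=> r x r0; rewrite hE HE.
  have [jf ef] := hf.2 _ (sph r x r0).
  have [jF eF] := hF.2 _ (sp r x r0).
  have [jg eg] := hg.2 _ (sp r x r0).
  rewrite (cintegralB (ig r x r0) jf).2 (cintegralB jg jF).2; congr (_ - _).
    by move: eg; rewrite /fourier_distr hatE.
  by rewrite -/(distr_of f _) -ef -/(distr_of F _) -eF /fourier_distr hatE.
rewrite lee_fin; apply: (@le_trans _ _ (4 * (16 * t `^ rho *
   \int[mu]_x ((1 + enorm x ^+ 2) `^ s * cabs (F x) ^+ 2)))).
  apply: ler_wpM2l; first exact: ler0n.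
  rewrite -RintegralZl; [|by []|exact: iW].
  apply: le_Rintegral; [by []|exact: iH|exact: (integrable_mulrl _ iW)|].
  by move=> x _; exact: HW.
move: (Rintegral _ _ _) (t `^ rho) => A B.
by rewrite le_eqVlt; apply/orP; left; apply/eqP; ring.
Qed.

End evolution.

(** * Almost everywhere convergence *)

Lemma cvg_complex_sqr_cabs (R : realType) (g : nat -> R[i]) (l : R[i]) :
  cabs (g k - l) ^+ 2 @[k --> \oo] --> (0 : R) ->
  (g : nat -> R[i]^o) @ \oo --> (l : R[i]^o).
Proof.
move=> gl; apply/cvgrPdist_lt => e.
(* The radius e is itself complex: its positivity means a zero imaginary part and a positive real
   part. *)
rewrite ltcE/= => /andP[/eqP e2 e1].
have e20 : 0 < complex.Re e ^+ 2 by rewrite exprn_gt0.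
move/cvgrPdist_lt : gl => /(_ _ e20); apply: filterS => k.
rewrite sub0r normrN ger0_norm ?sqr_ge0// => h.
rewrite distrC ltcE; apply/andP; split; first by rewrite e2; case: (g k - l).
have : cabs (g k - l) < complex.Re e.
  by rewrite -(@ltr_pXn2r _ 2)// nnegrE ?(ltW e1)// cabsE sqrtr_ge0.
by [].
Qed.

Lemma ae_cvg_of_summable (R : realType) (n : nat)
    (h : nat -> 'rV[R]_n -> R[i]) (N : nat) (w : nat -> R) :
  (forall k, (N <= k)%N -> cmeasurable (h k)) ->
  (forall k, 0 <= w k) ->
  (\sum_(0 <= k <oo) (w k)%:E < +oo)%E ->
  (forall k, (N <= k)%N ->
    (\int[lebesgue_rV R n]_x (cabs (h k x) ^+ 2)%:E <= (w k)%:E)%E) ->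
  {ae lebesgue_rV R n, forall x, cabs (h k x) ^+ 2 @[k --> \oo] --> (0 : R)}.
Proof.
(* The terms below N, about which nothing is assumed, are replaced by 0; this does not change the
   limit. *)
move=> mh w0 woo hw; set mu := lebesgue_rV R n.
pose f k x : \bar R := if (N <= k)%N then (cabs (h k x) ^+ 2)%:E else 0%E.
have f0 k x : (0 <= f k x)%E by rewrite /f; case: ifP => // _; rewrite lee_fin sqr_ge0.
have mf k : measurable_fun setT (f k).
  rewrite /f; case: (leqP N k) => Nk; last exact: measurable_cst.
  by apply/measurable_EFinP; apply: measurable_sqr_cabs; exact: mh.
have S : (\int[mu]_x \sum_(0 <= k <oo) f k x < +oo)%E.
  rewrite integral_nneseries//; apply: le_lt_trans woo.
  apply: lee_nneseries => [k _ _|k _]; first exact: integral_ge0.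
  rewrite /f; case: (leqP N k) => Nk; first exact: hw.
  by rewrite integral0 lee_fin.
have mS : measurable_fun setT (fun x => \sum_(0 <= k <oo) f k x)%E.
  exact: ge0_emeasurable_sum.
have S0 x : (0 <= \sum_(0 <= k <oo) f k x)%E by exact: nneseries_ge0.
have iS : mu.-integrable setT (fun x => \sum_(0 <= k <oo) f k x)%E.
  apply/integrableP; split => //; apply: le_lt_trans S.
  by apply: ge0_le_integral => // [|x _]; [exact: measurableT_comp|rewrite gee0_abs].
apply: filterS (integrable_ae measurableT iS) => x /(_ I) xfin.
have foo : (\sum_(0 <= k <oo) f k x < +oo)%E by rewrite ltey_eq xfin.
have := nneseries_lty_cvg0 (fun k => f0 k x) foo.
move/fine_cvg; apply: cvg_trans; apply: near_eq_cvg.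
by exists N => // k /= Nk; rewrite /f Nk.
Qed.
Theorem theorem1p4 (R : realType) (n : nat) (hn : (1 <= n)%N)
  (mu : 'rV[R]_n) (hmu : enorm mu = 1)
  (beta a s : R) (ha : 1 <= a) (hs0 : 0 < s) (hsa : s <= a)
  (hsb : beta <= 1 -> a * (1 - beta) < s)
  (t : nat -> R) (ht0 : forall k, 0 <= t k) (ht : t @ \oo --> (0 : R))
  (hsum_gt1 : 1 < beta ->
    (\sum_(0 <= k <oo) (t k `^ (2 * s / a))%:E < +oo)%E)
  (hsum_le1 : beta <= 1 ->
    (\sum_(0 <= k <oo) (t k `^ (2 * (beta - 1 + s / a)))%:E < +oo)%E)
  (T : functional R n) (hT : sobolev s T)
  (f : 'rV[R]_n -> R[i]) (hf : represents f T)
  (Sf : nat -> 'rV[R]_n -> R[i])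
  (hSf : forall k, is_evolution a beta mu (t k) T (Sf k)) :
  {ae lebesgue_rV R n, forall x : 'rV[R]_n,
    (fun k => ((2 * pi) ^- n)%:C * Sf k x : R[i]^o) @ \oo
      --> (f x : R[i]^o)}.

Proof.
have [_ [F [hF Foo]]] := hT.
(* The symbol bound compares powers of t and holds for t <= 1, so finitely many indices are set
   aside. *)
have [N _ tN] : \forall k \near \oo, t k <= 1.
  by apply: (cvgr_le (0 : R) ht).
pose rho := if beta <= 1 then 2 * (beta - 1 + s / a) else 2 * s / a.
pose S := \int[lebesgue_rV R n]_x ((1 + enorm x ^+ 2) `^ s * cabs (F x) ^+ 2).
pose h k x := ((2 * pi) ^- n)%:C * Sf k x - f x.
have S0 : 0 <= S.
  by apply: Rintegral_ge0 => x _; rewrite mulr_ge0 ?powR_ge0 ?sqr_ge0.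
have E k : (N <= k)%N -> cmeasurable (h k) /\
    (\int[lebesgue_rV R n]_x (cabs (h k x) ^+ 2)%:E <= (64 * S * t k `^ rho)%:E)%E.
  move=> Nk; exact: (evolution_error_le hmu ha hs0 hsa hsb (ht0 k) (tN k Nk) hf hF Foo (hSf k)).
have rhooo : (\sum_(0 <= k <oo) (t k `^ rho)%:E < +oo)%E.
  rewrite /rho; case: (leP beta 1) => b1; first exact: hsum_le1.
  exact: hsum_gt1.
have woo : (\sum_(0 <= k <oo) (64 * S * t k `^ rho)%:E < +oo)%E.
  under eq_eseriesr do rewrite EFinM.
  rewrite nneseriesZl; last by move=> k _; rewrite lee_fin powR_ge0.
  by rewrite lte_mul_pinfty// lee_fin mulr_ge0.
have w0 k : 0 <= 64 * S * t k `^ rho by rewrite !mulr_ge0 ?powR_ge0.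
apply: filterS (ae_cvg_of_summable (fun k Nk => (E k Nk).1) w0 woo
  (fun k Nk => (E k Nk).2)) => x hx.
exact: cvg_complex_sqr_cabs.
Qed.
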